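(* Let $d\ge2$. As $\lambda\downarrow0$, the distribution of the random simplex $Z_\lambda$ (the typical cell of $\mathcal{D}_{\lambda^{d-1},\lambda}$) converges weakly to the distribution of $Z^{\mathrm{PD}}_{1/(d-1)}$ (the typical cell of the Poisson--Delaunay tessellation $\mathcal{D}_{1/(d-1)}$ of $\mathbb{R}^{d-1}$).
   Context: $\mathbb{H}^d$ is hyperbolic space in the upper halfspace model $\mathbb{R}^{d-1}\times(0,\infty)$ with volume measure $d\mathrm{vol}_{\mathbb{H}^d}(v,y)=y^{-d}\,dv\,dy$. For $\gamma,\lambda>0$ let $\eta_{\gamma,\lambda}$ be a Poisson point process on $\mathbb{H}^d$ with intensity measure $\gamma\,\mathrm{vol}_{\mathbb{H}^d}$ restricted to the horoball $\{(v,y):y\ge\lambda\}$. $\mathcal{D}_{\gamma,\lambda}$ is the (almost surely locally finite, simplicial, stationary) random tessellation of $\mathbb{R}^{d-1}$ consisting of all simplices $[v_1,\dots,v_d]$ (Euclidean convex hulls) such that $(v_1,y_1),\dots,(v_d,y_d)$ are pairwise distinct points of $\eta_{\gamma,\lambda}$, $v_1,\dots,v_d$ are affinely independent, and the unique half-ball $\{(v,y)\in\mathbb{R}^{d-1}\times(0,\infty):\|v-w\|^2+y^2\le r^2\}$ whose bounding hemisphere contains these $d$ points has no point of $\eta_{\gamma,\lambda}$ in its interior. For $c>0$, $\mathcal{D}_c$ (single index) denotes the classical Poisson--Delaunay tessellation of $\mathbb{R}^{d-1}$ of intensity $c$: the collection of simplices $[x_1,\dots,x_d]$ with $x_1,\dots,x_d$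 distinct points of a homogeneous Poisson point process on $\mathbb{R}^{d-1}$ of intensity $c$ whose open circumscribed ball contains no points of the process. The typical cell $Z$ of a stationary simplicial tessellation $\mathcal{T}$ of $\mathbb{R}^{d-1}$ with finite positive cell intensity $\xi$ is understood in the sense of Palm distributions: with $c(C)$ the barycentre of a cell $C$, $$\mathbb{P}(Z\in\mathcal{A})=\frac{1}{\xi\,\mathrm{vol}_{\mathbb{R}^{d-1}}(W)}\,\mathbb{E}\sum_{C\in\mathcal{T}}\mathbf 1\{c(C)\in W\}\,\mathbf 1\{C-c(C)\in\mathcal{A}\}$$ for Borel sets $\mathcal{A}$ of compact convex sets (Hausdorff metric) and any bounded Borel $W\subset\mathbb{R}^{d-1}$ of positive volume, where $\xi=\frac{1}{\mathrm{vol}_{\mathbb{R}^{d-1}}(W)}\mathbb{E}\,\#\{C\in\mathcal{T}:c(C)\in W\}$. Weak convergence is with respect to the Hausdorff metric on compact convex sets. *)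

(* Defs.v *)
From HB Require Import structures.
From mathcomp Require Import all_boot all_order all_algebra.
From mathcomp Require Import ring lra.
From mathcomp Require Import all_classical all_reals all_analysis.
From mathcomp Require Import measurable_realfun.

Set Implicit Arguments.
Unset Strict Implicit.
Unset Printing Implicit Defensive.

Import Order.TTheory GRing.Theory Num.Theory.
Import numFieldNormedType.Exports.

Local Open Scope classical_set_scope.
Local Open Scope ring_scope.

(* The library's norm [`|v|] on ['rV[R]_n] is the maximum norm; the Euclidean
   norm has to be defined. *)
Definition enorm {R : realType} {n : nat} (v : 'rV[R]_n) : R :=
  Num.sqrt (\sum_i v ord0 i ^+ 2).

Section enorm_theory.
Context {R : realType} {n : nat}.
Implicit Types u v : 'rV[R]_n.

Lemma sumsq_ge0 v : 0 <= \sum_i v ord0 i ^+ 2.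
Proof. by apply: sumr_ge0 => i _; exact: sqr_ge0. Qed.

Lemma enorm_ge0 v : 0 <= enorm v.
Proof. exact: sqrtr_ge0. Qed.

Lemma enorm_sqr v : enorm v ^+ 2 = \sum_i v ord0 i ^+ 2.
Proof. by rewrite /enorm sqr_sqrtr// sumsq_ge0. Qed.

Lemma enorm0 : enorm (0 : 'rV[R]_n) = 0.
Proof.
rewrite /enorm big1 ?sqrtr0// => i _.
by rewrite mxE expr0n.
Qed.

Lemma enormN v : enorm (- v) = enorm v.
Proof. by congr Num.sqrt; apply: eq_bigr => i _; rewrite mxE sqrrN. Qed.

Lemma enormB u v : enorm (u - v) = enorm (v - u).
Proof. by rewrite -enormN opprB. Qed.

Lemma le_coord_enorm v i : `|v ord0 i| <= enorm v.
Proof.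
rewrite -sqrtr_sqr ler_sqrt ?sumsq_ge0// (bigD1 i)//= lerDl.
by apply: sumr_ge0 => j _; exact: sqr_ge0.
Qed.

Lemma le_norm_enorm v : `|v| <= enorm v.
Proof.
rewrite /Num.norm/= mx_normrE; apply/bigmax_leP; split; first exact: enorm_ge0.
by move=> [i j] _ /=; rewrite (ord1 i); exact: le_coord_enorm.
Qed.

Lemma enorm_dot u v :
  \sum_i u ord0 i * v ord0 i <= enorm u * enorm v.
Proof.
have [u0|u0] := eqVneq (enorm u) 0.
  rewrite big1 ?u0 ?mul0r// => i _.
  by have := le_coord_enorm u i; rewrite u0 normr_le0 => /eqP ->; rewrite mul0r.
have [v0|v0] := eqVneq (enorm v) 0.
  rewrite big1 ?v0 ?mulr0// => i _.
  by have := le_coord_enorm v i; rewrite v0 normr_le0 => /eqP ->; rewrite mulr0.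
have up : 0 < enorm u by rewrite lt_neqAle eq_sym u0 enorm_ge0.
have vp : 0 < enorm v by rewrite lt_neqAle eq_sym v0 enorm_ge0.
have : 0 <= \sum_i (enorm v * u ord0 i - enorm u * v ord0 i) ^+ 2.
  by apply: sumr_ge0 => i _; exact: sqr_ge0.
rewrite (eq_bigr (fun i => enorm v ^+ 2 * u ord0 i ^+ 2 +
    enorm u ^+ 2 * v ord0 i ^+ 2 -
    2 * enorm u * enorm v * (u ord0 i * v ord0 i))); last by move=> i _; ring.
rewrite big_split/= sumrN big_split/= -!mulr_sumr -!enorm_sqr.
set S := \sum_i _ => h.
have : 0 <= 2 * (enorm u * enorm v) * (enorm u * enorm v - S).
  rewrite [leRHS](_ : _ = enorm v ^+ 2 * enorm u ^+ 2 +
    enorm u ^+ 2 * enorm v ^+ 2 - 2 * enorm u * enorm v * S)//; ring.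
by rewrite pmulr_rge0 ?subr_ge0// !mulr_gt0.
Qed.

Lemma ler_enormD u v : enorm (u + v) <= enorm u + enorm v.
Proof.
rewrite -(@ler_pXn2r _ 2) ?nnegrE ?addr_ge0 ?enorm_ge0// enorm_sqr.
rewrite (eq_bigr (fun i => u ord0 i ^+ 2 + v ord0 i ^+ 2 +
  2 * (u ord0 i * v ord0 i))); last by move=> i _; rewrite mxE; ring.
rewrite !big_split/= -mulr_sumr -!enorm_sqr sqrrD -mulr_natl.
have := enorm_dot u v; lra.
Qed.

Lemma ler_enorm_dist w u v : enorm (u - v) <= enorm (u - w) + enorm (w - v).
Proof. by rewrite (le_trans _ (ler_enormD _ _))// addrA subrK. Qed.

Lemma enorm_le_norm v : enorm v <= n%:R * `|v|.
Proof.
rewrite -(@ler_pXn2r _ 2) ?nnegrE ?mulr_ge0 ?enorm_ge0// enorm_sqr.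
have vi i : v ord0 i ^+ 2 <= `|v| ^+ 2.
  rewrite -[leLHS]real_normK ?num_real// lerXn2r ?nnegrE//.
  rewrite {2}/Num.norm/= mx_normrE.
  exact: (le_bigmax _ (fun ij => `|v ij.1 ij.2|) (ord0, i)).
apply: le_trans (ler_sum _ (fun i _ => vi i)) _.
rewrite sumr_const card_ord -(mulr_natl (`|v| ^+ 2)) exprMn ler_wpM2r ?exprn_ge0//.
by rewrite -natrX ler_nat; case: (n) => // m; rewrite leq_pmull.
Qed.

End enorm_theory.

(* Nonempty compact convex subsets of R^n. *)
Record compact_convex (R : realType) (n : nat) := CompactConvex {
  cc_set :> set 'rV[R]_n ;
  cc_nonempty : cc_set !=set0 ;
  cc_compact : compact cc_set ;
  cc_convex : @convex_set R 'rV[R]_n cc_set }.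

HB.instance Definition _ (R : realType) (n : nat) :=
  gen_eqMixin (compact_convex R n).
HB.instance Definition _ (R : realType) (n : nat) :=
  gen_choiceMixin (compact_convex R n).

Definition fattening {R : realType} {n : nat} (r : R) (A : set 'rV[R]_n) :
    set 'rV[R]_n :=
  [set v | exists2 a, A a & enorm (v - a) <= r].

Definition hausdorff_dist {R : realType} {n : nat} (A B : set 'rV[R]_n) : R :=
  inf [set r | [/\ 0 <= r, A `<=` fattening r B & B `<=` fattening r A]].

Section hausdorff_metric.
Context {R : realType} {n : nat}.
Local Notation K := (compact_convex R n).
Implicit Types A B C : K.

Let S (A B : set 'rV[R]_n) : set R :=
  [set r | [/\ 0 <= r, A `<=` fattening r B & B `<=` fattening r A]].

Lemma compact_convex_eq A B : cc_set A = cc_set B -> A = B.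
Proof.
case: A B => [A a1 a2 a3] [B b1 b2 b3] /= AB; subst B.
by congr CompactConvex; exact: Prop_irrelevance.
Qed.

Let S_nonempty A B : S A B !=set0.
Proof.
have bnd (D : K) : exists M, forall v, cc_set D v -> enorm v <= M.
  have /compact_bounded[M [_ MD]] := @cc_compact _ _ D.
  exists (n%:R * (M + 1)) => v Dv.
  apply: le_trans (enorm_le_norm v) _; rewrite ler_wpM2l//.
  by apply: (MD (M + 1)) => //; rewrite ltrDl.
have [[a Aa] [b Bb]] := (@cc_nonempty _ _ A, @cc_nonempty _ _ B).
have [[MA hA] [MB hB]] := (bnd A, bnd B).
have dAB x y : cc_set A x -> cc_set B y -> enorm (x - y) <= MA + MB.
  move=> Ax By; apply: le_trans (ler_enormD _ _) _.
  by rewrite enormN lerD// ?hA ?hB.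
exists (MA + MB); split.
- by rewrite (le_trans (enorm_ge0 (a - b)))// dAB.
- by move=> x Ax; exists b => //; exact: dAB.
- by move=> y By; exists a => //; rewrite enormB; exact: dAB.
Qed.

Let S_lb A B : lbound (S A B) 0. Proof. by move=> r []. Qed.

Let S_inf A B : has_inf (S A B).
Proof. by split; [exact: S_nonempty|exists 0; exact: S_lb]. Qed.

Let S_sym (A B : set 'rV[R]_n) : S A B = S B A.
Proof. by apply/seteqP; split => r [r0 h1 h2]; split. Qed.

Let dist (A B : K) := hausdorff_dist A B.

Lemma hausdorff_distxx A : dist A A = 0.
Proof.
apply/eqP; rewrite eq_le; apply/andP; split; last exact: lb_le_inf (S_nonempty _ _) (@S_lb _ _).
apply: ge_inf; first by exists 0; exact: S_lb.
by split => // v Av; exists v => //; rewrite subrr enorm0.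
Qed.

Lemma hausdorff_dist_eq0 A B : dist A B = 0 -> A = B.
Proof.
move=> AB0; apply: compact_convex_eq.
suff sub A' B' : dist A' B' = 0 -> (A' : set 'rV[R]_n) `<=` B'.
  apply/seteqP; split; apply: sub => //.
  by rewrite /dist /hausdorff_dist -/(S _ _) S_sym.
move=> {A B AB0} d0 a Aa.
have clB : closed (cc_set B').
  exact: compact_closed (@norm_hausdorff _ _) (@cc_compact _ _ B').
apply: clB => U /nbhs_ballP[e/= e0 eU].
have [r [r0 rA rB] re] := inf_adherent e0 (S_inf A' B').
move: re; rewrite -/(hausdorff_dist A' B') -/(dist A' B') d0 add0r => re.
have [b Bb ab] := rA a Aa; exists b; split => //; apply: eU.
rewrite mx_norm_ball /ball_/=.
exact: le_lt_trans (le_norm_enorm _) (le_lt_trans ab re).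
Qed.

Lemma hausdorff_dist_sym A B : dist A B = dist B A.
Proof. by rewrite /dist /hausdorff_dist -/(S _ _) S_sym. Qed.

Lemma hausdorff_dist_triangle B A C : dist A C <= dist A B + dist B C.
Proof.
have fat (D E F : K) r s : (D : set _) `<=` fattening r E ->
    (E : set _) `<=` fattening s F -> (D : set _) `<=` fattening (r + s) F.
  move=> DE EF d /DE[e Ee de]; have [f Ff ef] := EF e Ee; exists f => //.
  by apply: le_trans (ler_enorm_dist e _ _) _; exact: lerD.
rewrite -lerBlDr; apply: lb_le_inf; first exact: S_nonempty.
move=> r [r0 AB BA]; rewrite lerBlDr -lerBlDl.
apply: lb_le_inf; first exact: S_nonempty.
move=> s [s0 BC CB]; rewrite lerBlDl.
apply: ge_inf; first by exists 0; exact: S_lb.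
split; [exact: addr_ge0|exact: fat AB BC|].
by rewrite addrC; exact: fat CB BA.
Qed.

HB.instance Definition _ := @isMetric.Build R K dist hausdorff_distxx
  hausdorff_dist_eq0 hausdorff_dist_sym hausdorff_dist_triangle.

Lemma set1_convex (v : 'rV[R]_n) : @convex_set R 'rV[R]_n [set v].
Proof. by move=> x y l; rewrite !inE => -> ->; rewrite convmm. Qed.

Lemma set1_compact (v : 'rV[R]_n) : compact [set v].
Proof. exact: compact_set1. Qed.

HB.instance Definition _ := isPointed.Build K
  (CompactConvex (ex_intro _ 0 erefl : [set 0] !=set0) (@set1_compact 0)
    (@set1_convex 0)).

End hausdorff_metric.

(* Borel sigma-algebras. *)
HB.instance Definition _ (R : realType) (n : nat) :=
  Measurable.copy (compact_convex R n)
    (g_sigma_algebraType (@open (compact_convex R n))).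
HB.instance Definition _ (R : realType) (n : nat) :=
  Measurable.copy 'rV[R]_n (g_sigma_algebraType (@open 'rV[R]_n)).

(* Lebesgue measure, by iterated product along R^(m+1) = R x R^m. *)
Fixpoint lebesgue_rV (R : realType) (n : nat) : set 'rV[R]_n -> \bar R :=
  if n is m.+1 then
    pushforward (@lebesgue_measure R \x @lebesgue_rV R m)%E
      (fun z : R * 'rV[R]_m => row_mx z.1%:M z.2 : 'rV[R]_(1 + m))
  else \d_(0 : 'rV[R]_0).

Section lebesgue_rV_measure.
Context {R : realType}.

Let ratv m (q : 'rV[rat]_m) : 'rV[R]_m := map_mx (@ratr R) q.

Let dense_rat (x e : R) : 0 < e -> exists q : rat, `|x - ratr q| < e.
Proof.
move=> e0; have /(@rat_in_itvoo R)[q] : x - e < x + e by lra.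
rewrite in_itv/= => /andP[h1 h2]; exists q; rewrite ltr_norml; lra.
Qed.

Let dense_ratv m (v : 'rV[R]_m) (e : R) : 0 < e ->
  exists q : 'rV[rat]_m, ball (ratv q) e v.
Proof.
move=> e0; have /choice[q qP] : forall i, exists q : rat,
    `|v ord0 i - ratr q| < e by move=> i; exact: dense_rat.
exists (\row_i q i); split => // i j; rewrite /ball/= (ord1 i) !mxE distrC.
exact: qP.
Qed.

Lemma open_measurable_prod m (U : set (R * 'rV[R]_m)) : open U -> measurable U.
Proof.
move=> oU.
pose B (t : rat * 'rV[rat]_m * nat) : set (R * 'rV[R]_m) :=
  ball (ratr t.1.1 : R) t.2.+1%:R^-1 `*` ball (ratv t.1.2) t.2.+1%:R^-1.
have mB t : measurable (B t).
  apply: measurableX; first by apply: open_measurable; exact: ball_open.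
  by apply: sub_gen_smallest; exact: ball_open.
have -> : U = \bigcup_(t in [set t | B t `<=` U]) B t.
  apply/seteqP; split => [x Ux|x [t /= BU Bx]]; last exact: BU.
  have /nbhs_ballP[e /= e0 eU] : nbhs x U by exact: open_nbhs_nbhs.
  have [k ke] : exists k : nat, k.+1%:R^-1 < e / 2.
    have : 0 < e / 2 by rewrite divr_gt0.
    move=> h; have [k _ /(_ k)/= kh] := near_infty_natSinv_lt (PosNum h).
    by exists k; exact: kh.
  have k0 : 0 < k.+1%:R^-1 :> R by rewrite invr_gt0.
  have [q qx] := dense_rat x.1 k0.
  have [p px] := dense_ratv x.2 k0.
  exists (q, p, k); last by split => //=; rewrite /ball/= distrC.
  move=> y [/= yq yp]; apply: eU; rewrite [e]splitr; split.
    apply: ball_triangle (le_ball (ltW ke) _) (le_ball (ltW ke) yq).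
    exact: qx.
  by apply: ball_triangle (le_ball (ltW ke) _) (le_ball (ltW ke) yp);
     exact: ball_sym.
rewrite bigcup_mkcond; apply: countable_bigcupT_measurable.
  exact: countableP.
by move=> t; case: ifP.
Qed.

Let rV_cons m (z : R * 'rV[R]_m) : 'rV[R]_(1 + m) := row_mx z.1%:M z.2.

Let rV_cons_continuous m : continuous (@rV_cons m).
Proof.
move=> z; apply/cvg_ballP => e e0; near=> y.
have : ball z e y by near: y; exact: (nbhsx_ballx z e e0).
move=> [h1 h2]; split => // i j; rewrite (ord1 i) /rV_cons.
case: (split_ordP j) => k ->; rewrite ?row_mxEl ?row_mxEr; last exact: h2.2.
by rewrite (ord1 k) !mxE.
Unshelve. all: by end_near. Qed.

Lemma rV_cons_measurable m : measurable_fun setT (@rV_cons m).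
Proof.
apply: (@measurability _ _ _ _ _ _ (@open 'rV[R]_(1 + m))) => //.
move=> _ [U oU <-]; rewrite setTI; apply: open_measurable_prod.
by apply: open_comp oU => z _; exact: rV_cons_continuous.
Qed.

Let cball n (k : nat) : set 'rV[R]_n := ball 0 k%:R.

Let measurable_cball n k : measurable (@cball n k).
Proof. by apply: sub_gen_smallest; exact: ball_open. Qed.

Let sigma_finite_cball n (mu : {measure set 'rV[R]_n -> \bar R}) :
  (forall k, (mu (cball k) < +oo)%E) -> sigma_finite setT mu.
Proof.
move=> fmu; exists (@cball n) => //.
apply/esym/seteqP; split => // v _.
exists (Num.bound `|v|) => //; rewrite /cball mx_norm_ball /ball_/= sub0r normrN.
exact: archi_boundP.
Qed.

Let sf n (mu : {measure set 'rV[R]_n -> \bar R})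
  of (forall k, (mu (cball k) < +oo)%E) : set 'rV[R]_n -> \bar R := mu.

HB.instance Definition _ n mu fmu := Measure.on (@sf n mu fmu).
HB.instance Definition _ n mu fmu :=
  @Measure_isSigmaFinite.Build _ _ _ (@sf n mu fmu) (sigma_finite_cball fmu).

Let rV_cons_cball m k : @rV_cons m @^-1` @cball (1 + m) k =
  ball (0 : R) k%:R `*` @cball m k.
Proof.
apply/seteqP; split => -[x v] /=.
  move=> [k0 h]; split.
    have := h ord0 (lshift m (ord0 : 'I_1)).
    by rewrite /rV_cons/= row_mxEl !mxE eqxx mulr1n.
  split => // i j; have := h i (rshift 1 j).
  by rewrite /rV_cons/= row_mxEr !mxE.
move=> [xk [k0 vk]]; split => // i j; rewrite (ord1 i) /rV_cons.
case: (split_ordP j) => l -> /=; rewrite ?row_mxEl ?row_mxEr.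
  by rewrite (ord1 l) !mxE eqxx mulr1n.
by have := vk ord0 l; rewrite !mxE.
Qed.

Let lebesgue_rV_ex n : exists2 mu : {measure set 'rV[R]_n -> \bar R},
  (mu : set _ -> _) = @lebesgue_rV R n & forall k, (mu (cball k) < +oo)%E.
Proof.
elim: n => [|m [mu muE fmu]].
  exists (\d_(0 : 'rV[R]_0)) => // k.
  by rewrite (le_lt_trans (probability_le1 _ _)) ?ltry.
pose nu : {measure set (measurableTypeR R * 'rV[R]_m)%type -> \bar R} :=
  (@lebesgue_measure R \x sf fmu)%E.
exists (pushforward nu (@rV_cons m)).
  by rewrite /= -muE.
move=> k.
rewrite [ltLHS](_ : _ = nu (ball (0 : R) k%:R `*` @cball m k)); last first.
  exact: (congr1 (fun U => nu U) (@rV_cons_cball m k)).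
have mb : measurable (ball (0 : R) k%:R) by apply: open_measurable; exact: ball_open.
rewrite [ltLHS]product_measure1E//.
apply: lte_mul_pinfty; [exact: measure_ge0| |exact: fmu].
by have /= -> := @lebesgue_measure_ball R 0 k%:R (ler0n _ _).
Unshelve. all: exact: rV_cons_measurable. Qed.

Let lebesgue_rV0 n : @lebesgue_rV R n set0 = 0%E.
Proof. by have [mu <- _] := lebesgue_rV_ex n; exact: measure0. Qed.

Let lebesgue_rV_ge0 n A : (0 <= @lebesgue_rV R n A)%E.
Proof. by have [mu <- _] := lebesgue_rV_ex n; exact: measure_ge0. Qed.

Let lebesgue_rV_sigma_additive n : semi_sigma_additive (@lebesgue_rV R n).
Proof.
by have [mu <- _] := lebesgue_rV_ex n; exact: measure_semi_sigma_additive.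
Qed.

HB.instance Definition _ n := isMeasure.Build _ _ _ (@lebesgue_rV R n)
  (@lebesgue_rV0 n) (@lebesgue_rV_ge0 n) (@lebesgue_rV_sigma_additive n).

Let lebesgue_rV_sigma_finite n : sigma_finite setT (@lebesgue_rV R n).
Proof.
by have [mu <- fmu] := lebesgue_rV_ex n; exact: sigma_finite_cball fmu.
Qed.

HB.instance Definition _ n := Measure_isSigmaFinite.Build _ _ _
  (@lebesgue_rV R n) (@lebesgue_rV_sigma_finite n).

End lebesgue_rV_measure.

(* A point process is represented by its random set of points, which loses no
   generality for intensity measures without atoms.  The second argument of
   the library's [poisson_prob] is a dummy. *)
Definition is_poisson_process {R : realType} {dO : measure_display}
    {Omega : measurableType dO} (P : probability Omega R)
    {dX : measure_display} {X : measurableType dX}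
    (intensity : set X -> \bar R) (eta : Omega -> set X) : Prop :=
  let N (B : set X) (w : Omega) : \bar R := counting (eta w `&` B) in
  [/\ forall B, measurable B -> measurable_fun setT (N B),
      forall (B : set X) (r : R) (k : nat), measurable B ->
        intensity B = r%:E ->
        P [set w | N B w = k%:R%:E] = poisson_prob r 0 [set k] &
      forall (m : nat) (B : 'I_m -> set X) (U : 'I_m -> set \bar R),
        (forall i, measurable (B i)) -> trivIset setT B ->
        (forall i, measurable (U i)) ->
        P [set w | forall i, U i (N (B i) w)] =
        (\prod_(i < m) P [set w | U i (N (B i) w)])%E].

(* The upper halfspace model of hyperbolic d-space is the part [0 < z.2] of
   ['rV[R]_d.-1 * R]. *)
Definition hyperbolic_volume {R : realType} (d : nat)
    (B : set ('rV[R]_d.-1 * R)) : \bar R :=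
  (\int[@lebesgue_rV R d.-1 \x @lebesgue_measure R]_(z in
      B `&` [set z : 'rV[R]_d.-1 * R | (0 < z.2)%R]) (z.2 ^- d)%R%:E)%E.
Arguments hyperbolic_volume {R} d B.

Definition horoball {R : realType} (d : nat) (lambda : R) :
    set ('rV[R]_d.-1 * R) :=
  [set z | lambda <= z.2].
Arguments horoball {R} d lambda _.

Definition horoball_intensity {R : realType} (d : nat) (gamma lambda : R)
    (B : set ('rV[R]_d.-1 * R)) : \bar R :=
  (gamma%:E * hyperbolic_volume d (B `&` horoball d lambda))%E.
Arguments horoball_intensity {R} d gamma lambda B.

Definition homogeneous_intensity {R : realType} (n : nat) (c : R)
    (B : set 'rV[R]_n) : \bar R :=
  (c%:E * lebesgue_rV B)%E.

Definition affinely_independent {R : realType} {n m : nat}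
    (x : 'I_m -> 'rV[R]_n) : Prop :=
  forall a : 'I_m -> R,
    \sum_i a i = 0 -> \sum_i a i *: x i = 0 -> forall i, a i = 0.

Definition hull {R : realType} {n m : nat} (x : 'I_m -> 'rV[R]_n) :
    set 'rV[R]_n :=
  [set v | exists a : 'I_m -> R,
    [/\ forall i, 0 <= a i, \sum_i a i = 1 & v = \sum_i a i *: x i]].

(* Affine independence of the [(p i).1] makes the half-ball, given by its centre
   [w] and radius [r], unique. *)
Definition hyperbolic_delaunay {R : realType} (d : nat)
    (eta : set ('rV[R]_d.-1 * R)) : set (set 'rV[R]_d.-1) :=
  [set C | exists p : 'I_d -> 'rV[R]_d.-1 * R,
    [/\ injective p, forall i, eta (p i),
        affinely_independent (fun i => (p i).1),
        exists (w : 'rV[R]_d.-1) (r : R),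
          [/\ 0 < r,
              forall i, enorm ((p i).1 - w) ^+ 2 + (p i).2 ^+ 2 = r ^+ 2 &
              forall q, eta q -> ~ enorm (q.1 - w) ^+ 2 + q.2 ^+ 2 < r ^+ 2] &
        C = hull (fun i => (p i).1)]].
Arguments hyperbolic_delaunay {R} d eta _.

Definition delaunay {R : realType} (d : nat) (eta : set 'rV[R]_d.-1) :
    set (set 'rV[R]_d.-1) :=
  [set C | exists x : 'I_d -> 'rV[R]_d.-1,
    [/\ injective x, forall i, eta (x i), affinely_independent x,
        exists (w : 'rV[R]_d.-1) (r : R),
          [/\ 0 < r, forall i, enorm (x i - w) = r &
              forall q, eta q -> ~ enorm (q - w) < r] &
        C = hull x]].
Arguments delaunay {R} d eta _.

(* The barycentre of a (d-1)-simplex is the mean of its d vertices, see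
   [barycentre_hull]; it is 0 by convention for other sets. *)
Definition barycentre {R : realType} (d : nat) (C : set 'rV[R]_d.-1) :
    'rV[R]_d.-1 :=
  xget 0 [set c | exists x : 'I_d -> 'rV[R]_d.-1,
    [/\ affinely_independent x, C = hull x & c = d%:R^-1 *: \sum_i x i]].
Arguments barycentre {R} d C.

Definition recentred {R : realType} (d : nat) (C : set 'rV[R]_d.-1) :
    set 'rV[R]_d.-1 :=
  [set v - barycentre d C | v in C].
Arguments recentred {R} d C _.

Lemma hull_vertices {R : realType} {n m : nat} (x y : 'I_m -> 'rV[R]_n) :
  affinely_independent x -> hull x = hull y ->
  exists2 s : 'I_m -> 'I_m, injective s & forall i, x i = y (s i).
Proof.
move=> ax xy.
have vtx (z : 'I_m -> 'rV[R]_n) i : hull z (z i).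
  exists (fun j => (j == i)%:R); split.
  - by move=> j; exact: ler0n.
  - by rewrite (bigD1 i)//= eqxx big1 ?addr0// => j /negPf ->.
  - rewrite (bigD1 i)//= eqxx scale1r big1 ?addr0// => j /negPf ->.
    by rewrite scale0r.
have /choice[b bP] : forall i, exists b : 'I_m -> R,
    [/\ forall j, 0 <= b j, \sum_j b j = 1 & x i = \sum_j b j *: y j].
  by move=> i; have := vtx x i; rewrite xy.
have /choice[a aP] : forall j, exists a : 'I_m -> R,
    [/\ forall k, 0 <= a k, \sum_k a k = 1 & y j = \sum_k a k *: x k].
  by move=> j; have := vtx y j; rewrite -xy.
have ba i k : \sum_j b i j * a j k = (k == i)%:R.
  have [b0 b1 bx] := bP i.
  apply/eqP; rewrite -subr_eq0; apply/eqP; move: k; apply: ax.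
    rewrite sumrB exchange_big/= (eq_bigr (b i)); last first.
      by move=> j _; rewrite -mulr_sumr; have [_ -> _] := aP j; rewrite mulr1.
    rewrite b1 (bigD1 i)//= eqxx big1 ?addr0 ?subrr// => k.
    by move=> /negPf ->.
  under eq_bigr => k _ do rewrite scalerBl.
  rewrite sumrB [X in _ - X](_ : _ = x i); last first.
    rewrite (bigD1 i)//= eqxx scale1r big1 ?addr0// => k /negPf ->.
    by rewrite scale0r.
  apply/eqP; rewrite subr_eq0 [eqbRHS]bx; apply/eqP.
  under eq_bigr => k _ do rewrite scaler_suml.
  rewrite exchange_big/=; apply: eq_bigr => j _.
  have [_ _ yj] := aP j.
  by rewrite yj scaler_sumr; apply: eq_bigr => k _; rewrite scalerA.
have nz (c : 'I_m -> R) : \sum_j c j = 1 -> exists j, c j != 0.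
  move=> c1; apply/existsP; apply: contraPT c1 => /existsPn c0.
  rewrite big1 => [/esym/eqP|j _]; first by rewrite oner_eq0.
  by have := c0 j; rewrite negbK => /eqP.
have /choice[k kP] : forall j, exists k, a j k != 0.
  by move=> j; apply: nz; have [] := aP j.
have /choice[s sP] : forall i, exists j, b i j != 0.
  by move=> i; apply: nz; have [] := bP i.
have bk i j : b i j != 0 -> k j = i.
  move=> bij; apply/eqP; apply: contraT => /negPf kji.
  have /eqP := ba i (k j); rewrite kji psumr_eq0; last first.
    by move=> l _; rewrite mulr_ge0//; [have [->]:= bP i|have [->]:= aP l].
  move=> /allP/(_ j (mem_index_enum _)); rewrite mulf_eq0 (negPf bij)/=.
  by rewrite (negPf (kP j)).
have sk : cancel s k by move=> i; exact: bk (sP i).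
have [t st ts] := injF_bij (can_inj sk).
exists s; first exact: can_inj sk.
move=> i; have [_ b1 bx] := bP i.
have b0 j : j != s i -> b i j = 0.
  move=> jsi; apply/eqP; apply: contraNT jsi => /bk <-.
  by rewrite -[in k _](ts j) sk ts.
move: b1; rewrite (bigD1 (s i))//= big1 => [|j /b0//]; rewrite addr0 => b1.
rewrite bx (bigD1 (s i))//= b1 scale1r big1 ?addr0// => j /b0 ->.
by rewrite scale0r.
Qed.

Lemma barycentre_hull {R : realType} (d : nat) (x : 'I_d -> 'rV[R]_d.-1) :
  affinely_independent x -> barycentre d (hull x) = d%:R^-1 *: \sum_i x i.
Proof.
move=> ax; rewrite /barycentre; case: xgetP => [_ -> [y [_ xy ->]]|].
  have [s sinj xs] := hull_vertices ax xy.
  by rewrite (reindex_inj sinj); congr (_ *: _); apply: eq_bigr => i _.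
by move=> /(_ (d%:R^-1 *: \sum_i x i)) []; exists x.
Qed.

(* [T w] is the set of cells of the random tessellation at the outcome [w], [xi]
   its cell intensity and [Z] the law of its typical cell. *)
Definition is_typical_cell_law {R : realType} (d : nat) {dO : measure_display}
    {Omega : measurableType dO} (P : probability Omega R)
    (T : Omega -> set (set 'rV[R]_d.-1))
    (Z : probability (compact_convex R d.-1) R) : Prop :=
  exists2 xi : R, 0 < xi &
  forall W : set 'rV[R]_d.-1,
    measurable W -> bounded_set W -> (0 < lebesgue_rV W)%E ->
    (xi%:E = (fine (lebesgue_rV W))^-1%R%:E *
       \int[P]_w counting [set C | T w C /\ W (barycentre d C)])%E /\
    forall A : set (compact_convex R d.-1), measurable A ->
      (Z A = ((xi * fine (lebesgue_rV W))^-1)%R%:E *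
         \int[P]_w \esum_(C in T w)
           (\1_W (barycentre d C) *
            \1_[set cc_set K | K in A] (recentred d C))%R%:E)%E.
Arguments is_typical_cell_law {R} d {dO Omega} P T Z.

Definition weakly_converges {R : realType} {n : nat}
    (Z : R -> probability (compact_convex R n) R) (F : set_system R)
    (Z0 : probability (compact_convex R n) R) : Prop :=
  forall f : compact_convex R n -> R, continuous f -> bounded_fun f ->
    (\int[Z l]_K f K) @[l --> F] --> \int[Z0]_K f K.

(* Main.v *)
From HB Require Import structures.
From mathcomp Require Import all_boot all_order fingroup perm all_algebra finmap.
From mathcomp Require Import ring lra.
From mathcomp Require Import all_classical all_reals all_analysis.
From mathcomp Require Import measurable_realfun.
Require Import Defs.

Set Implicit Arguments.
Unset Strict Implicit.
Unset Printing Implicit Defensive.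

Import Order.TTheory GRing.Theory Num.Theory.
Import numFieldNormedType.Exports.

Local Open Scope classical_set_scope.
Local Open Scope ring_scope.

(** Put n = d - 1.  In the variable s = y / lambda the density
    lambda^n y^-(n+1) on y >= lambda of the intensity of eta_lambda no longer
    depends on lambda: that intensity is the image of one fixed measure, Lebesgue
    measure on R^n times the Pareto law of total mass 1/n on [1, oo), under
    (v, s) |-> (v, lambda s) ([marked_volume], [scale_height],
    [horoball_intensityE]).  At lambda = 0 the same image is the intensity of the
    homogeneous process of intensity 1/n placed in the hyperplane y = 0
    ([homogeneous_intensityE]), and there the half-ball condition is the classical
    empty ball condition ([delaunay_ground]).  Both tessellations thus belong to
    one family indexed by lambda >= 0, and the claim is its continuity at 0.

    By the Mecke formula the expected number of cells with barycentre in a unit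
    window and centred shape in A is, up to the factor 1/(n+1)!, the integral
    [cell_mass] over all (n+1)-tuples in general position, with mean in the window
    and shape in A, of the probability that the half-ball through the tuple is
    empty, which is exp(- volume of the half-ball).  The law of the typical cell is
    the quotient of these integrals for A and for all shapes
    ([typical_cell_ratio]).  Lambda occurs in the void probability only.  The centre
    of the half-ball moves by lambda^2 times a fixed vector, so its volume
    converges as lambda tends to 0 ([sphere_powerE], [cvg_void_mass]).  The
    circumradius is at least of the order of the distances between the vertices,
    so the void probability decays exponentially in these distances, uniformly in
    lambda in [0, 1] ([void_probability_le]), and has an integrable majorant
    ([integrable_envelope]).  Dominated convergence yields convergence of the laws
    of the typical cells on every Borel set ([cvg_cell_mass]), which is more than
    weak convergence ([cvg_integral_setwise]).

    The Mecke formula is derived from the definition of a Poisson process by its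
    counts.  For boxes with disjoint sides it is the independence of the counts
    ([mean_rectangle]); Dynkin's argument and a countable partition of the
    injective tuples extend it to all sets of tuples and a fixed void region
    ([mecke_piece], [mecke_void]); a void region depending on the tuple is the
    limit of regions taking finitely many values ([mecke_moving_void]).  Cells are
    counted through tuples: a cell comes from exactly (n+1)! tuples as soon as no
    two points of the process lie on a vertical line, which holds almost surely
    ([no_vertical_pairs], [esum_cell_tuples]). *)

(** * Integrals of functions not known to be measurable *)

Section integral_off_null_set.
Context d (T : measurableType d) (R : realType).
Variable mu : {measure set T -> \bar R}.
Local Open Scope ereal_scope.

Lemma ge0_le_integral_nonmeasurable (f g : T -> \bar R) :
  (forall x, 0 <= f x) -> (forall x, f x <= g x) ->
  \int[mu]_x f x <= \int[mu]_x g x.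
Proof.
move=> f0 fg.
have g0 x : 0 <= g x by exact: le_trans (f0 x) (fg x).
rewrite !ge0_integralTE//; apply: le_ereal_sup => _ [h /= hf <-].
by exists h => // x; exact: le_trans (hf x) (fg x).
Qed.

(** The sum over the cells of a tessellation is a function of the outcome whose
    measurability is unclear; it agrees off a null set with a tuple count, and the
    integral of a nonnegative function, a supremum over simple functions, does not
    see the difference. *)
Lemma ge0_integral_off_null (f g : T -> \bar R) (N : set T) :
  measurable N -> mu N = 0 -> measurable_fun setT g ->
  (forall x, 0 <= f x) -> (forall x, 0 <= g x) ->
  (forall x, ~ N x -> f x = g x) ->
  \int[mu]_x f x = \int[mu]_x g x.
Proof.
move=> mN N0 mg f0 g0 fg.
(* On N the function is replaced by its smallest and its largest possible value. *)
pose lo x := if x \in N then 0 else g x.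
pose hi x := if x \in N then +oo else g x.
have mcst (c : \bar R) :
    measurable_fun setT (fun x => if x \in N then c else g x).
  apply: measurable_fun_ifT => //.
  apply: (@measurable_fun_bool _ _ _ _ true).
  rewrite setTI (_ : _ @^-1` _ = N)//.
  by apply/seteqP; split => x /= => [/set_mem|/mem_set].
have mlo : measurable_fun setT lo by exact: mcst.
have mhi : measurable_fun setT hi by exact: mcst.
have lo0 x : 0 <= lo x by rewrite /lo; case: ifP.
have hi0 x : 0 <= hi x by rewrite /hi; case: ifP.
have elo : \int[mu]_x lo x = \int[mu]_x g x.
  apply: ge0_ae_eq_integral => //; exists N; split => // x /= h.
  apply: contrapT => Nx; apply: h => _.
  by rewrite /lo; case: ifPn => // /set_mem.
have ehi : \int[mu]_x hi x = \int[mu]_x g x.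
  apply: ge0_ae_eq_integral => //; exists N; split => // x /= h.
  apply: contrapT => Nx; apply: h => _.
  by rewrite /hi; case: ifPn => // /set_mem.
apply/eqP; rewrite eq_le; apply/andP; split.
- rewrite -ehi; apply: ge0_le_integral_nonmeasurable => // x.
  rewrite /hi; case: ifPn => [_|/negP xN]; first exact: leey.
  by rewrite fg// => /mem_set.
- rewrite -elo; apply: ge0_le_integral_nonmeasurable => // x.
  rewrite /lo; case: ifPn => // /negP xN.
  by rewrite fg// => /mem_set.
Qed.

End integral_off_null_set.

(** * Means of products of independent counts *)

Section independence.
Context d (Om : measurableType d) (R : realType) (P : probability Om R).
Local Open Scope ereal_scope.

Lemma emeasurable_prod (I : Type) (s : seq I) (f : I -> Om -> \bar R) :
  (forall i, measurable_fun setT (f i)) ->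
  measurable_fun setT (fun w => \prod_(i <- s) f i w).
Proof.
move=> mf; elim: s => [|i s ih].
  by under eq_fun do rewrite big_nil; exact: measurable_cst.
by under eq_fun do rewrite big_cons; exact: emeasurable_funM.
Qed.

Let above (k : nat) : set (\bar R) := [set y | k%:R%:E < y].

Lemma natural_eq_series (k : nat) :
  k%:R%:E = \sum_(j <oo) (\1_(above j) k%:R%:E : R)%:E.
Proof.
rewrite (nneseries_split 0 k); last by move=> j _; rewrite lee_fin.
rewrite add0n [X in _ + X]eseries0 ?adde0; last first.
  move=> j kj _; rewrite indicE memNset// /above /= lte_fin ltr_nat.
  by apply/negP; rewrite -leqNgt.
rewrite big_mkord (eq_bigr (fun=> 1)); last first.
  by move=> j _; rewrite indicE mem_set// /above /= lte_fin ltr_nat.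
by rewrite sumEFin sumr_const card_ord.
Qed.

(** Each integrated factor is written as the sum over k of the indicators of
    [k < Y i], which trades it for an event; the induction on the number of
    integrated factors ends with the independence of events.  The remaining
    factors are indicators, so that counts and void events mix. *)
Lemma integral_prod_independent m (Y : 'I_m -> Om -> \bar R) :
  (forall i, measurable_fun setT (Y i)) ->
  (forall i w, exists k : nat, Y i w = k%:R%:E) ->
  (forall i, \int[P]_w Y i w < +oo) ->
  (forall U : 'I_m -> set \bar R, (forall i, measurable (U i)) ->
    P [set w | forall i, U i (Y i w)] = \prod_(i < m) P [set w | U i (Y i w)]) ->
  forall (D : pred 'I_m) (U : 'I_m -> set \bar R),
    (forall i, measurable (U i)) ->
    \int[P]_w (\prod_(i < m) if D i then Y i w else (\1_(U i) (Y i w))%:E) =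
    \prod_(i < m) if D i then \int[P]_w Y i w else P [set w | U i (Y i w)].
Proof.
move=> mY natY finY indY D.
(* The event in each factor of the induction hypothesis is arbitrary, so the factor
   j can be moved from the integrated ones to the indicators. *)
move cD : #|D| => c; elim: c D cD => [|c ih] D cD U mU.
  have D0 i : D i = false by have := card0_eq cD i.
  under [RHS]eq_bigr do rewrite D0.
  rewrite -indY//.
  rewrite (_ : [set w | _] = \bigcap_(i in setT) (Y i @^-1` U i)); last first.
    by apply/seteqP; split => w /= h i; [move=> _|]; exact: h.
  rewrite -[in RHS](setIT (\bigcap_(_ in _) _)) -integral_indic//; last first.
    apply: fin_bigcap_measurable => [|i _]; first exact: finite_finset.
    by rewrite -[X in measurable X]setTI; exact: mY.
  apply: eq_integral => w _; under eq_bigr do rewrite D0.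
  rewrite indicE; have [|] := boolP (w \in _).
    rewrite inE => h; rewrite big1// => i _.
    by rewrite indicE mem_set//; exact: h.
  move=> /negP h; have [i hi] : exists i, ~ U i (Y i w).
      by apply: contra_notP h => /forallNP h; rewrite inE => i _; exact: contrapT (h i).
  by rewrite (bigD1 i)//= indicE memNset// mul0e.
have [j Dj] : exists j, D j.
  by apply/existsP; apply: contraPT cD => /existsPn h; rewrite eq_card0// => i; exact/negbTE/h.
pose D' := [predD1 D & j].
have cD' : #|D'| = c.
  by have := cardD1 j D; rewrite cD unfold_in Dj => -[].
pose V k i := if i == j then above k else U i.
have mV k i : measurable (V k i).
  rewrite /V; case: ifP => _ //.
  by rewrite -[X in measurable X]setTI; exact: emeasurable_fun_o_infty.
have Y0 i w : 0 <= Y i w by have [k ->] := natY i w; rewrite lee_fin.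
pose G k w := \prod_(i < m) if D' i then Y i w else (\1_(V k i) (Y i w))%:E.
have G0 k w : 0 <= G k w.
  by apply: prode_ge0 => i _; case: ifP => // _; rewrite lee_fin.
have mG k : measurable_fun setT (G k).
  apply: emeasurable_prod => i; case: (D' i) => //.
  apply/measurable_EFinP; apply: (measurableT_comp _ (mY i)) => //.
pose H w := \prod_(i < m | i != j) if D i then Y i w else (\1_(U i) (Y i w))%:E.
have Hfin w : H w \is a fin_num.
  apply: prode_fin_num => i _; case: ifP => // _.
  by have [k ->] := natY i w.
have GH k w : G k w = (fine (H w))%:E * (\1_(above k) (Y j w))%:E.
  rewrite /G (bigD1 j)//= /D' /= eqxx /= /V eqxx muleC fineK//; congr (_ * _).
  by apply: eq_bigr => i ij; rewrite ij (negPf ij).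
transitivity (\int[P]_w \sum_(k <oo) G k w).
  apply: eq_integral => w _; under eq_eseriesr do rewrite GH.
  rewrite nneseriesZl; last by move=> k _; rewrite lee_fin.
  have [k Yk] := natY j w; rewrite Yk -natural_eq_series -Yk fineK// muleC.
  by rewrite (bigD1 j)//= Dj.
rewrite integral_nneseries//.
pose C := \prod_(i < m | i != j) if D i then \int[P]_w Y i w else P [set w | U i (Y i w)].
have Cfin : C \is a fin_num.
  apply: prode_fin_num => i _; case: ifP => _.
    by rewrite ge0_fin_numE//; exact: integral_ge0.
  apply: fin_num_measure.
  by rewrite -[X in measurable X]setTI; exact: mY.
transitivity (\sum_(k <oo) (fine C)%:E * P [set w | k%:R%:E < Y j w]).
  apply: eq_eseriesr => k _; rewrite ih//.
  rewrite (bigD1 j)//= /D' /= eqxx /= /V eqxx muleC fineK//; congr (_ * _).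
  by apply: eq_bigr => i ij; rewrite ij (negPf ij).
rewrite nneseriesZl; last by move=> k _; exact: measure_ge0.
rewrite fineK// (bigD1 j)//= Dj muleC; congr (_ * _).
transitivity (\sum_(k <oo) \int[P]_w (\1_(above k) (Y j w))%:E).
  apply: eq_eseriesr => k _.
  rewrite -[in LHS](setIT [set w | _]) -integral_indic//.
  have := mY j measurableT _ (mV k j).
  by rewrite setTI /V eqxx.
rewrite -integral_nneseries//; last first.
  move=> k; apply/measurable_EFinP; apply: (measurableT_comp _ (mY j)) => //.
  by have := mV k j; rewrite /V eqxx.
apply: eq_integral => w _; have [k Yk] := natY j w.
by rewrite Yk -natural_eq_series.
Qed.
End independence.

(** * Counting tuples of points *)

Section tuples_of_points.
Context {X : choiceType} {R : realType}.
Local Open Scope ereal_scope.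

Definition rectangle m (B : 'I_m -> set X) : set (m.-tuple X) :=
  [set t | forall i, B i (tnth t i)].

Lemma rectangleI m (B C : 'I_m -> set X) :
  rectangle B `&` rectangle C = rectangle (fun i => B i `&` C i).
Proof.
apply/seteqP; split => [t [tB tC] i|t tBC]; first by split; [exact: tB|exact: tC].
by split => i; have [] := tBC i.
Qed.

Lemma esum_cst (T : choiceType) (E : set T) (r : R) : finite_set E -> (0 <= r)%R ->
  \esum_(x in E) r%:E = counting E * r%:E.
Proof.
move=> finE r0; rewrite esum_fset//.
rewrite fsbig_finite//= sumEFin big_const_seq count_predT iter_addr_0.
by rewrite /counting asboolT// -EFinM mulr_natl.
Qed.

Lemma esum_rectangle m (E : 'I_m -> set X) : (forall i, finite_set (E i)) ->
  \esum_(t in rectangle E) 1 = \prod_(i < m) (counting (E i) : \bar R).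
Proof.
elim: m E => [|m ih] E finE.
  rewrite big_ord0 (_ : rectangle E = [set [tuple]]) ?esum_set1//.
  by apply/seteqP; split => [t _|t _ []//]; rewrite /= (tuple0 t).
pose E' i := E (lift ord0 i).
rewrite (reindex_esum (E ord0 `*` rectangle E') _
    (fun p : X * m.-tuple X => [tuple of p.1 :: p.2])).
  rewrite -(@esum_esum _ _ _ (E ord0) (fun=> rectangle E') (fun _ _ => 1))//.
  rewrite ih; last by move=> i; exact: finE.
  rewrite [RHS]big_ord_recl.
  have [r rE] : exists n : nat, \prod_(i < m) counting (E' i) = n%:R%:E :> \bar R.
    elim/big_ind: _ => [|_ _ [a ->] [b ->]|i _]; first by exists 1%N.
      by exists (a * b)%N; rewrite natrM.
    by exists #|` fset_set (E' i)|; rewrite /counting asboolT//; exact: finE.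
  by rewrite rE esum_cst.
split => [[x t] [/= Ex Et] i|[x t] [y s] _ _ /= []|t Et].
- by case: (unliftP ord0 i) => [j ->|->//]; rewrite tnthS; exact: Et.
- by move=> -> /val_inj ->.
- exists (thead t, [tuple of behead t]); last by rewrite [RHS]tuple_eta.
  split => [|i] /=; first exact: Et.
  by have := Et (lift ord0 i); rewrite [in X in X -> _](tuple_eta t) tnthS.
Qed.

Definition distinct_tuples m (E : set X) : set (m.-tuple X) :=
  [set t | injective (tnth t) /\ forall i, E (tnth t i)].

(** The factorial counting measure of the point set E. *)
Definition tuple_count m (E : set X) (A : set (m.-tuple X)) : \bar R :=
  \esum_(t in @distinct_tuples m E) (\1_A t)%:E.

Lemma tuple_count_ge0 m (E : set X) (A : set (m.-tuple X)) : 0 <= tuple_count E A.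
Proof. by apply: esum_ge0 => t _; rewrite lee_fin. Qed.

Lemma tuple_count_rectangle m (E : set X) (C : 'I_m -> set X) :
  trivIset setT C -> (forall i, finite_set (E `&` C i)) ->
  tuple_count E (rectangle C) = \prod_(i < m) counting (E `&` C i).
Proof.
move=> tC finC; rewrite -esum_rectangle//.
transitivity (\esum_(t in @distinct_tuples m E `&` rectangle C) (1 : \bar R)).
  rewrite esum_mkcondr; apply: eq_esum => t _; rewrite indicE.
  by case: (t \in _).
congr (esum _ _); apply/seteqP; split => [t [[_ tE] tC'] i|t tEC]; first by split.
split; last by move=> i; have [] := tEC i.
split; last by move=> i; have [] := tEC i.
move=> i j ij; apply: tC => //; exists (tnth t i).
by split; [have [] := tEC i|rewrite ij; have [] := tEC j].
Qed.

Lemma le_tuple_count m (E : set X) (A B : set (m.-tuple X)) :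
  A `<=` B -> tuple_count E A <= tuple_count E B.
Proof.
move=> AB; apply: le_esum => t _; rewrite lee_fin !indicE.
by have [/set_mem/AB/mem_set ->//|] := boolP (t \in A).
Qed.

Lemma tuple_count_bigcup m (E : set X) (A : nat -> set (m.-tuple X)) :
  trivIset setT A ->
  tuple_count E (\bigcup_k A k) = \sum_(k <oo) tuple_count E (A k).
Proof.
move=> tA; have e B : tuple_count E B = \esum_(t in B) (\1_(@distinct_tuples m E) t)%:E.
  rewrite /tuple_count (_ : (fun _ => _) = (fun t => if t \in B then 1 else 0)); last first.
    by apply/funext => t; rewrite indicE; case: ifP.
  rewrite -esum_mkcondr setIC esum_mkcondr; apply: eq_esum => t _.
  by rewrite indicE; case: ifP.
rewrite e esum_bigcupT//.
rewrite -nneseries_esumT; last first.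
  by move=> k; apply: esum_ge0 => t _; rewrite lee_fin.
by apply: eq_eseriesr => k _; rewrite e.
Qed.

Lemma tuple_countU m (E : set X) (A B : set (m.-tuple X)) : A `&` B = set0 ->
  tuple_count E (A `|` B) = tuple_count E A + tuple_count E B.
Proof.
move=> AB; rewrite -esumD => [|t _|t _]; rewrite ?lee_fin//.
apply: eq_esum => t _; rewrite -EFinD; congr _%:E; rewrite !indicE in_setU.
have [/set_mem tA|_] := boolP (t \in A); have [/set_mem tB|_] := boolP (t \in B) => /=;
  rewrite ?addr0 ?add0r//.
by have : (A `&` B) t by []; rewrite AB.
Qed.

End tuples_of_points.

(** * Void probabilities *)

Lemma expRN_fine_le1 (R : realType) (x : \bar R) : (0 <= x)%E ->
  ((expR (- fine x))%:E <= 1)%E.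
Proof. by move=> x0; rewrite lee_fin -[leRHS]expR0 ler_expR lerNl oppr0 fine_ge0. Qed.

Lemma cvg_expRN_fine (R : realType) (u : nat -> \bar R) (l : \bar R) :
  l \is a fin_num -> u k @[k --> \oo] --> l ->
  (expR (- fine (u k)))%:E @[k --> \oo] --> (expR (- fine l))%:E.
Proof.
move=> lfin ul; apply: cvg_EFin; first by apply: nearW.
rewrite (_ : _ \o _ = (fun k => expR (- fine (u k)))); last exact/funext.
apply: (cvg_comp (fun k => - fine (u k)) expR); last exact: continuous_expR.
by apply: cvgN; apply: fine_cvg; rewrite fineK.
Qed.

(** * Locally finite Poisson processes and the Mecke formula *)

Section measurable_tuple_rectangles.
Context d (X : measurableType d).

Lemma measurable_rectangle m (B : 'I_m -> set X) :
  (forall i, measurable (B i)) -> measurable (rectangle B).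
Proof.
move=> mB.
rewrite (_ : rectangle B =
    \bigcap_(i in setT) ((fun t : m.-tuple X => tnth t i) @^-1` B i)).
  apply: fin_bigcap_measurable => [|i _]; first exact: finite_finset.
  rewrite -[X in measurable X]setTI.
  exact: measurable_tnth.
by apply/seteqP; split => [t tB i _|t tB i]; exact: tB.
Qed.

Lemma measurable_tuple_rectangles m :
  @measurable _ (m.-tuple X) =
  <<s [set A | exists2 B : 'I_m -> set X,
         (forall i, measurable (B i)) & A = rectangle B] >>.
Proof.
apply/seteqP; split; last first.
  apply: smallest_sub; first exact: sigma_algebra_measurable.
  by move=> _ [B mB ->]; exact: measurable_rectangle.
apply: smallest_sub; first exact: smallest_sigma_algebra.
move=> A; rewrite -bigcup_seq => -[i _ [B mB <-]].
apply: sub_sigma_algebra; exists (fun j => if j == i then B else setT).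
  by move=> j; case: ifP.
apply/seteqP; split => t /=; first by move=> [_ Bt] j; case: eqP => [->|].
by move=> /(_ i); rewrite eqxx.
Qed.

End measurable_tuple_rectangles.

(** The tuples as a measurable type, for stating the type of measures on them. *)
Definition tuple_space d (X : measurableType d) (m : nat) :
  measurableType (measure_tuple_display d) := m.-tuple X.

Section locally_finite_poisson.
Context dO (Om : measurableType dO) (R : realType) (P : probability Om R).
Context dX (X : measurableType dX).
Local Open Scope ereal_scope.

(** What the Mecke formula uses of a Poisson process with intensity mu.  Finiteness
    in the windows F k is required at every outcome, not almost surely; a
    modification on a null set ensures it. *)
Record lf_poisson (mu : {measure set X -> \bar R}) (F : nat -> set X)
    (eta : Om -> set X) : Prop := {
  lfp_measurable : forall B, measurable B ->
    measurable_fun setT (fun w => counting (eta w `&` B) : \bar R) ;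
  lfp_mean : forall B, measurable B -> mu B < +oo ->
    \int[P]_w counting (eta w `&` B) = mu B ;
  lfp_void : forall B, measurable B -> mu B < +oo ->
    P [set w | counting (eta w `&` B) = 0 :> \bar R] = (expR (- fine (mu B)))%:E ;
  lfp_independent : forall m (B : 'I_m -> set X) (U : 'I_m -> set \bar R),
    (forall i, measurable (B i)) -> trivIset setT B ->
    (forall i, measurable (U i)) ->
    P [set w | forall i, U i (counting (eta w `&` B i))] =
    \prod_(i < m) P [set w | U i (counting (eta w `&` B i))] ;
  lfp_window_measurable : forall k, measurable (F k) ;
  lfp_window_homo : forall k l, (k <= l)%N -> F k `<=` F l ;
  lfp_window_cover : forall x, exists k, F k x ;
  lfp_window_finite : forall k, mu (F k) < +oo ;
  lfp_finite : forall k w, finite_set (eta w `&` F k) }.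

Variables (mu : {measure set X -> \bar R}) (F : nat -> set X) (eta : Om -> set X).
Hypothesis heta : lf_poisson mu F eta.

Lemma lfp_subfinite k B w : B `<=` F k -> finite_set (eta w `&` B).
Proof.
by move=> BF; apply: sub_finite_set (lfp_finite heta k w) => x [? /BF].
Qed.

Lemma lfp_mu_fin k B : measurable B -> B `<=` F k -> mu B < +oo.
Proof.
move=> mB BF; apply: le_lt_trans (lfp_window_finite heta k).
by apply: (@le_measure _ _ _ mu); rewrite ?inE//; exact: lfp_window_measurable heta k.
Qed.

Lemma counting0P (A : set X) : counting A = 0 :> \bar R <-> A = set0.
Proof.
rewrite /counting; case: ifPn => [/asboolP fA|/asboolPn iA].
  split=> [[/eqP]|->]; last by rewrite fset_set0.
  rewrite pnatr_eq0 => /eqP/cardfs0_eq A0.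
  by rewrite -(fset_setK fA) A0 -set_fset0.
by split => // A0; case: iA; rewrite A0; exact: finite_set0.
Qed.

Definition void_indic (S : set X) (w : Om) : \bar R :=
  (\1_[set y : \bar R | y = 0] (counting (eta w `&` S)))%:E.

Lemma void_indic01 S w :
  void_indic S w = if `[< eta w `&` S = set0 >] then 1 else 0.
Proof.
rewrite /void_indic indicE; case: asboolP => h.
  by rewrite mem_set//; apply/counting0P.
by rewrite memNset//= => /counting0P.
Qed.

Lemma measurable_void_indic S : measurable S -> measurable_fun setT (void_indic S).
Proof.
move=> mS; apply/measurable_EFinP.
apply: (measurableT_comp _ (lfp_measurable heta mS)) => //.
exact: measurable_indic (emeasurable_set1 0).
Qed.

(** The Mecke formula for a box with disjoint sides: the tuple count factors into
    the counts of the sides, which are independent of the count of the void S. *)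
Lemma mean_rectangle m (C : 'I_m -> set X) (S : set X) k :
  (forall i, measurable (C i)) -> measurable S -> trivIset setT C ->
  (forall i, C i `&` S = set0) -> (forall i, C i `<=` F k) -> S `<=` F k ->
  \int[P]_w (tuple_count (eta w) (rectangle C) * void_indic S w) =
  (\prod_(i < m) mu (C i)) * (expR (- fine (mu S)))%:E.
Proof.
move=> mC mS tC CS CF SF.
(* The void S is the side 0 of a family of m + 1 disjoint sets. *)
pose B (i : 'I_m.+1) := if unlift ord0 i is Some j then C j else S.
pose Y i w : \bar R := counting (eta w `&` B i).
have mB i : measurable (B i) by rewrite /B; case: unlift.
have BF i : B i `<=` F k by rewrite /B; case: unlift.
have tB : trivIset setT B.
  move=> i j _ _; rewrite /B; case: unliftP => [i' ->|->]; case: unliftP => [j' ->|->] //.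
  - by move=> h; congr lift; exact: tC.
  - by move=> [x xx]; have : (C i' `&` S) x by []; rewrite CS.
  - by move=> [x [x1 x2]]; have : (C j' `&` S) x by []; rewrite CS.
have -> : \int[P]_w (tuple_count (eta w) (rectangle C) * void_indic S w) =
    \int[P]_w (\prod_(i < m.+1) if i != ord0 then Y i w else
       (\1_[set y : \bar R | y = 0] (Y i w))%:E).
  apply: eq_integral => w _; rewrite big_ord_recl/= muleC /Y /B unlift_none.
  rewrite tuple_count_rectangle//; last by move=> i; exact: lfp_subfinite (CF i).
  by congr (_ * _); apply: eq_bigr => i _; rewrite liftK.
rewrite (@integral_prod_independent _ _ _ _ _ Y _ _ _ _ (fun i => i != ord0)
    (fun=> [set y : \bar R | y = 0])); first last.
- by move=> i; exact: emeasurable_set1.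
- by move=> U mU; exact: lfp_independent heta _ _ _ mB tB mU.
- move=> i; rewrite /Y (lfp_mean heta)//; exact: lfp_mu_fin (BF i).
- move=> i w; exists #|` fset_set (eta w `&` B i)|.
  by rewrite /Y /counting asboolT//; exact: lfp_subfinite (BF i).
- by move=> i; exact: (lfp_measurable heta).
rewrite big_ord_recl/= /Y muleC /B unlift_none; congr (_ * _).
  apply: eq_bigr => i _; rewrite liftK (lfp_mean heta)//.
  exact: lfp_mu_fin (CF i).
by rewrite (lfp_void heta)//; exact: lfp_mu_fin SF.
Qed.

Section mecke.
Variables (m : nat) (M : {measure set (tuple_space X m) -> \bar R}).
Hypothesis M_rectangle : forall B : 'I_m -> set X,
  (forall i, measurable (B i)) -> M (rectangle B) = \prod_(i < m) mu (B i).

Let void_ge0 S w : 0 <= void_indic S w.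
Proof. by rewrite /void_indic lee_fin. Qed.

Lemma M_rectangle_fin k (B : 'I_m -> set X) :
  (forall i, measurable (B i)) -> (forall i, B i `<=` F k) -> M (rectangle B) < +oo.
Proof.
move=> mB BF; rewrite M_rectangle// -ge0_fin_numE ?prode_ge0//.
apply: prode_fin_num => i _; rewrite ge0_fin_numE//.
exact: lfp_mu_fin (BF i).
Qed.

(** Inside a bounded box with disjoint sides both sides of the formula are finite
    measures in A that agree on boxes, so Dynkin's theorem applies. *)
Lemma mecke_piece (Q : 'I_m -> set X) (S : set X) k :
  (forall i, measurable (Q i)) -> measurable S -> trivIset setT Q ->
  (forall i, Q i `&` S = set0) -> (forall i, Q i `<=` F k) -> S `<=` F k ->
  forall A, measurable A ->
    let h w := tuple_count (eta w) (A `&` rectangle Q) * void_indic S w in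
    measurable_fun setT h /\
    \int[P]_w h w = M (A `&` rectangle Q) * (expR (- fine (mu S)))%:E.
Proof.
move=> mQ mS tQ QS QF SF.
have mrQ := measurable_rectangle mQ.
have rect (B : 'I_m -> set X) : (forall i, measurable (B i)) ->
    let h w := tuple_count (eta w) (rectangle B `&` rectangle Q) * void_indic S w in
    measurable_fun setT h /\
    \int[P]_w h w = M (rectangle B `&` rectangle Q) * (expR (- fine (mu S)))%:E.
  move=> mB h; rewrite /h rectangleI.
  pose C i := B i `&` Q i.
  have mC i : measurable (C i) by exact: measurableI.
  have CF i : C i `<=` F k by move=> x [_ /QF].
  have tC : trivIset setT C by exact: trivIset_setIl.
  split; last first.
    rewrite M_rectangle//; apply: mean_rectangle mC mS tC _ CF SF.
    by move=> i; rewrite -setIA QS setI0.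
  apply: emeasurable_funM; last exact: measurable_void_indic.
  rewrite (_ : (fun _ => _) = (fun w => \prod_(i < m) counting (eta w `&` C i))).
    by apply: emeasurable_prod => i; exact: (lfp_measurable heta).
  apply/funext => w; apply: tuple_count_rectangle => // i.
  exact: lfp_subfinite (CF i).
have QfinM A : measurable A -> M (A `&` rectangle Q) < +oo.
  move=> mA; apply: le_lt_trans (M_rectangle_fin mQ QF).
  by apply: (@le_measure _ _ _ M); rewrite ?inE//; exact: measurableI.
have Qfin w A : tuple_count (eta w) (A `&` rectangle Q) < +oo :> \bar R.
  apply: le_lt_trans (le_tuple_count _ (@subIsetr _ A (rectangle Q))) _.
  rewrite tuple_count_rectangle//; last by move=> i; exact: lfp_subfinite (QF i).
  rewrite -ge0_fin_numE; last by apply: prode_ge0 => i _; exact: measure_ge0.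
  apply: prode_fin_num => i _; rewrite /counting asboolT//.
  exact: lfp_subfinite (QF i).
move=> A; rewrite measurable_tuple_rectangles.
apply: (dynkin_induction (P := fun A =>
    let h w := tuple_count (eta w) (A `&` rectangle Q) * void_indic S w in
    measurable_fun setT h /\
    \int[P]_w h w = M (A `&` rectangle Q) * (expR (- fine (mu S)))%:E)) => //.
- exact: measurable_tuple_rectangles.
- move=> _ _ [B mB ->] [C mC ->]; exists (fun i => B i `&` C i).
    by move=> i; exact: measurableI.
  by rewrite rectangleI.
- have -> : [set: m.-tuple X] = rectangle (fun=> setT) by apply/seteqP; split.
  exact: rect.
- by move=> _ [B mB ->]; exact: rect.
- move=> B mB [mhB ihB] /=.
  have hE w : tuple_count (eta w) (~` B `&` rectangle Q) * void_indic S w =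
      tuple_count (eta w) (setT `&` rectangle Q) * void_indic S w -
      tuple_count (eta w) (B `&` rectangle Q) * void_indic S w.
    rewrite -(setvU B) setIUl tuple_countU; last first.
      by rewrite setICA !setIA setICr !set0I.
    rewrite muleDl ?ge0_adde_def ?inE ?tuple_count_ge0//.
    rewrite addeK// fin_numM//.
    by rewrite ge0_fin_numE ?tuple_count_ge0.
  have [mT ihT] := rect (fun=> setT) (fun=> measurableT).
  have Trect : rectangle (fun=> setT) = [set: m.-tuple X] by apply/seteqP; split.
  rewrite Trect in mT ihT.
  have mC : measurable_fun setT (fun w => tuple_count (eta w) (~` B `&` rectangle Q) * void_indic S w).
    rewrite (_ : (fun _ => _) = (fun w => tuple_count (eta w) (setT `&` rectangle Q) * void_indic S w -
      tuple_count (eta w) (B `&` rectangle Q) * void_indic S w)); last exact/funext.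
    exact: emeasurable_funB.
  split => //.
  have h0 D w : 0 <= tuple_count (eta w) D * void_indic S w.
    by rewrite mule_ge0 ?tuple_count_ge0.
  have MU : M ([set: m.-tuple X] `&` rectangle Q) =
      M (~` B `&` rectangle Q) + M (B `&` rectangle Q).
    rewrite setTI; apply: etrans (measureDI M mrQ mB) _.
    by rewrite setDE [_ `&` ~` B]setIC [_ `&` B]setIC.
  have := ihT; rewrite MU -(setvU B) setIUl muleDl ?ge0_adde_def ?inE//.
  under eq_integral => w _.
    rewrite tuple_countU; last by rewrite setICA !setIA setICr !set0I.
    rewrite muleDl ?ge0_adde_def ?inE ?tuple_count_ge0//.
    over.
  rewrite ge0_integralD// ihB => e.
  have Mfin : M (B `&` rectangle Q) * (expR (- fine (mu S)))%:E \is a fin_num.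
    by rewrite fin_numM// ge0_fin_numE// QfinM.
  by rewrite -[LHS](addeK _ Mfin) e addeK.
- move=> B mB tB ih /=.
  have hE w : tuple_count (eta w) ((\bigcup_k B k) `&` rectangle Q) * void_indic S w =
      \sum_(j <oo) tuple_count (eta w) (B j `&` rectangle Q) * void_indic S w.
    rewrite setI_bigcupl tuple_count_bigcup; last exact: trivIset_setIr.
    rewrite muleC /void_indic -nneseriesZl//.
      by apply: eq_eseriesr => j _; rewrite muleC.
    by move=> j _; exact: tuple_count_ge0.
  have h0 D w : 0 <= tuple_count (eta w) D * void_indic S w.
    by rewrite mule_ge0 ?tuple_count_ge0.
  split.
    rewrite (_ : (fun _ => _) = (fun w => \sum_(j <oo) tuple_count (eta w) (B j `&` rectangle Q) * void_indic S w)); last exact/funext.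
    by apply: ge0_emeasurable_sum => // j _; have [] := ih j.
  under eq_integral => w _ do rewrite hE.
  rewrite integral_nneseries//; last by move=> j; have [] := ih j.
  rewrite setI_bigcupl measure_bigcup//=; first last.
  - exact: trivIset_setIr.
  - by move=> j _; exact: measurableI.
  rewrite [X in _ = X * _](eq_eseriesl (Q := xpredT)); last first.
    by move=> j; rewrite in_setT.
  rewrite muleC -nneseriesZl//.
  by apply: eq_eseriesr => j _; have [_ ->] := ih j; rewrite muleC.
Qed.

Variable U : nat -> set X.
Hypothesis mU : forall j, measurable (U j).
Hypothesis U_separates : forall x y, x <> y -> exists j, U j x /\ ~ U j y.

(** A box whose sides are told apart by the separating sets U: the side i lies in
    U (l (i, j)) and the side j outside of it.  It is disjoint from S and bounded.
    Countably many such boxes cover all injective tuples avoiding S. *)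
Let separated_box k0 S (k : nat) (l : {ffun 'I_m * 'I_m -> nat}) (i : 'I_m) : set X :=
  (F (maxn k0 k) `&` ~` S) `&`
  \bigcap_(j in [set j | j != i]) (U (l (i, j)) `&` ~` U (l (j, i))).

(** The sum of [mecke_piece] over the parts of A first covered by the n-th of the
    separated boxes. *)
Theorem mecke_void (S : set X) (k : nat) (A : set (m.-tuple X)) :
  measurable S -> S `<=` F k -> measurable A ->
  (forall t, A t -> injective (tnth t)) ->
  (forall t i, A t -> ~ S (tnth t i)) ->
  let h w := tuple_count (eta w) A * void_indic S w in
  measurable_fun setT h /\ \int[P]_w h w = M A * (expR (- fine (mu S)))%:E.
Proof.
move=> mS SF mA injA SA h; rewrite /h.
pose Q n : 'I_m -> set X :=
  if @choice.unpickle (nat * {ffun 'I_m * 'I_m -> nat})%type n is Some (k', l)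
  then separated_box k S k' l else fun=> set0.
have mQ n i : measurable (Q n i).
  rewrite /Q; case: choice.unpickle => [[k' l]|//].
  apply: measurableI; first apply: measurableI.
  - exact: lfp_window_measurable heta _.
  - exact: measurableC.
  - apply: fin_bigcap_measurable => [|j _]; first exact: finite_finset.
    by apply: measurableI => //; exact: measurableC.
have tQ n : trivIset setT (Q n).
  rewrite /Q; case: choice.unpickle => [[k' l]|i j _ _ [x []//]].
  move=> i j _ _ [x [[_ xi] [_ xj]]]; apply/eqP; apply: contraT => ij.
  have [] := xi j; first by rewrite /= eq_sym.
  by have [] := xj i.
have QS n i : Q n i `&` S = set0.
  rewrite /Q; case: choice.unpickle => [[k' l]|]; last by rewrite set0I.
  by apply/seteqP; split => // x [[[_ ?] _] ?].
have QF n : exists K, (forall i, Q n i `<=` F K) /\ S `<=` F K.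
  rewrite /Q; case: choice.unpickle => [[k' l]|]; last first.
    by exists k; split => // i x [].
  exists (maxn k k'); split; first by move=> i x [[]].
  by apply: subset_trans SF _; apply: (lfp_window_homo heta); rewrite leq_maxl.
(* The boxes overlap; [B n] is the part of A first covered by the box n. *)
pose B n := (A `\` \big[setU/set0]_(i < n) rectangle (Q i)) `&` rectangle (Q n).
have mB n : measurable (A `\` \big[setU/set0]_(i < n) rectangle (Q i)).
  apply: measurableD => //; apply: bigsetU_measurable => i _.
  exact: measurable_rectangle.
have BE n : B n = A `&` seqDU (fun n => rectangle (Q n)) n.
  by rewrite /B /seqDU setDE -setIA; congr (_ `&` _); rewrite setDE setIC.
have tB : trivIset setT B.
  rewrite (_ : B = fun n => A `&` seqDU (fun n => rectangle (Q n)) n); last exact/funext.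
  by apply: trivIset_setIl; exact: trivIset_seqDU.
have AB : A = \bigcup_n B n.
  rewrite (_ : B = fun n => A `&` seqDU (fun n => rectangle (Q n)) n); last exact/funext.
  rewrite -setI_bigcupr -seqDU_bigcup_eq; apply/seteqP; split => [t At|t []//].
  split=> //.
  have /choice[f fP] : forall p : 'I_m * 'I_m, exists j, p.1 != p.2 ->
      U j (tnth t p.1) /\ ~ U j (tnth t p.2).
    move=> p; have [_|pp] := eqVneq p.1 p.2; first by exists 0%N.
    have [|j jP] := U_separates (x := tnth t p.1) (y := tnth t p.2); last by exists j.
    by move=> /(injA t At) /eqP; rewrite (negPf pp).
  have /choice[K KP] : forall i, exists k, F k (tnth t i).
    by move=> i; exact: lfp_window_cover heta _.
  exists (choice.pickle (\max_i K i, [ffun p => f p])) => // i.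
  rewrite /Q choice.pickleK; split.
    split; last exact: SA.
    apply: (lfp_window_homo heta) (KP i).
    by rewrite leq_max leq_bigmax orbT.
  move=> j /= ij; rewrite !ffunE; split.
    by have [] := fP (i, j); rewrite //= eq_sym.
  by have [] := fP (j, i).
have piece n : measurable_fun setT (fun w => tuple_count (eta w) (B n) * void_indic S w) /\
    \int[P]_w (tuple_count (eta w) (B n) * void_indic S w) = M (B n) * (expR (- fine (mu S)))%:E.
  have [K [QK SK]] := QF n.
  exact: mecke_piece (mQ n) mS (tQ n) (QS n) QK SK _ (mB n).
have hE w : tuple_count (eta w) A * void_indic S w =
    \sum_(j <oo) tuple_count (eta w) (B j) * void_indic S w.
  rewrite [in LHS]AB tuple_count_bigcup// muleC /void_indic -nneseriesZl//.
    by apply: eq_eseriesr => j _; rewrite muleC.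
  by move=> j _; exact: tuple_count_ge0.
have h0 D w : 0 <= tuple_count (eta w) D * void_indic S w.
  by rewrite mule_ge0 ?tuple_count_ge0.
split.
  rewrite (_ : (fun _ => _) = (fun w => \sum_(j <oo) tuple_count (eta w) (B j) * void_indic S w)); last exact/funext.
  by apply: ge0_emeasurable_sum => // j _; have [] := piece j.
under eq_integral => w _ do rewrite hE.
rewrite integral_nneseries//; last by move=> j; have [] := piece j.
rewrite [in RHS]AB measure_bigcup//=; last first.
  by move=> j _; apply: measurableI; [exact: mB|exact: measurable_rectangle].
rewrite [X in _ = X * _](eq_eseriesl (Q := xpredT)); last first.
    by move=> j; rewrite in_setT.
rewrite muleC -nneseriesZl//.
by apply: eq_eseriesr => j _; have [_ ->] := piece j; rewrite muleC.
Qed.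

Corollary mecke_mean (A : set (m.-tuple X)) :
  measurable A -> (forall t, A t -> injective (tnth t)) ->
  measurable_fun setT (fun w => tuple_count (eta w) A : \bar R) /\
  \int[P]_w tuple_count (eta w) A = M A.
Proof.
move=> mA injA.
have [mcA icA] : measurable_fun setT (fun w => tuple_count (eta w) A * void_indic set0 w) /\
    \int[P]_w (tuple_count (eta w) A * void_indic set0 w) = M A * (expR (- fine (mu set0)))%:E.
  exact: (@mecke_void set0 0%N A measurable0 (@sub0set _ _) mA injA (fun t i _ h => h)).
have v0 w : void_indic set0 w = 1 by rewrite void_indic01 setI0 asboolT.
split; first by apply: eq_measurable_fun mcA => w _; rewrite v0 mule1.
have mu0 : mu set0 = 0 by exact: measure0.
rewrite mu0 oppr0 expR0 mule1 in icA; rewrite -icA.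
by apply: eq_integral => w _; rewrite v0 mule1.
Qed.

Lemma finite_rectangle (T : choiceType) n (E : 'I_n -> set T) :
  (forall i, finite_set (E i)) -> finite_set (rectangle E).
Proof.
elim: n E => [|n ih] E finE.
  apply: (@sub_finite_set _ _ [set [tuple]]); last exact: finite_set1.
  by move=> t _ /=; rewrite (tuple0 t).
apply: (@sub_finite_set _ _ ((fun p : T * n.-tuple T => [tuple of p.1 :: p.2]) @`
    (E ord0 `*` rectangle (fun i => E (lift ord0 i))))).
  move=> t Et; exists (thead t, [tuple of behead t]); last by rewrite [RHS]tuple_eta.
  split => [|i] /=; first exact: Et.
  by have := Et (lift ord0 i); rewrite [in X in X -> _](tuple_eta t) tnthS.
by apply: finite_image; apply: finite_setX => //; apply: ih.
Qed.

Section moving_void.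
Variables (V : nat -> set X) (D : nat -> set (m.-tuple X)) (A : set (m.-tuple X)).
Hypothesis mV : forall j, measurable (V j).
Hypothesis V_window : forall j, exists k, V j `<=` F k.
Hypothesis mD : forall j, measurable (D j).
Hypothesis mA : measurable A.
Hypothesis A_inj : forall t, A t -> injective (tnth t).

(** A void region that varies with the tuple t, as a countable union of fixed
    sets switched on by measurable conditions on t. *)
Definition swept (t : m.-tuple X) : set X := \bigcup_(j in [set j | D j t]) V j.

Hypothesis swept_fin : forall t, A t -> mu (swept t) < +oo.
Hypothesis swept_avoid : forall t i, A t -> ~ swept t (tnth t i).

Let sweptn k (t : m.-tuple X) : set X :=
  \bigcup_(j in [set j | (j < k)%N /\ D j t]) V j.

Let msweptn k t : measurable (sweptn k t).
Proof. by apply: bigcup_measurable. Qed.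

Let mswept t : measurable (swept t).
Proof. exact: bigcup_measurable. Qed.

(** The tuples for which exactly the sets with index in J are switched on, among the
    first k, and the void region common to these tuples. *)
Let J_ k (J : {set 'I_k}) := [set t | forall j : 'I_k, D j t <-> j \in J].
Let S_ k (J : {set 'I_k}) : set X := \bigcup_(j in [set` J]) V (nat_of_ord j).

Let mJ k (J : {set 'I_k}) : measurable (J_ J).
Proof.
rewrite (_ : J_ J = \bigcap_(j in [set: 'I_k])
    (if j \in J then D j else ~` D j)).
  apply: fin_bigcap_measurable => [|j _]; first exact: finite_finset.
  by case: ifP => _ //; exact: measurableC.
apply/seteqP; split => t h j; first by move=> _; case: ifPn => [/h//|/negP jJ /h].
have := h j I; case: ifP => //.
Qed.

Let mS k (J : {set 'I_k}) : measurable (S_ J).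
Proof. by apply: fin_bigcup_measurable => //; exact: finite_finset. Qed.

Let S_window k (J : {set 'I_k}) : exists K, S_ J `<=` F K.
Proof.
have /choice[f fP] := V_window.
exists (\max_(j < k) f j) => x [j _ /fP]; apply: (lfp_window_homo heta).
exact: (leq_bigmax j).
Qed.

Let sweptnE k (J : {set 'I_k}) t : J_ J t -> sweptn k t = S_ J.
Proof.
move=> Jt; apply/seteqP; split => [x [j [/= jk Djt] Vx]|x [j /= jJ Vx]].
  by exists (Ordinal jk) => //=; apply/Jt.
by exists j => //; split; [exact: ltn_ord|exact/Jt].
Qed.

Let JP k t (J : {set 'I_k}) : J_ J t <-> J = [set j : 'I_k | `[< D j t >]]%SET.
Proof.
split => [Jt|-> j]; last by rewrite inE; split => /asboolP.
apply/setP => j; rewrite inE; apply/idP/asboolP; by move/Jt.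
Qed.

Let survival (t : m.-tuple X) : \bar R := (expR (- fine (mu (swept t))))%:E.

(** On each of the finitely many sets [J_ J] the first k pieces of the void region
    form a fixed set, so the formula holds for them; then k tends to infinity.
    The counts stabilise because a bounded region holds finitely many tuples. *)
Lemma mecke_moving_void_bounded K : A `<=` rectangle (fun=> F K) ->
  let c w := tuple_count (eta w) (A `&` [set t | eta w `&` swept t = set0]) in
  measurable_fun setT c /\ \int[P]_w c w = \int[M]_(t in A) survival t.
Proof.
move=> AK c.
pose cn k w : \bar R := tuple_count (eta w) (A `&` [set t | eta w `&` sweptn k t = set0]).
pose sn k t : \bar R := (expR (- fine (mu (sweptn k t))))%:E.
have MA : M A < +oo.
  apply: le_lt_trans (M_rectangle_fin (k := K) (B := fun=> F K) _ _); last 2 first.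
  - by move=> i; exact: lfp_window_measurable heta _.
  - by move=> _.
  apply: (@le_measure _ _ _ M); rewrite ?inE//.
  by apply: measurable_rectangle => i; exact: lfp_window_measurable heta _.
have cnE k w : cn k w = \sum_(J : {set 'I_k})
    tuple_count (eta w) (A `&` J_ J) * void_indic (S_ J) w.
  have e (J : {set 'I_k}) : tuple_count (eta w) (A `&` J_ J) * void_indic (S_ J) w =
      \esum_(t in @distinct_tuples _ m (eta w)) ((\1_(A `&` J_ J) t)%:E * void_indic (S_ J) w).
    rewrite void_indic01; case: asboolP => _.
      by rewrite mule1; apply: eq_esum => t _; rewrite mule1.
    by rewrite mule0 esum1// => t _; rewrite mule0.
  under eq_bigr do rewrite e.
  rewrite -esum_sum; last by move=> t J _ _; rewrite mule_ge0 ?lee_fin.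
  apply: eq_esum => t _.
  pose J0 := [set j : 'I_k | `[< D j t >]]%SET.
  have J0t : J_ J0 t by exact/JP.
  rewrite (bigD1 J0)//= big1 ?adde0; last first.
    move=> J JJ0; rewrite indicE memNset ?mul0e// => -[_ /JP] /eqP.
    by rewrite (negPf JJ0).
  rewrite void_indic01 -(sweptnE J0t) !indicE !in_setI (mem_set J0t) andbT.
  case: asboolP => h; first by rewrite mule1 [X in _ && X]mem_set ?andbT.
  by rewrite mule0 [X in _ && X]memNset ?andbF.
have piece k (J : {set 'I_k}) :
    measurable_fun setT (fun w => tuple_count (eta w) (A `&` J_ J) * void_indic (S_ J) w) /\
    \int[P]_w (tuple_count (eta w) (A `&` J_ J) * void_indic (S_ J) w) =
      M (A `&` J_ J) * (expR (- fine (mu (S_ J))))%:E.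
  have [L SL] := S_window J.
  apply: (mecke_void (mS J) SL) => [||t i [At Jt]].
  - exact: measurableI.
  - by move=> t [/A_inj].
  - move=> h; apply: (@swept_avoid t i At); rewrite -(sweptnE Jt) in h.
    by case: h => j [_ Dj] Vj; exists j.
have h0 E S w : 0 <= tuple_count (eta w) E * void_indic S w.
  by rewrite mule_ge0 ?tuple_count_ge0// lee_fin.
have mcn k : measurable_fun setT (cn k).
  rewrite (_ : cn k = fun w => \sum_(J : {set 'I_k})
    tuple_count (eta w) (A `&` J_ J) * void_indic (S_ J) w); last exact/funext.
  by apply: emeasurable_sum => J; have [] := piece k J.
have snE k t : sn k t * (\1_A t)%:E = \sum_(J : {set 'I_k})
    (expR (- fine (mu (S_ J))))%:E * (\1_(A `&` J_ J) t)%:E.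
  pose J0 := [set j : 'I_k | `[< D j t >]]%SET.
  have J0t : J_ J0 t by exact/JP.
  rewrite (bigD1 J0)//= big1 ?adde0; last first.
    move=> J JJ0; rewrite indicE memNset ?mule0// => -[_ /JP] /eqP.
    by rewrite (negPf JJ0).
  by rewrite /sn (sweptnE J0t) !indicE in_setI (mem_set J0t) andbT.
have msn1 k : measurable_fun setT (fun t => sn k t * (\1_A t)%:E).
  rewrite (_ : (fun _ => _) = (fun t => \sum_(J : {set 'I_k})
    (expR (- fine (mu (S_ J))))%:E * (\1_(A `&` J_ J) t)%:E)); last exact/funext.
  apply: emeasurable_sum => J; apply: measurable_funeM.
  by apply/measurable_EFinP; apply: measurable_indic; exact: measurableI.
have msn k : measurable_fun A (sn k).
  apply: (eq_measurable_fun (fun t => sn k t * (\1_A t)%:E)).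
    by move=> t tA; rewrite indicE tA mule1.
  exact: measurable_funTS.
have icn k : \int[P]_w cn k w = \int[M]_(t in A) sn k t.
  rewrite (_ : cn k = fun w => \sum_(J : {set 'I_k})
    tuple_count (eta w) (A `&` J_ J) * void_indic (S_ J) w); last exact/funext.
  rewrite ge0_integral_sum//; last by move=> J; have [] := piece k J.
  transitivity (\int[M]_(t in A) (sn k t * (\1_A t)%:E)); last first.
    by apply: eq_integral => t tA; rewrite indicE tA mule1.
  rewrite (_ : (fun _ => _) = (fun t => \sum_(J : {set 'I_k})
    (expR (- fine (mu (S_ J))))%:E * (\1_(A `&` J_ J) t)%:E)); last exact/funext.
  rewrite ge0_integral_sum//; last first.
    move=> J; apply: measurable_funTS; apply: measurable_funeM.
    by apply/measurable_EFinP; apply: measurable_indic; exact: measurableI.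
  apply: eq_bigr => J _; have [_ ->] := piece k J.
  rewrite ge0_integralZl//=.
  - rewrite integral_indic//; last exact: measurableI.
    by rewrite muleC; congr (_ * _); congr (M _); rewrite setIAC setIid.
  - apply: measurable_funTS; apply/measurable_EFinP; apply: measurable_indic.
    exact: measurableI.
have finE w : finite_set (@distinct_tuples _ m (eta w) `&` A).
  apply: (@sub_finite_set _ _ (rectangle (fun=> eta w `&` F K))).
    by move=> t [[_ te] /AK tF] i; split; [exact: te|exact: tF].
  by apply: finite_rectangle => _; exact: lfp_finite heta _ _.
have sub_swept k t : sweptn k t `<=` swept t by move=> x [j [_ Dj] Vj]; exists j.
have cvg_cn w : cn k w @[k --> \oo] --> c w.
  apply: cvg_near_cst.
  (* The void event of a single tuple is decided by finitely many pieces: if it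
     fails, some piece contains a point. *)
  have /choice[f fP] : forall t, exists N, forall k, (N <= k)%N ->
      (eta w `&` sweptn k t = set0 <-> eta w `&` swept t = set0).
    move=> t; have [h|/set0P[x [ex [j Dj Vj]]]] := eqVneq (eta w `&` swept t) set0.
      exists 0%N => k _; split => // _; apply/seteqP; split => // x [ex /sub_swept sx].
      by rewrite -h; split.
    exists j.+1 => k jk; split => h.
      have : (eta w `&` sweptn k t) x by split => //; exists j.
      by rewrite h.
    have : (eta w `&` swept t) x by split => //; exists j.
    by rewrite h.
  exists (\max_(t <- fset_set (@distinct_tuples _ m (eta w) `&` A)) f t)%N => // k /= fk.
  apply: eq_esum => t te; congr (_%:E).
  have [At|nAt] := pselect (A t); last by rewrite !indicE !memNset// => -[].
  have /fP h : (f t <= k)%N.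
    apply: leq_trans fk; apply: (leq_bigmax_seq t) => //.
    by rewrite in_fset_set// inE.
  rewrite !indicE !in_setI; congr (_ && _)%:R.
  by apply/idP/idP => /set_mem/h/mem_set.
have cvg_sn t : A t -> sn k t @[k --> \oo] --> survival t.
  move=> At; have bE : swept t = \bigcup_k sweptn k t.
    apply/seteqP; split => [x [j Dj Vj]|x [k _]]; last exact: sub_swept.
    by exists j.+1 => //; exists j.
  apply: cvg_expRN_fine; first by rewrite ge0_fin_numE// swept_fin.
  rewrite bE; apply: nondecreasing_cvg_mu => //; first by rewrite -bE.
  move=> k l kl; apply/subsetPset => x [j [jk Dj] Vj].
  by exists j => //; split => //; exact: leq_trans jk kl.
have mc : measurable_fun setT c.
  by apply: emeasurable_fun_cvg => [k|w _]; [exact: mcn|exact: cvg_cn].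
have [mcA icA] := mecke_mean mA A_inj.
split => //.
(* The number of all tuples in A dominates; its mean is M A, which is finite. *)
have lim1 : \int[P]_w cn k w @[k --> \oo] --> \int[P]_w c w.
  apply: (@dominated_cvg _ _ _ _ _ measurableT _ _ (fun w => tuple_count (eta w) A)) => //.
  - move=> w _; rewrite ge0_fin_numE ?tuple_count_ge0//.
    rewrite /tuple_count (_ : (fun _ => _) = (fun t => if t \in A then 1 else 0)); last first.
      by apply/funext => t; rewrite indicE; case: ifP.
    rewrite -esum_mkcondr esum_cst// /counting asboolT//.
    by rewrite mule1 ltry.
  - apply/integrableP; split => //.
    under eq_integral do rewrite gee0_abs ?tuple_count_ge0//.
    by rewrite icA.
  - move=> k w _; rewrite gee0_abs ?tuple_count_ge0//.
    by apply: le_tuple_count; exact: subIsetl.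
have lim2 : \int[M]_(t in A) sn k t @[k --> \oo] --> \int[M]_(t in A) survival t.
  apply: (@dominated_cvg _ _ _ _ _ mA _ _ (cst 1)) => //.
  - apply/integrableP; split; first exact: measurable_cst.
    rewrite (eq_integral (cst 1)) => [|t _]; last by rewrite /= normr1.
    by rewrite integral_cst// mul1e.
  - move=> k t _; rewrite gee0_abs; last by rewrite lee_fin expR_ge0.
    exact: expRN_fine_le1.
rewrite (_ : (fun k => \int[P]_w cn k w) = fun k => \int[M]_(t in A) sn k t) in lim1;
  last exact/funext.
exact: cvg_unique lim1 lim2.
Qed.

End moving_void.

(** The bounded case, summed over a partition into bounded sets of tuples. *)
Theorem mecke_moving_void (V : nat -> set X) (D : nat -> set (m.-tuple X))
    (A : set (m.-tuple X)) :
  (forall j, measurable (V j)) -> (forall j, exists k, V j `<=` F k) ->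
  (forall j, measurable (D j)) -> measurable A ->
  (forall t, A t -> injective (tnth t)) ->
  (forall t, A t -> mu (swept V D t) < +oo) ->
  (forall t i, A t -> ~ swept V D t (tnth t i)) ->
  let c w := tuple_count (eta w) (A `&` [set t | eta w `&` swept V D t = set0]) in
  measurable_fun setT (fun t => (\1_A t * expR (- fine (mu (swept V D t))))%:E) ->
  measurable_fun setT c /\
  \int[P]_w c w = \int[M]_(t in A) (expR (- fine (mu (swept V D t))))%:E.
Proof.
move=> mV VF mD mA injA finA avA c ms.
pose G := seqDU (fun n => @rectangle X m (fun=> F n)).
have mG n : measurable (G n).
  apply: measurableD; last apply: bigsetU_measurable => i _.
    by apply: measurable_rectangle => i; exact: lfp_window_measurable heta _.
  by apply: measurable_rectangle => j; exact: lfp_window_measurable heta _.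
have tG : trivIset setT G by exact: trivIset_seqDU.
have GT : \bigcup_n G n = setT.
  rewrite -seqDU_bigcup_eq; apply/seteqP; split => // t _.
  have /choice[K KP] : forall i, exists k, F k (tnth t i).
    by move=> i; exact: lfp_window_cover heta _.
  exists (\max_i K i)%N => // i; apply: (lfp_window_homo heta) (KP i).
  exact: leq_bigmax.
have piece n : let c w := tuple_count (eta w) ((A `&` G n) `&` [set t | eta w `&` swept V D t = set0]) in
    measurable_fun setT c /\
    \int[P]_w c w = \int[M]_(t in A `&` G n) (expR (- fine (mu (swept V D t))))%:E.
  apply: (@mecke_moving_void_bounded V D (A `&` G n) mV VF mD _ _ _ _ n) => //.
  - exact: measurableI.
  - by move=> t [/injA].
  - by move=> t [/finA].
  - by move=> t i [/avA].
  - by move=> t [_ []].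
have -> : c = fun w => \sum_(n <oo)
    tuple_count (eta w) ((A `&` G n) `&` [set t | eta w `&` swept V D t = set0]).
  apply/funext => w; rewrite -tuple_count_bigcup; last by apply: trivIset_setIr; exact: trivIset_setIl.
  by rewrite -setI_bigcupl -setI_bigcupr GT setIT.
split.
  apply: ge0_emeasurable_sum => [n w _ _|n _]; first exact: tuple_count_ge0.
  by have [] := piece n.
rewrite integral_nneseries//; first last.
- by move=> n w _; exact: tuple_count_ge0.
- by move=> n; have [] := piece n.
transitivity (\sum_(n <oo) \int[M]_(t in A `&` G n) (expR (- fine (mu (swept V D t))))%:E).
  by apply: eq_eseriesr => n _; have [_ ->] := piece n.
rewrite -ge0_integral_bigcup//.
- by rewrite -setI_bigcupr GT setIT.
- by move=> n; exact: measurableI.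
- rewrite -setI_bigcupr GT setIT.
  apply: eq_measurable_fun (measurable_funTS ms) => t tA.
  by rewrite indicE tA mul1r.
- exact: trivIset_setIl.
Qed.
End mecke.
End locally_finite_poisson.

(** * A locally finite version of a Poisson process *)

Section poisson_modification.
Context dO (Om : measurableType dO) (R : realType) (P : probability Om R).
Context dX (X : measurableType dX).
Local Open Scope ereal_scope.

Lemma measure_off_null (N A B : set Om) : measurable N -> P N = 0 ->
  measurable A -> measurable B -> (forall w, ~ N w -> A w <-> B w) -> P A = P B.
Proof.
move=> mN N0 mA mB AB.
have le (C D : set Om) : measurable C -> measurable D ->
    (forall w, ~ N w -> C w -> D w) -> P C <= P D.
  move=> mC mD CD; rewrite -[leRHS]adde0 -N0.
  apply: le_trans (measureU2 _ mD mN).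
  apply: le_measure; rewrite ?inE//; first exact: measurableU.
  by move=> w Cw; have [|nNw] := pselect (N w); [right|left; exact: CD].
by apply/eqP; rewrite eq_le !le// => w /AB [].
Qed.

Lemma poisson_prob1 (r : R) (k : nat) : (0 <= r)%R ->
  poisson_prob r 0 [set k] = (r ^+ k * k`!%:R^-1 * expR (- r))%:E.
Proof.
rewrite le_eqVlt /poisson_prob => /orP[/eqP <-|r0]; last first.
  by rewrite r0 esum_set1 ?lee_fin ?poisson_pmf_ge0// /poisson_pmf r0.
rewrite ltxx diracE oppr0 expR0 mulr1; case: k => [|k].
  by rewrite mem_set// expr0 fact0 invr1 mulr1.
by rewrite memNset// expr0n/= mul0r.
Qed.

Lemma poisson_mass (r : R) : (0 <= r)%R ->
  \sum_(k <oo) (r ^+ k * k`!%:R^-1 * expR (- r))%:E = 1.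
Proof.
move=> r0; rewrite -(@probability_setT _ _ R (poisson_prob r 0)).
have -> : [set: nat] = \bigcup_k [set k] by apply/seteqP; split => // k _; exists k.
rewrite measure_bigcup//=; last by move=> i j _ _ [x [-> ->]].
rewrite [RHS](eq_eseriesl (Q := xpredT)); last by move=> j; rewrite in_setT.
by apply: eq_eseriesr => k _; rewrite poisson_prob1.
Qed.

Lemma poisson_first_moment (r : R) : (0 <= r)%R ->
  \sum_(k <oo) (k%:R * (r ^+ k * k`!%:R^-1 * expR (- r)))%:E = r%:E.
Proof.
move=> r0.
have t0 k : (0 <= r ^+ k * k`!%:R^-1 * expR (- r))%R.
  by rewrite !mulr_ge0 ?exprn_ge0 ?expR_ge0 ?invr_ge0.
rewrite nneseries_recl//; last by move=> k _; rewrite lee_fin mulr_ge0.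
rewrite mul0r add0e.
transitivity (\sum_(k <oo) (r%:E * (r ^+ k * k`!%:R^-1 * expR (- r))%:E)).
  rewrite -(nneseries_addn 1)/=; last by move=> k; rewrite lee_fin mulr_ge0.
  apply: eq_eseriesr => k _; rewrite addn1 -EFinM; congr _%:E.
  rewrite factS natrM invfM exprS; field.
  by rewrite -(natrD _ 1) !pnatr_eq0 -lt0n fact_gt0.
by rewrite nneseriesZl ?poisson_mass ?mule1// => k _; rewrite lee_fin.
Qed.

Variables (mu : {measure set X -> \bar R}) (intensity : set X -> \bar R).
Variables (F : nat -> set X) (eta : Om -> set X).
Hypothesis heta : is_poisson_process P intensity eta.
Hypothesis muE : forall B, measurable B -> intensity B = mu B.
Hypothesis mF : forall k, measurable (F k).
Hypothesis F_homo : forall k l, (k <= l)%N -> F k `<=` F l.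
Hypothesis F_cover : forall x, exists k, F k x.
Hypothesis F_fin : forall k, mu (F k) < +oo.

Let N B w : \bar R := counting (eta w `&` B).

Let mN B : measurable B -> measurable_fun setT (N B).
Proof. by move=> mB; have [h _ _] := heta; exact: h. Qed.

Let N_law B k : measurable B -> mu B < +oo ->
  P [set w | N B w = k%:R%:E] =
  (fine (mu B) ^+ k * k`!%:R^-1 * expR (- fine (mu B)))%:E.
Proof.
move=> mB Bfin; have [_ h _] := heta; rewrite /N (h B (fine (mu B)))//.
  by rewrite poisson_prob1// fine_ge0.
by rewrite muE// fineK// ge0_fin_numE.
Qed.

Let mN_eq B (y : \bar R) : measurable B -> measurable [set w | N B w = y].
Proof.
move=> mB; have := mN mB measurableT (emeasurable_set1 y).
by rewrite setTI.
Qed.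

Let N_nat B w : N B w = +oo \/ exists k : nat, N B w = k%:R%:E.
Proof. by rewrite /N /counting; case: ifP => _; [right; eexists|left]. Qed.

Let N_fin B : measurable B -> mu B < +oo -> P [set w | N B w = +oo] = 0.
Proof.
move=> mB Bfin.
have e : [set w | N B w = +oo] = ~` \bigcup_k [set w | N B w = k%:R%:E].
  apply/seteqP; split => w /= => [Nw [k _ /=]|h]; first by rewrite Nw.
  by have [//|[k hk]] := N_nat B w; case: h; exists k.
have mU : measurable (\bigcup_k [set w | N B w = k%:R%:E]).
  by apply: bigcup_measurable => k _; exact: mN_eq.
rewrite e probability_setC// measure_bigcup//=; first last.
- move=> i j _ _ [w [/= -> [/eqP]]]; rewrite eqr_nat => /eqP //.
- by move=> k _; exact: mN_eq.
rewrite (eq_eseriesl (Q := xpredT)); last by move=> j; rewrite in_setT.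
under eq_eseriesr do rewrite N_law//.
by rewrite poisson_mass ?fine_ge0// subee.
Qed.

Let N_mean B : measurable B -> mu B < +oo -> \int[P]_w N B w = mu B.
Proof.
move=> mB Bfin.
pose g w : \bar R := \sum_(k <oo) (k%:R%:E * (\1_[set w | N B w = k%:R%:E] w)%:E).
have mg : measurable_fun setT g.
  apply: ge0_emeasurable_sum => [k w _ _|k _].
    by rewrite mule_ge0 ?lee_fin.
  apply: measurable_funeM; apply/measurable_EFinP; apply: measurable_indic.
  exact: mN_eq.
have g0 w : 0 <= g w by apply: nneseries_ge0 => k _ _; rewrite mule_ge0 ?lee_fin.
rewrite (@ge0_integral_off_null _ _ _ P _ g [set w | N B w = +oo])//; first last.
- move=> w /= h; have [//|[k hk]] := N_nat B w; rewrite /g.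
  rewrite (nneseries_split_cond 0 k.+1)/=; last first.
    by move=> j _; rewrite mule_ge0 ?lee_fin.
  rewrite add0n [X in _ + X]eseries0 ?adde0; last first.
    move=> j kj _; rewrite indicE memNset ?mule0//= hk => -[/eqP].
    by rewrite eqr_nat => /eqP kj'; rewrite kj' ltnn in kj.
  rewrite big_mkord big_ord_recr/= big1 ?add0e; last first.
    move=> j _; rewrite indicE memNset ?mule0//= hk => -[/eqP].
    by rewrite eqr_nat => /eqP kj'; have := ltn_ord j; rewrite -kj' ltnn.
  by rewrite indicE mem_set//= mule1.
- exact: N_fin.
- exact: mN_eq.
rewrite /g integral_nneseries//; last first.
  move=> k; apply: measurable_funeM; apply/measurable_EFinP; apply: measurable_indic.
  exact: mN_eq.
rewrite -[RHS]fineK ?ge0_fin_numE// -poisson_first_moment ?fine_ge0//.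
apply: eq_eseriesr => k _; rewrite ge0_integralZl//.
- rewrite integral_indic ?setIT//; last exact: mN_eq.
  by rewrite EFinM -N_law.
- apply/measurable_EFinP; apply: measurable_indic; exact: mN_eq.
Qed.

(** Counts in windows of finite intensity are almost surely finite because the
    Poisson weights sum to 1; on the exceptional null set the process is
    replaced by the empty set. *)
Lemma poisson_locally_finite_version : exists eta' (N0 : set Om),
  [/\ lf_poisson P mu F eta', measurable N0, P N0 = 0 &
      forall w, ~ N0 w -> eta' w = eta w].
Proof.
pose N0 := \bigcup_k [set w | N (F k) w = +oo].
have mN0 : measurable N0 by apply: bigcup_measurable => k _; exact: mN_eq.
have PN0 : P N0 = 0.
  apply/eqP; rewrite eq_le measure_ge0 andbT.
  apply: le_trans (generalized_Boole_inequality P _ _) _ => //.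
    by move=> k; exact: mN_eq.
  by rewrite eseries0// => k _ _; exact: N_fin.
pose eta' w := if w \in N0 then set0 else eta w.
have eta'E w : ~ N0 w -> eta' w = eta w by move=> h; rewrite /eta' memNset.
have mN' B : measurable B -> measurable_fun setT (fun w => counting (eta' w `&` B) : \bar R).
  move=> mB; rewrite (_ : (fun _ => _) = (fun w => if w \in N0 then 0 else N B w)).
    apply: measurable_fun_ifT => //; last exact: mN.
    apply: (@measurable_fun_bool _ _ _ _ true).
    rewrite setTI (_ : _ @^-1` _ = N0)//.
    by apply/seteqP; split => x /= => [/set_mem|/mem_set].
  apply/funext => w; rewrite /eta'; case: ifP => // _.
  by rewrite set0I; apply/counting0P.
have mN'_eq B (y : \bar R) : measurable B -> measurable [set w | counting (eta' w `&` B) = y].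
  by move=> mB; have := mN' B mB measurableT _ (emeasurable_set1 y); rewrite setTI.
exists eta', N0; split => //; split => //.
- move=> B mB Bfin; rewrite -N_mean//; apply/esym.
  apply: (ge0_integral_off_null mN0 PN0) => //; first exact: mN'.
  by move=> w /eta'E ->.
- move=> B mB Bfin.
  rewrite (@measure_off_null N0 _ [set w | N B w = 0%:R%:E])//.
  + by rewrite N_law// expr0 fact0 invr1 !mul1r.
  + exact: mN'_eq.
  + exact: mN_eq.
  + by move=> w /eta'E e; rewrite /= e.
- move=> m B U mB tB mU; have [_ _ ind] := heta.
  rewrite (@measure_off_null N0 _ [set w | forall i, U i (N (B i) w)])//; first last.
  + by move=> w /eta'E e; rewrite /= e.
  + rewrite (_ : [set w | _] = \bigcap_(i in setT) (N (B i) @^-1` U i)); last first.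
      by apply/seteqP; split => w /= h i; [move=> _|]; exact: h.
    apply: fin_bigcap_measurable => [|i _]; first exact: finite_finset.
    by rewrite -[X in measurable X]setTI; exact: mN.
  + rewrite (_ : [set w | _] = \bigcap_(i in setT) ((fun w => counting (eta' w `&` B i)) @^-1` U i)); last first.
      by apply/seteqP; split => w /= h i; [move=> _|]; exact: h.
    apply: fin_bigcap_measurable => [|i _]; first exact: finite_finset.
    by rewrite -[X in measurable X]setTI; exact: mN'.
  rewrite ind//; apply: eq_bigr => i _; apply: (measure_off_null mN0 PN0).
  + by rewrite -[X in measurable X]setTI; exact: (mN (mB i)).
  + by rewrite -[X in measurable X]setTI; exact: (mN' _ (mB i)).
  + by move=> w /eta'E e; rewrite /= e.
- move=> k w; rewrite /eta'; case: ifPn => [_|/negP h]; first by rewrite set0I.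
  apply: contrapT => inf; apply: h; rewrite inE; exists k => //=.
  by rewrite /N /counting asboolF.
Qed.

End poisson_modification.

(** * Product measures and Lebesgue measure on row vectors *)

Section tuple_product_measure.
Context dX (X : measurableType dX) (R : realType).
Variable mu : {sigma_finite_measure set X -> \bar R}.
Local Open Scope ereal_scope.

Lemma tuple_product_measure m : exists M : {measure set (tuple_space X m) -> \bar R},
  forall B : 'I_m -> set X, (forall i, measurable (B i)) ->
    M (rectangle B) = \prod_(i < m) mu (B i).
Proof.
elim: m => [|m [M ME]].
  exists (\d_([tuple] : tuple_space X 0)) => B mB.
  by rewrite big_ord0 /= /dirac indicE mem_set// => -[].
pose c (p : tuple_space X m * X) : tuple_space X m.+1 := [tuple of p.2 :: p.1].
have mc : measurable_fun setT c.
  apply: (@measurable_cons _ _ _ _ snd m fst); first exact: measurable_snd.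
  exact: measurable_fst.
exists (pushforward (M \x mu) c) => B mB.
have cB : c @^-1` rectangle B = rectangle (fun i => B (lift ord0 i)) `*` B ord0.
  apply/seteqP; split => -[t x] /=.
    by move=> h; split => [i|]; [have := h (lift ord0 i); rewrite tnthS|exact: h ord0].
  by move=> [h1 h2] i; case: (unliftP ord0 i) => [j ->|->//]; rewrite tnthS; exact: h1.
transitivity ((M \x mu) (rectangle (fun i => B (lift ord0 i)) `*` B ord0)).
  exact: (congr1 (M \x mu) cB).
rewrite [LHS]product_measure1E//; last exact: measurable_rectangle.
by rewrite ME// big_ord_recl muleC.
Unshelve. all: exact: mc. Qed.

End tuple_product_measure.

Section lebesgue_rV_facts.
Context {R : realType}.
Local Open Scope ereal_scope.

(** Balls of the maximum norm are cubes. *)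
Lemma lebesgue_rV_ball n (w : 'rV[R]_n) (a : R) : (0 < a)%R ->
  lebesgue_rV (ball w a) = ((2 * a) ^+ n)%:E.
Proof.
move=> a0; elim: n w => [|n ih] w.
  rewrite expr0 /lebesgue_rV diracE mem_set//.
  by split => // i [].
pose wl : R := (w : 'rV[R]_(1 + n)) ord0 (lshift n ord0).
pose wr : 'rV[R]_n := rsubmx (w : 'rV[R]_(1 + n)).
rewrite /= /pushforward (_ : _ @^-1` _ = ball wl a `*` ball wr a).
  rewrite [LHS]product_measure1E//=.
  - by rewrite lebesgue_measure_ball ?ltW// ih -EFinM exprS mulr_natl.
  - by apply: open_measurable; exact: ball_open.
  - by apply: sub_gen_smallest; exact: ball_open.
apply/seteqP; split => -[x v] /=.
  move=> [_ h].
  have {}h (j : 'I_(1 + n)) : ball ((w : 'rV[R]_(1 + n)) ord0 j) a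
      ((row_mx x%:M v : 'rV[R]_(1 + n)) ord0 j) by exact: h.
  split; first by have := h (lshift n ord0); rewrite row_mxEl mxE eqxx mulr1n.
  by split => // i j; have := h (rshift 1 j); rewrite row_mxEr !mxE (ord1 i).
move=> [xk [_ vk]]; split => // i j.
suff h (k : 'I_(1 + n)) : ball ((w : 'rV[R]_(1 + n)) ord0 k) a
    ((row_mx x%:M v : 'rV[R]_(1 + n)) ord0 k) by rewrite (ord1 i); exact: h.
case: (split_ordP k) => l -> /=; rewrite ?row_mxEl ?row_mxEr.
  by rewrite (ord1 l) mxE eqxx mulr1n.
by have := vk ord0 l; rewrite !mxE.
Qed.

(** Fubini along the first coordinate.  It covers points and Euclidean spheres,
    whose lines in the first direction have at most two points. *)
Lemma lebesgue_rV_null n (A : set 'rV[R]_n.+1) : measurable A ->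
  (forall v : 'rV[R]_n,
     countable [set x : R | A (row_mx x%:M v : 'rV[R]_(1 + n))]) ->
  lebesgue_rV A = 0.
Proof.
move=> mA cA; rewrite /= /pushforward.
set B := _ @^-1` A.
have mB : measurable B.
  by rewrite /B -[X in measurable X]setTI; exact: rV_cons_measurable.
transitivity (\int[@lebesgue_measure R \x @lebesgue_rV R n]_z (\1_B z)%:E).
  by rewrite integral_indic// setIT.
rewrite fubini_tonelli2//; first last.
  by apply/measurable_EFinP; exact: measurable_indic.
rewrite (indic_fubini_tonelli_GE (@lebesgue_measure R) mB).
apply: integral0_eq => v _ /=; apply: countable_lebesgue_measure0.
apply: sub_countable (cA v); apply: subset_card_le => x.
by rewrite /ysection/= inE.
Qed.

End lebesgue_rV_facts.

(** * The Pareto law of the heights *)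

Section pareto_measure.
Context {R : realType}.

Lemma measurable_invr : measurable_fun setT (@GRing.inv R).
Proof.
rewrite -(setvU [set 0 : R]); apply/measurable_funU => //.
  exact: measurableC.
split; last exact: measurable_fun_set1.
apply: open_continuous_measurable_fun.
  by apply: closed_openC; exact: closed_eq.
by move=> x; rewrite inE/= => /eqP x0; exact: inv_continuous.
Qed.

Lemma is_derive_powN (n : nat) (y : R) : (0 < n)%N -> 0 < y ->
  is_derive y 1 (fun z : R => - (n%:R^-1 * z ^- n)) (y ^- n.+1).
Proof.
move=> n0 y0.
have yn0 : y ^+ n != 0 by rewrite expf_neq0 ?gt_eqF.
have h0 : is_derive y 1 (fun z : R => z ^+ n) (n%:R * y ^+ n.-1).
  have h := @is_deriveX R R^o (@id R) n y 1 1 (is_derive_id _ _).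
  rewrite (_ : (fun z => z ^+ n) = (@id R) ^+ n); last first.
    by apply/funext => z; rewrite exprfctE.
  by apply: is_derive_eq h _; rewrite /GRing.scale/= mulr1.
have h := is_deriveN (is_deriveZ n%:R^-1 (@is_deriveV R (fun z => z ^+ n) y _ 1 yn0 h0)).
apply: (is_derive_eq h); rewrite /GRing.scale/=.
have -> : y ^+ n.-1 = y ^+ n / y.
  by rewrite -[in RHS](prednK n0) exprS mulrC mulKf// gt_eqF.
have nR0 : n%:R != 0 :> R by rewrite pnatr_eq0 -lt0n.
rewrite [y ^+ n.+1]exprS; move: (y ^+ n) (n%:R : R) yn0 nR0 => Y c Y0 c0.
by field; rewrite Y0 c0 gt_eqF.
Qed.

Lemma integral_powN (n : nat) (b : R) : (0 < n)%N -> 0 < b ->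
  (\int[@lebesgue_measure R]_(y in `[b, +oo[) (y ^- n.+1)%:E = (n%:R^-1 * b ^- n)%:E)%E.
Proof.
move=> n0 b0.
rewrite (@ge0_continuous_FTC2y R _ (fun z : R => - (n%:R^-1 * z ^- n)) _ 0).
- by rewrite sub0e -EFinN opprK.
- by move=> x bx; rewrite invr_ge0 exprn_ge0// ltW// (lt_le_trans b0).
- apply: continuous_in_subspaceT => x; rewrite inE/= in_itv/= andbT => bx.
  have h : {for x, continuous (fun z : R => (z ^+ n.+1)^-1)}.
    apply: continuousV; first by rewrite expf_neq0// gt_eqF// (lt_le_trans b0).
    exact: exprn_continuous.
  exact: h.
- apply/cvgrPdist_lt => e e0; near=> x.
  have x1 : 1 <= x by near: x; exact: nbhs_pinfty_ge.
  have xe : e^-1 < x by near: x; apply: nbhs_pinfty_gt; rewrite num_real.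
  have x0 : 0 < x := lt_le_trans ltr01 x1.
  rewrite opprK add0r ger0_norm ?mulr_ge0 ?invr_ge0 ?ler0n ?exprn_ge0 ?ltW//.
  apply: (@le_lt_trans _ _ x^-1); last by rewrite invf_plt ?posrE.
  have nV1 : n%:R^-1 <= 1 :> R by rewrite invf_le1 ?ler1n ?ltr0n.
  have xVn : x ^- n <= x^-1.
    by rewrite lef_pV2 ?posrE ?exprn_gt0// -[leLHS]expr1; exact: ler_weXn2l.
  by rewrite -[leRHS]mul1r; apply: ler_pM => //; rewrite invr_ge0// exprn_ge0// ltW.
- by move=> x bx; have := is_derive_powN n0 (lt_trans b0 bx); case.
- apply: cvg_at_right_filter; have [db _] := is_derive_powN n0 b0.
  by move/derivable1_diffP/differentiable_continuous : db; apply.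
- move=> x; rewrite in_itv/= andbT => bx; rewrite derive1E.
  by have h := is_derive_powN n0 (lt_trans b0 bx); rewrite (@derive_val _ _ _ _ _ _ _ h).
Unshelve. all: by end_near. Qed.

(** For l > 0 the density of the height in the intensity with
    gamma = l^n, on the horoball of height l; its total mass is 1/n for every l. *)
Definition pareto_density (n : nat) (l : R) (y : R) : R :=
  if l <= y then l ^+ n * y ^- n.+1 else 0.

Lemma pareto_density_ge0 n l y : 0 < l -> 0 <= pareto_density n l y.
Proof.
move=> l0; rewrite /pareto_density; case: ifP => // ly.
by rewrite mulr_ge0 ?exprn_ge0 ?invr_ge0 ?exprn_ge0 ?ltW// (lt_le_trans l0).
Qed.

Lemma measurable_pareto_density n l : measurable_fun setT (pareto_density n l).
Proof.
apply: measurable_fun_ifT => //; first exact: measurable_fun_ler.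
apply: measurable_funM => //.
apply: (measurableT_comp measurable_invr).
exact: exprn_measurable.
Qed.

Section fixed_shape.
Variables (n : nat) (l : {posnum R}).
Local Open Scope ereal_scope.

Definition pareto (A : set (measurableTypeR R)) : \bar R :=
  \int[@lebesgue_measure R]_(y in A) (pareto_density n l%:num y)%:E.

Let pareto0 : pareto set0 = 0.
Proof. exact: integral_set0. Qed.

Let density_ge0 y : 0 <= (pareto_density n l%:num y)%:E.
Proof. by rewrite lee_fin pareto_density_ge0. Qed.

Let pareto_ge0 A : 0 <= pareto A.
Proof. by apply: integral_ge0 => y _. Qed.

Let mdensity : measurable_fun setT (fun y => (pareto_density n l%:num y)%:E).
Proof. by apply/measurable_EFinP; exact: measurable_pareto_density. Qed.

Let pareto_sigma_additive : semi_sigma_additive pareto.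
Proof.
move=> A mA tA mUA; rewrite /pareto ge0_integral_bigcup//; last first.
  exact: measurable_funTS.
apply: is_cvg_ereal_nneg_natsum_cond => k _ _; exact: pareto_ge0.
Qed.

HB.instance Definition _ := isMeasure.Build _ _ _ pareto
  pareto0 pareto_ge0 pareto_sigma_additive.

Lemma pareto_ray (a : R) : (0 < n)%N ->
  pareto `]a, +oo[ = (n%:R^-1 * (l%:num / Num.max a l%:num) ^+ n)%:E.
Proof.
move=> n0; set b := Num.max a l%:num.
have b0 : (0 < b)%R by rewrite lt_max gt0 orbT.
have lb : (l%:num <= b)%R by rewrite le_max lexx orbT.
transitivity (\int[@lebesgue_measure R]_(y in `[b, +oo[)
    ((l%:num ^+ n)%:E * (y ^- n.+1)%:E)).
  transitivity (\int[@lebesgue_measure R]_(y in `]b, +oo[) (pareto_density n l%:num y)%:E).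
    have [la|al] := leP l%:num a; first by rewrite /b max_l.
    rewrite /b max_r ?ltW// integral_itv_obnd_cbnd; last exact: measurable_funTS.
    rewrite /pareto integral_mkcond [RHS]integral_mkcond.
    apply: eq_integral => y _; rewrite !patchE !mem_setE !in_itv/= !andbT.
    have [ly|yl] := leP l%:num y.
      by rewrite (lt_le_trans al ly).
    by rewrite /pareto_density (lt_geF yl) if_same.
  rewrite integral_itv_obnd_cbnd; last exact: measurable_funTS.
  apply: eq_integral => y; rewrite inE/= in_itv/= andbT => yb.
  by rewrite /pareto_density (le_trans lb yb) EFinM.
rewrite ge0_integralZl_EFin//.
- by rewrite integral_powN// -EFinM expr_div_n mulrCA.
- move=> y; rewrite /= in_itv/= andbT => yb.
  by rewrite lee_fin invr_ge0 exprn_ge0// (le_trans _ yb)// ltW.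
- apply: measurable_funTS; apply/measurable_EFinP.
  by apply: (measurableT_comp measurable_invr); exact: exprn_measurable.
Qed.

Lemma pareto_mass : (0 < n)%N -> pareto setT = (n%:R^-1)%:E.
Proof.
move=> n0; pose A (k : nat) : set (measurableTypeR R) := `](- k%:R)%R, +oo[%classic.
have AT : \bigcup_k A k = setT.
  apply/seteqP; split => // y _; exists (Num.bound `|y|) => //=.
  rewrite /A /= in_itv/= andbT ltrNl.
  by apply: le_lt_trans (ler_norm _) _; rewrite normrN archi_boundP.
have : pareto (A k) @[k --> \oo] --> pareto (\bigcup_k A k).
  apply: nondecreasing_cvg_mu.
  - by move=> i; exact: measurable_itv.
  - by rewrite AT.
  - move=> i j ij; apply/subsetPset => y; rewrite /A /= !in_itv/= !andbT.
    by apply: le_lt_trans; rewrite lerN2 ler_nat.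
rewrite AT; move=> h; apply: (cvg_unique _ h) => //.
apply: cvg_near_cst; apply: nearW => k.
rewrite pareto_ray// max_r; last by rewrite (le_trans _ (ltW (gt0 l)))// oppr_le0.
by rewrite divff ?gt_eqF// expr1n mulr1.
Qed.

End fixed_shape.

(** Both sides agree on rays, where the total mass is finite. *)
Lemma pareto_scale n (l : {posnum R}) (A : set (measurableTypeR R)) : (0 < n)%N ->
  measurable A -> pareto n l A = pareto n (PosNum ltr01) (( *%R l%:num) @^-1` A).
Proof.
move=> n0 mA.
pose f : measurableTypeR R -> measurableTypeR R := *%R l%:num.
have ml : measurable_fun setT f by exact: measurable_funM.
pose nu : {measure set (measurableTypeR R) -> \bar R} := pushforward (pareto n (PosNum ltr01)) f.
apply: (@measure_unique _ R (measurableTypeR R) (@RGenOInfty.G R) (fun k => `](- k%:R)%R, +oo[%classic)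
  _ _ _ _ (pareto n l) (nu ml)) => //.
- exact: RGenOInfty.measurableE.
- move=> _ _ [x ->] [y ->]; exists (Num.max x y).
  by apply/seteqP; split => z /=; rewrite !in_itv/= !andbT gt_max => /andP.
- by move=> i; eexists.
- apply/seteqP; split => // y _; exists (Num.bound `|y|) => //=.
  rewrite /= in_itv/= andbT ltrNl.
  by apply: le_lt_trans (ler_norm _) _; rewrite normrN archi_boundP.
- move=> _ [x ->]; apply: (etrans (pareto_ray l x n0)).
  have -> : nu ml `]x, +oo[%classic = pareto n (PosNum ltr01) `]x / l%:num, +oo[%classic.
    congr (pareto n _ _); apply/seteqP; split => z /=; rewrite !in_itv/= !andbT.
      by rewrite ltr_pdivrMr// mulrC.
    by rewrite ltr_pdivrMr// mulrC.
  apply: esym; apply: (etrans (pareto_ray _ _ n0)) => /=; congr (_ * _ ^+ n)%:E.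
  rewrite div1r -[X in Num.max _ X](@divff _ l%:num) ?gt_eqF//.
  by rewrite -maxr_pMl ?invr_ge0// invf_div.
- by move=> k; rewrite [ltLHS](pareto_ray l _ n0) ltry.
Qed.

End pareto_measure.

(** * One measure behind all intensities *)

Section marked_intensity.
Context {R : realType}.
Local Open Scope ereal_scope.

(** The Pareto law seen on the reals with the measurable structure used for points
    of the half-space. *)
Definition height_law (m : nat) : set R -> \bar R :=
  pareto m.+1 (PosNum (@ltr01 R)).
Arguments height_law m _ : clear implicits.

Let height_law0 m : height_law m set0 = 0.
Proof. exact: (measure0 (pareto m.+1 (PosNum (@ltr01 R)))). Qed.

Let height_law_ge0 m A : 0 <= height_law m A.
Proof. exact: (measure_ge0 (pareto m.+1 (PosNum (@ltr01 R)))). Qed.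

Let height_law_sigma_additive m : semi_sigma_additive (height_law m).
Proof. exact: (@measure_semi_sigma_additive _ _ _ (pareto m.+1 (PosNum (@ltr01 R)))). Qed.

HB.instance Definition _ m := isMeasure.Build _ _ _ (height_law m)
  (@height_law0 m) (@height_law_ge0 m) (@height_law_sigma_additive m).

Lemma height_law_setT m : height_law m setT = (m.+1%:R^-1)%:E.
Proof. exact: pareto_mass. Qed.

Let height_law_finite m : fin_num_fun (height_law m).
Proof.
move=> A mA; rewrite ge0_fin_numE; last exact: measure_ge0.
apply: (@le_lt_trans _ _ (height_law m setT)).
  by apply: (le_measure (height_law m)); rewrite ?inE.
by rewrite height_law_setT ltry.
Qed.

HB.instance Definition _ m := @Measure_isFinite.Build _ _ _
  (height_law m) (@height_law_finite m).

Definition marked_volume (m : nat) : set ('rV[R]_m.+1 * R)%type -> \bar R :=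
  @lebesgue_rV R m.+1 \x height_law m.
Arguments marked_volume m _ : clear implicits.

HB.instance Definition _ m := Measure.on (marked_volume m).

(** The windows are unbounded in height: the heights have finite mass, and the
    scaling of the heights preserves them. *)
Definition cylinder (m k : nat) : set ('rV[R]_m.+1 * R) :=
  ball (0%R : 'rV[R]_m.+1) k.+1%:R `*` setT.
Arguments cylinder m k _ : clear implicits.

Lemma measurable_ball_rV n (v : 'rV[R]_n) r : measurable (ball v r).
Proof. by apply: sub_gen_smallest; exact: ball_open. Qed.

Lemma measurable_cylinder m k : measurable (cylinder m k).
Proof. by apply: measurableX => //; exact: measurable_ball_rV. Qed.

Lemma marked_volume_cylinder m k :
  marked_volume m (cylinder m k) =
  ((2 * k.+1%:R) ^+ m.+1 / m.+1%:R)%R%:E.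
Proof.
rewrite /marked_volume [LHS]product_measure1E//; last exact: measurable_ball_rV.
by rewrite [X in X * _]lebesgue_rV_ball// [X in _ * X]height_law_setT.
Qed.

Lemma cylinder_cover m : \bigcup_k cylinder m k = setT.
Proof.
apply/seteqP; split => // -[v y] _; exists (Num.bound `|v|) => //; split => //=.
rewrite mx_norm_ball /ball_/= sub0r normrN.
by rewrite (lt_trans (archi_boundP _))// ltr_nat.
Qed.

Lemma cylinder_mono m : {homo cylinder m : k l / (k <= l)%N >-> k `<=` l}.
Proof.
move=> k l kl [v y] [/= vk _]; split => //=.
by apply: le_ball vk; rewrite ler_nat ltnS.
Qed.

Let marked_volume_sigma_finite m : sigma_finite setT (marked_volume m).
Proof.
exists (cylinder m); first by rewrite cylinder_cover.
move=> k; split; first exact: measurable_cylinder.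
by rewrite marked_volume_cylinder ltry.
Qed.

HB.instance Definition _ m := Measure_isSigmaFinite.Build _ _ _
  (marked_volume m) (marked_volume_sigma_finite m).

Definition scale_height {m : nat} (l : R) (z : 'rV[R]_m.+1 * R) : 'rV[R]_m.+1 * R :=
  (z.1, (l * z.2)%R).

Lemma measurable_scale_height m (l : R) :
  measurable_fun setT (scale_height l : 'rV[R]_m.+1 * R -> _).
Proof.
apply: measurable_fun_pair; first exact: measurable_fst.
by apply: measurable_funM => //; exact: measurable_snd.
Qed.

(** The substitution y = l s on each vertical line. *)
Lemma horoball_intensityE m (l : R) (B : set ('rV[R]_m.+1 * R)) :
  (0 < l)%R -> measurable B ->
  horoball_intensity m.+2 (l ^+ m.+1) l B = marked_volume m (scale_height l @^-1` B).
Proof.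
move=> l0 mB.
pose f (z : 'rV[R]_m.+1 * R) : \bar R :=
  ((\1_B z : R) * pareto_density m.+1 l z.2)%:E.
have mf : measurable_fun setT f.
  apply/measurable_EFinP; apply: measurable_funM; first exact: measurable_indic.
  exact: (measurableT_comp (measurable_pareto_density m.+1 l) measurable_snd).
have f0 z : 0 <= f z by rewrite lee_fin mulr_ge0 ?pareto_density_ge0.
transitivity (\int[@lebesgue_rV R m.+1 \x @lebesgue_measure R]_z f z).
  rewrite /horoball_intensity /hyperbolic_volume -ge0_integralZl_EFin//; first last.
  - by rewrite exprn_ge0 ?ltW.
  - apply: measurable_funTS; apply/measurable_EFinP.
    apply: (measurableT_comp measurable_invr).
    exact: (measurableT_comp (exprn_measurable _) measurable_snd).
  - by move=> z [_ /= z0]; rewrite lee_fin invr_ge0 exprn_ge0 ?ltW.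
  - apply: measurableI; first (apply: measurableI => //).
      rewrite (_ : horoball m.+2 l = (@snd 'rV[R]_m.+1 R) @^-1` `[l, +oo[).
        by rewrite -[_ @^-1` _]setTI; exact: measurable_snd.
      by apply/seteqP; split => z /=; rewrite /horoball/= in_itv/= andbT.
    rewrite (_ : [set z | _] = (@snd 'rV[R]_m.+1 R) @^-1` `]0%R, +oo[).
      by rewrite -[_ @^-1` _]setTI; exact: measurable_snd.
    by apply/seteqP; split => z /=; rewrite in_itv/= andbT.
  rewrite integral_mkcond; apply: eq_integral => z _.
  rewrite patchE; case: ifPn => [/set_mem [[Bz lz] z0]|nz].
    by rewrite /f indicE mem_set// mul1r /pareto_density lz EFinM.
  rewrite /f indicE /pareto_density; case: ifP => lz; last by rewrite mulr0.
  rewrite memNset ?mul0r// => Bz; move/negP: nz; apply; apply/mem_set.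
  by split => //=; exact: lt_le_trans l0 lz.
rewrite fubini_tonelli1; [|exact: mf|exact: f0].
apply: eq_integral => v _.
transitivity (pareto m.+1 (PosNum l0) (xsection B v)).
  rewrite /fubini_F /pareto integral_mkcond [RHS]integral_mkcond.
  apply: eq_integral => y _; rewrite !patchE in_setT /f indicE mem_xsection.
  by case: ifP; rewrite ?mul1r ?mul0r.
by rewrite pareto_scale; last exact: measurable_xsection.
Qed.

Lemma homogeneous_intensityE m (B : set ('rV[R]_m.+1 * R)) : measurable B ->
  homogeneous_intensity (m.+1%:R)^-1 ((fun v => (v, 0%R)) @^-1` B) =
  marked_volume m (scale_height 0 @^-1` B).
Proof.
move=> mB; pose B0 := (fun v : 'rV[R]_m.+1 => (v, 0%R) : 'rV[R]_m.+1 * R) @^-1` B.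
have mB0 : measurable B0.
  rewrite -[B0]setTI.
  have mv0 : measurable_fun setT (fun v : 'rV[R]_m.+1 => (v, 0%R) : 'rV[R]_m.+1 * R).
    exact: measurable_fun_pair.
  exact: mv0.
rewrite /homogeneous_intensity -/B0.
rewrite (_ : scale_height 0 @^-1` B = B0 `*` setT).
  rewrite [RHS]product_measure1E//= height_law_setT// muleC.
  by [].
by apply/seteqP; split => -[v y] /=; rewrite /B0 /scale_height/= mul0r => // -[].
Qed.

End marked_intensity.
Arguments marked_volume {R} m _.
Arguments cylinder {R} m k _.

(** * Coordinates and separating half-spaces *)

Section measurable_coordinates.
Context {R : realType}.

Lemma measurable_coord n (i : 'I_n) :
  measurable_fun setT (fun v : 'rV[R]_n => v ord0 i).
Proof.
apply: (measurability _ (RGenOInfty.measurableE R)) => _ [_ [x ->] <-].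
rewrite setTI; apply: sub_gen_smallest.
apply: open_comp; last exact: interval_open.
by move=> v _; exact: coord_continuous.
Qed.

Definition coordinate {m : nat} (i : option 'I_m.+1) (z : 'rV[R]_m.+1 * R) : R :=
  if i is Some k then z.1 ord0 k else z.2.

Lemma measurable_coordinate m (i : option 'I_m.+1) :
  measurable_fun setT (coordinate i).
Proof.
case: i => [i|]; last exact: measurable_snd.
exact: (measurableT_comp (measurable_coord i) measurable_fst).
Qed.

Lemma coordinate_inj m (x y : 'rV[R]_m.+1 * R) :
  (forall i, coordinate i x = coordinate i y) -> x = y.
Proof.
case: x y => [u s] [v t] h; congr pair; last exact: (h None).
by apply/rowP => i; exact: (h (Some i)).
Qed.

Definition coordinate_halfspace {m : nat} (p : option 'I_m.+1 * rat * bool) :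
    set ('rV[R]_m.+1 * R) :=
  if p.2 then [set z | coordinate p.1.1 z < ratr p.1.2]
  else [set z | ratr p.1.2 < coordinate p.1.1 z].

Definition halfspace_enum m (j : nat) : set ('rV[R]_m.+1 * R) :=
  oapp (@coordinate_halfspace m) set0 (choice.unpickle j).

Lemma measurable_halfspace_enum m j : measurable (@halfspace_enum m j).
Proof.
rewrite /halfspace_enum; case: (choice.unpickle j) => [[[i q] b]|] //=.
have mi := @measurable_coordinate m i.
rewrite /coordinate_halfspace/=; case: b.
  rewrite (_ : [set z | _] = setT `&` coordinate i @^-1` `]-oo, ratr q[); first exact: mi.
  by rewrite setTI; apply/seteqP; split => z /=; rewrite in_itv.
rewrite (_ : [set z | _] = setT `&` coordinate i @^-1` `]ratr q, +oo[); first exact: mi.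
by rewrite setTI; apply/seteqP; split => z /=; rewrite in_itv/= andbT.
Qed.

Lemma halfspace_enum_separates m (x y : 'rV[R]_m.+1 * R) : x <> y ->
  exists j, halfspace_enum j x /\ ~ halfspace_enum j y.
Proof.
move=> xy.
have [i xyi] : exists i, coordinate i x != coordinate i y.
  apply: contrapT => h; apply: xy; apply: coordinate_inj => i.
  by apply/eqP/negPn/negP => n; apply: h; exists i.
have enumE p : halfspace_enum (choice.pickle p) = coordinate_halfspace p :> set ('rV[R]_m.+1 * R).
  by rewrite /halfspace_enum choice.pickleK.
case: (ltgtP (coordinate i x) (coordinate i y)) xyi => // lt _.
  have [q] := rat_in_itvoo lt; rewrite in_itv/= => /andP[xq qy].
  exists (choice.pickle (i, q, true)); rewrite enumE; split => //=.
  by apply/negP; rewrite -leNgt ltW.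
have [q] := rat_in_itvoo lt; rewrite in_itv/= => /andP[yq qx].
exists (choice.pickle (i, q, false)); rewrite enumE; split => //=.
by apply/negP; rewrite -leNgt ltW.
Qed.

End measurable_coordinates.

Lemma measurable_eq_fun d (T : measurableType d) (R : realType) (f g : T -> R) :
  measurable_fun setT f -> measurable_fun setT g -> measurable [set x | f x = g x].
Proof.
move=> mf mg; rewrite (_ : [set x | _] = setT `&` (f \- g) @^-1` [set 0]).
  by apply: measurable_funB => //; exact: measurable_set1.
by rewrite setTI; apply/seteqP; split => x /= => [->|/eqP]; rewrite ?subrr// subr_eq0 => /eqP.
Qed.

(** * The intensity for every scale l, including l = 0 *)

Section scaled_volume.
Context {R : realType}.
Local Open Scope ereal_scope.

Definition scaled_volume (m : nat) (l : R) : set ('rV[R]_m.+1 * R) -> \bar R :=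
  pushforward (marked_volume m) (scale_height l).
Arguments scaled_volume m l _ : clear implicits.

Let scaled_volume_ex m l : exists nu : {measure set ('rV[R]_m.+1 * R) -> \bar R},
  (nu : set _ -> _) = scaled_volume m l.
Proof.
by exists (pushforward (marked_volume m) (scale_height l)).
Unshelve. all: exact: measurable_scale_height. Qed.

Let scaled_volume0 m l : scaled_volume m l set0 = 0.
Proof. by have [nu <-] := scaled_volume_ex m l. Qed.

Let scaled_volume_ge0 m l A : 0 <= scaled_volume m l A.
Proof. by have [nu <-] := scaled_volume_ex m l. Qed.

Let scaled_volume_sigma_additive m l : semi_sigma_additive (scaled_volume m l).
Proof.
by have [nu <-] := scaled_volume_ex m l; exact: measure_semi_sigma_additive.
Qed.

HB.instance Definition _ m l := isMeasure.Build _ _ _ (scaled_volume m l)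
  (@scaled_volume0 m l) (@scaled_volume_ge0 m l) (@scaled_volume_sigma_additive m l).

Lemma scale_height_cylinder m k l :
  scale_height l @^-1` cylinder m k = cylinder m k :> set ('rV[R]_m.+1 * R).
Proof. by apply/seteqP; split => -[]. Qed.

Lemma scaled_volume_cylinder m k l : scaled_volume m l (cylinder m k) < +oo.
Proof.
rewrite /scaled_volume /pushforward scale_height_cylinder.
by rewrite marked_volume_cylinder ltry.
Qed.

Lemma lf_poisson_scaled_volume m l dO (Om : measurableType dO)
    (P : probability Om R) (intensity : set ('rV[R]_m.+1 * R) -> \bar R)
    (eta : Om -> set ('rV[R]_m.+1 * R)) :
  is_poisson_process P intensity eta ->
  (forall B, measurable B -> intensity B = scaled_volume m l B) ->
  exists eta' (N0 : set Om),
  [/\ lf_poisson P (scaled_volume m l) (cylinder m) eta', measurable N0, P N0 = 0 &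
      forall w, ~ N0 w -> eta' w = eta w].
Proof.
move=> heta muE; apply: (poisson_locally_finite_version heta) => //.
- by move=> k; exact: measurable_cylinder.
- exact: cylinder_mono.
- by move=> x; have : [set: 'rV[R]_m.+1 * R] x by []; rewrite -cylinder_cover => -[k _]; exists k.
- by move=> k; exact: scaled_volume_cylinder.
Qed.

End scaled_volume.
Arguments scaled_volume {R} m l _.

(** * No two points on a vertical line *)

Lemma measurable_rV_set1 (R : realType) n (v : 'rV[R]_n) : measurable [set v].
Proof.
rewrite (_ : [set v] = \bigcap_(i in [set: 'I_n]) [set u | u ord0 i = v ord0 i]).
  apply: fin_bigcap_measurable => [|i _]; first exact: finite_finset.
  by apply: measurable_eq_fun => //; exact: measurable_coord.
by apply/seteqP; split => u /= => [-> //|h]; apply/rowP => i; exact: h.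
Qed.

Lemma lebesgue_rV_set1 (R : realType) m (v : 'rV[R]_m.+1) : lebesgue_rV [set v] = 0%E.
Proof.
apply: lebesgue_rV_null; first exact: measurable_rV_set1.
move=> u; apply: (@sub_countable _ _ _ [set v ord0 ord0]); last exact: countable1.
apply: subset_card_le => x /= <-.
rewrite (_ : ord0 = lshift m (ord0 : 'I_1)); last exact/val_inj.
by rewrite (@row_mxEl _ _ 1) !mxE eqxx mulr1n.
Qed.

Section no_vertical_pairs.
Context {R : realType} (m : nat) (l : R).
Context dO (Om : measurableType dO) (P : probability Om R).
Variable eta : Om -> set ('rV[R]_m.+1 * R).
Hypothesis heta : lf_poisson P (scaled_volume m l) (cylinder m) eta.
Local Open Scope ereal_scope.
Let X := ('rV[R]_m.+1 * R)%type.

Let pair_tuple (p : X * X) : tuple_space X 2 :=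
  [tuple scale_height l p.1; scale_height l p.2].

Let measurable_pair_tuple : measurable_fun setT pair_tuple.
Proof.
apply: measurable_cons.
  exact: (measurableT_comp (measurable_scale_height _) measurable_fst).
apply: measurable_cons.
  exact: (measurableT_comp (measurable_scale_height _) measurable_snd).
exact: measurable_cst.
Qed.

Let vertical : set (tuple_space X 2) :=
  [set t | tnth t ord0 <> tnth t ord_max /\ (tnth t ord0).1 = (tnth t ord_max).1].

Let measurable_same (i : option 'I_m.+1) : measurable
  [set t : tuple_space X 2 | coordinate i (tnth t ord0) = coordinate i (tnth t ord_max)].
Proof.
apply: measurable_eq_fun;
  exact: (measurableT_comp (measurable_coordinate i) (measurable_tnth _)).
Qed.

Let measurable_vertical : measurable vertical.
Proof.
rewrite (_ : vertical =
  ~` (\bigcap_(i in [set: option 'I_m.+1]) [set t : tuple_space X 2 |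
       coordinate i (tnth t ord0) = coordinate i (tnth t ord_max)]) `&`
  \bigcap_(i in [set: 'I_m.+1]) [set t : tuple_space X 2 |
       coordinate (Some i) (tnth t ord0) = coordinate (Some i) (tnth t ord_max)]).
  apply: measurableI; first apply: measurableC.
    apply: fin_bigcap_measurable => [|i _]; first exact: finite_finset.
    exact: measurable_same.
  apply: fin_bigcap_measurable => [|i _]; first exact: finite_finset.
  exact: (measurable_same (Some i)).
apply/seteqP; split => t /= [h1 h2]; split.
- by move=> h; apply: h1; apply: coordinate_inj => i; exact: h.
- by move=> i _ /=; rewrite h2.
- by move=> h; apply: h1 => i _ /=; rewrite h.
- by apply/rowP => i; exact: (h2 i I).
Qed.

(** By the Mecke formula the mean number of pairs of distinct points with the same
    first component is the mass of a null set. *)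
Lemma no_vertical_pairs : exists N0 : set Om, [/\ measurable N0, P N0 = 0 &
  forall w, ~ N0 w -> forall x y, eta w x -> eta w y -> x.1 = y.1 -> x = y].
Proof.
have [M [M_rectangle M_vertical]] : exists M : {measure set (tuple_space X 2) -> \bar R},
    (forall B : 'I_2 -> set X, (forall i, measurable (B i)) ->
      M (rectangle B) = \prod_(i < 2) scaled_volume m l (B i)) /\ M vertical = 0.
  exists (pushforward (marked_volume m \x marked_volume m) pair_tuple).
  split => [B mB|].
    have eB : pair_tuple @^-1` rectangle B =
        (scale_height l @^-1` B ord0) `*` (scale_height l @^-1` B ord_max).
      apply/seteqP; split => -[x y] /=.
        by move=> h; split; [exact: (h ord0)|exact: (h ord_max)].
      move=> [hx hy] i; case: (unliftP ord0 i) => [j ->|->]; last exact: hx.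
      by rewrite (_ : lift ord0 j = ord_max)//; apply/val_inj; rewrite /= (ord1 j).
    transitivity ((marked_volume m \x marked_volume m)
        ((scale_height l @^-1` B ord0) `*` (scale_height l @^-1` B ord_max))).
      exact: (congr1 (marked_volume m \x marked_volume m) eB).
    rewrite [LHS]product_measure1E.
    - rewrite [RHS]big_ord_recl [X in _ = _ * X]big_ord1 (_ : lift ord0 ord0 = ord_max)//.
      exact/val_inj.
    - by rewrite -[_ @^-1` _]setTI; exact: (measurable_scale_height l measurableT (mB _)).
    - by rewrite -[_ @^-1` _]setTI; exact: (measurable_scale_height l measurableT (mB _)).
  rewrite /pushforward /product_measure1; apply: integral0_eq => x _ /=.
  apply/eqP; rewrite eq_le measure_ge0 andbT.
  apply: (@le_trans _ _ (marked_volume m ([set x.1] `*` setT))).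
    apply: le_measure; rewrite ?inE.
    - apply: measurable_xsection; rewrite -[_ @^-1` _]setTI; exact: measurable_pair_tuple.
    - by apply: measurableX => //; exact: measurable_rV_set1.
    - by move=> y; rewrite /xsection/= inE => -[_ /= e]; split.
  rewrite [leLHS]product_measure1E//; last exact: measurable_rV_set1.
  by rewrite [X in X * _]lebesgue_rV_set1 mul0e.
have vertical_inj t : vertical t -> injective (tnth t).
  move=> [ne _] i j; case: (unliftP ord0 i) => [i' ->|->]; case: (unliftP ord0 j) => [j' ->|->] //;
    rewrite ?(ord1 i') ?(ord1 j') //.
  - by rewrite (_ : lift ord0 ord0 = ord_max); [move=> /esym/ne|exact/val_inj].
  - by rewrite (_ : lift ord0 ord0 = ord_max); [move=> /ne|exact/val_inj].
have [mN iN] := mecke_mean heta M_rectangle (@measurable_halfspace_enum R m)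
  (@halfspace_enum_separates R m) measurable_vertical vertical_inj.
pose c w := tuple_count (eta w) vertical : \bar R.
have mN0 : measurable [set w | 1 <= c w].
  by rewrite -[X in measurable X]setTI; exact: (emeasurable_fun_c_infty measurableT mN).
exists [set w | 1 <= c w]; split => //.
  apply/eqP; rewrite eq_le measure_ge0 andbT.
  rewrite -M_vertical -iN -[X in P X]setIT -integral_indic//.
  apply: ge0_le_integral => //.
  - by apply/measurable_EFinP; exact: measurable_indic.
  - move=> w _; rewrite indicE; case: (boolP (w \in _)) => [/set_mem//|_].
    exact: tuple_count_ge0.
move=> w nw x y ex ey xy; apply: contrapT => nxy; apply: nw => /=.
pose t : 2.-tuple ('rV[R]_m.+1 * R) := [tuple x; y].
have vt : vertical t by [].
apply: esum_ge; exists [set t].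
  split; first exact: finite_set1.
  move=> _ ->; split; first exact: vertical_inj.
  move=> i; case: (unliftP ord0 i) => [j ->|-> //].
  by rewrite (_ : lift ord0 j = ord_max)//; apply/val_inj; rewrite /= (ord1 j).
by rewrite fsbig_set1 indicE mem_set.
Unshelve. all: exact: measurable_pair_tuple. Qed.

End no_vertical_pairs.

(** * The half-ball through an affinely independent tuple *)

Section circumscribed_halfball.
Context {R : realType} {m : nat}.
Local Notation V := 'rV[R]_m.+1.
Implicit Types (p : 'I_m.+2 -> V * R) (x : 'I_m.+2 -> V).

Definition edges x : 'M[R]_m.+1 := \matrix_(i, j) (x (lift ord0 i) - x ord0) ord0 j.

Lemma mulmx_edges x (a : 'rV[R]_m.+1) :
  a *m edges x = \sum_i a ord0 i *: (x (lift ord0 i) - x ord0).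
Proof.
apply/rowP => j; rewrite !mxE summxE; apply: eq_bigr => i _.
by rewrite !mxE.
Qed.

Lemma affinely_independent_det x :
  affinely_independent x <-> \det (edges x) != 0.
Proof.
split => [ax|/det0P nz a a0 ax].
  apply/det0P => -[a a0]; rewrite mulmx_edges => aD.
  (* A linear relation between the edges is an affine relation between the points. *)
  pose b (i : 'I_m.+2) : R := if unlift ord0 i is Some j then a ord0 j else - \sum_j a ord0 j.
  have b0 : b ord0 = - \sum_j a ord0 j by rewrite /b unlift_none.
  have bS j : b (lift ord0 j) = a ord0 j by rewrite /b liftK.
  have /(ax b) h : \sum_i b i = 0.
    by rewrite big_ord_recl b0 (eq_bigr _ (fun i _ => bS i)) addNr.
  have /h bz : \sum_i b i *: x i = 0.
    rewrite big_ord_recl b0 -[RHS]aD.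
    under [in RHS]eq_bigr => i _ do rewrite scalerBr.
    rewrite sumrB -scaler_suml addrC scaleNr; congr (_ - _).
    by apply: eq_bigr => i _; rewrite bS.
  by move/eqP: a0; apply; apply/rowP => j; rewrite mxE -bS bz.
have tail i : a (lift ord0 i) = 0.
  have [aD|aD] := eqVneq (\row_i a (lift ord0 i)) 0.
    by have := congr1 (fun v : 'rV[R]_m.+1 => v ord0 i) aD; rewrite !mxE.
  exfalso; apply: nz; exists (\row_i a (lift ord0 i)) => //.
  rewrite mulmx_edges; under eq_bigr => j _ do rewrite mxE scalerBr.
  rewrite sumrB -scaler_suml; move: a0 ax; rewrite !big_ord_recl => /eqP.
  by rewrite addr_eq0 => /eqP ->; rewrite scaleNr addrC.
move=> i; case: (unliftP ord0 i) => [j ->|->]; first exact: tail.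
by move: a0; rewrite big_ord_recl big1 ?addr0// => j _; exact: tail.
Qed.

(** The centre w satisfies, for each edge u from the vertex 0 to a vertex i,
    2 u . (w - v0) = |u|^2 + y_i^2 - y_0^2, obtained by subtracting two of the
    equations |v_i - w|^2 + y_i^2 = r^2. *)
Definition sphere_rhs p : 'cV[R]_m.+1 :=
  \col_i ((enorm ((p (lift ord0 i)).1 - (p ord0).1) ^+ 2 +
           (p (lift ord0 i)).2 ^+ 2 - (p ord0).2 ^+ 2) / 2).

(** Cramer's rule, which makes the centre visibly measurable in the points. *)
Definition center p : V := (p ord0).1 +
  ((\det (edges (fun i => (p i).1)))^-1 *:
     (\adj (edges (fun i => (p i).1)) *m sphere_rhs p))^T.

Definition rad2 p : R := enorm ((p ord0).1 - center p) ^+ 2 + (p ord0).2 ^+ 2.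

Lemma enorm_sqrB (u v : V) :
  enorm (u - v) ^+ 2 = enorm u ^+ 2 + enorm v ^+ 2 - 2 * (\sum_i u ord0 i * v ord0 i).
Proof.
rewrite !enorm_sqr mulr_sumr -big_split/= -sumrB; apply: eq_bigr => i _.
by rewrite !mxE; ring.
Qed.

Lemma edges_center p (w : V) : affinely_independent (fun i => (p i).1) ->
  edges (fun i => (p i).1) *m (w - (p ord0).1)^T = sphere_rhs p <-> w = center p.
Proof.
move/affinely_independent_det; set D := edges _ => D0; rewrite /center -/D.
have uD : D \in unitmx by rewrite unitmxE unitfE.
split => [Dw|->].
  rewrite -Dw mulmxA mul_adj_mx scalemxAl scale_scalar_mx mulVf// mul1mx trmxK.
  by rewrite addrC subrK.
by rewrite addrC addKr trmxK -scalemxAr mulmxA mul_mx_adj mul_scalar_mx scalerA mulVf// scale1r.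
Qed.

(** Subtracting the equation of the vertex 0 from the others turns the equations of
    the sphere into the invertible linear system solved by [center]. *)
Lemma circumsphereP p (w : V) (s : R) : affinely_independent (fun i => (p i).1) ->
  (forall i, enorm ((p i).1 - w) ^+ 2 + (p i).2 ^+ 2 = s) <->
  w = center p /\ s = rad2 p.
Proof.
move=> ap.
have key u i : (enorm ((p (lift ord0 i)).1 - u) ^+ 2 + (p (lift ord0 i)).2 ^+ 2 =
      enorm ((p ord0).1 - u) ^+ 2 + (p ord0).2 ^+ 2) <->
    (edges (fun i => (p i).1) *m (u - (p ord0).1)^T) i ord0 = sphere_rhs p i ord0.
  rewrite !mxE.
  rewrite (_ : (p (lift ord0 i)).1 - u = ((p (lift ord0 i)).1 - (p ord0).1) - (u - (p ord0).1)); last first.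
    by rewrite opprB addrA subrK.
  rewrite enorm_sqrB (enormB _ u).
  set S := \sum_(_ < _) ((p (lift ord0 i)).1 - (p ord0).1) ord0 _ * _.
  rewrite (_ : \sum_j _ = S); last by apply: eq_bigr => j _; rewrite !mxE.
  by split => h; lra.
split => [h|[-> -> i]].
  have wc : w = center p.
    apply/(edges_center w ap)/matrixP => i j; rewrite (ord1 j); apply/key.
    by rewrite !h.
  by split => //; rewrite -(h ord0) wc.
case: (unliftP ord0 i) => [j ->|-> //].
by apply/key; rewrite ((edges_center _ ap).2 erefl).
Qed.

Lemma rad2_gt0 p : affinely_independent (fun i => (p i).1) -> 0 < rad2 p.
Proof.
move=> ap; rewrite lt_neqAle eq_sym addr_ge0 ?sqr_ge0// andbT.
apply/negP => /eqP r0.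
have on_center i : (p i).1 = center p.
  have /eqP : enorm ((p i).1 - center p) ^+ 2 + (p i).2 ^+ 2 = 0.
    by rewrite ((circumsphereP _ _ ap).2 (conj erefl erefl) i).
  rewrite paddr_eq0 ?sqr_ge0// sqrf_eq0 => /andP[/eqP e _].
  apply/eqP; rewrite -subr_eq0 -normr_le0; rewrite -[leRHS]e.
  exact: le_norm_enorm.
move/affinely_independent_det/negP : ap; apply; apply/eqP.
rewrite (_ : edges _ = 0) ?det0//; apply/matrixP => i j.
by rewrite /edges mxE !on_center subrr !mxE.
Qed.

Definition halfball p : set (V * R) :=
  [set q | enorm (q.1 - center p) ^+ 2 + q.2 ^+ 2 < rad2 p].

Lemma halfball_boundary p i : affinely_independent (fun i => (p i).1) ->
  ~ halfball p (p i).
Proof.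
by move=> ap; rewrite /halfball/= ((circumsphereP _ _ ap).2 (conj erefl erefl) i) ltxx.
Qed.

Lemma empty_halfballP p (E : set (V * R)) : affinely_independent (fun i => (p i).1) ->
  (exists (w : V) (r : R),
    [/\ 0 < r,
        forall i, enorm ((p i).1 - w) ^+ 2 + (p i).2 ^+ 2 = r ^+ 2 &
        forall q, E q -> ~ enorm (q.1 - w) ^+ 2 + q.2 ^+ 2 < r ^+ 2]) <->
  E `&` halfball p = set0.
Proof.
move=> ap; split.
  move=> [w [r [_ /(circumsphereP _ _ ap)[-> ->] h]]].
  by apply/seteqP; split => // q [Eq]; exact: h Eq.
move=> h; exists (center p), (Num.sqrt (rad2 p)).
have r0 := rad2_gt0 ap.
rewrite sqr_sqrtr ?(ltW r0)// sqrtr_gt0; split => //.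
  exact: (circumsphereP _ _ ap).2.
by move=> q Eq hq; have : (E `&` halfball p) q by []; rewrite h.
Qed.

End circumscribed_halfball.

Section affine_independence_permuted.
Context {R : realType} {n k : nat}.

Lemma affinely_independent_perm (x : 'I_k -> 'rV[R]_n) (s : {perm 'I_k}) :
  affinely_independent x -> affinely_independent (x \o s).
Proof.
move=> ax a a0 h i.
pose b j := a ((s^-1)%g j).
have b0 : \sum_j b j = 0.
  by rewrite (reindex_inj (@perm_inj _ s)) -[RHS]a0; apply: eq_bigr => j _; rewrite /b permK.
have bx : \sum_j b j *: x j = 0.
  by rewrite (reindex_inj (@perm_inj _ s)) -[RHS]h; apply: eq_bigr => j _; rewrite /b permK.
by have := ax b b0 bx (s i); rewrite /b permK.
Qed.

Lemma hull_perm (x : 'I_k -> 'rV[R]_n) (s : {perm 'I_k}) : hull (x \o s) = hull x.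
Proof.
apply/seteqP; split => v [a [a0 a1 ->]].
  exists (a \o (s^-1)%g); split => [i||] /=; first exact: a0.
    by rewrite -a1 [RHS](reindex_inj (@perm_inj _ s^-1%g)).
  rewrite [LHS](reindex_inj (@perm_inj _ s^-1%g)); apply: eq_bigr => i _ /=.
  by rewrite permKV.
exists (a \o s); split => [i||] /=; first exact: a0.
  by rewrite -a1 [RHS](reindex_inj (@perm_inj _ s)).
by rewrite [LHS](reindex_inj (@perm_inj _ s)).
Qed.

Lemma affinely_independent_inj (x : 'I_k -> 'rV[R]_n) :
  affinely_independent x -> injective x.
Proof.
move=> ax i j xij; apply/eqP; apply: contraT => ij.
pose a l : R := (l == i)%:R - (l == j)%:R.
have sumdelta (f : 'I_k -> 'rV[R]_n) l : \sum_h (h == l)%:R *: f h = f l.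
  rewrite (bigD1 l)//= eqxx scale1r big1 ?addr0// => h /negPf ->.
  by rewrite scale0r.
have sum1 l : \sum_(h < k) (h == l)%:R = 1 :> R.
  by rewrite (bigD1 l)//= eqxx big1 ?addr0// => h /negPf ->.
have := ax a _ _ i; rewrite /a eqxx (negPf ij) subr0 => h.
suff /eqP : true%:R = 0 :> R by rewrite oner_eq0.
apply: h; first by rewrite sumrB !sum1 subrr.
under eq_bigr => l _ do rewrite scalerBl.
by rewrite sumrB !sumdelta xij subrr.
Qed.

End affine_independence_permuted.

(** * Cells and the tuples of points spanning them *)

Section cells_and_tuples.
Context {R : realType} {m : nat}.
Local Notation X := ('rV[R]_m.+1 * R)%type.
Implicit Types (t : m.+2.-tuple X) (E : set X).
Local Open Scope ereal_scope.

Definition vertices t (i : 'I_m.+2) : 'rV[R]_m.+1 := (tnth t i).1.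

Definition cell_tuples E : set (m.+2.-tuple X) :=
  [set t | [/\ @distinct_tuples _ m.+2 E t, affinely_independent (vertices t) &
               E `&` halfball (tnth t) = set0]].

Lemma hyperbolic_delaunayE E :
  hyperbolic_delaunay m.+2 E = [set hull (vertices t) | t in cell_tuples E].
Proof.
apply/seteqP; split => C.
  move=> [p [pinj Ep ap sph ->]]; exists [tuple p i | i < m.+2]; last first.
    by congr hull; apply/funext => i; rewrite /vertices tnth_mktuple.
  have tp : tnth [tuple p i | i < m.+2] = p by apply/funext => i; rewrite tnth_mktuple.
  rewrite /cell_tuples/= /distinct_tuples/= /vertices tp; split => //.
  exact/empty_halfballP.
move=> [t [[tinj Et] at_ ht] <-]; exists (tnth t); split => //.
exact/empty_halfballP.
Qed.

Let permute t (s : {perm 'I_m.+2}) := [tuple tnth t (s i) | i < m.+2].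

Let tnth_permute t s : tnth (permute t s) = tnth t \o s.
Proof. by apply/funext => i; rewrite tnth_mktuple. Qed.

Let vertices_permute t s : vertices (permute t s) = vertices t \o s.
Proof. by apply/funext => i; rewrite /vertices tnth_permute. Qed.

Let halfball_permute t s : affinely_independent (vertices t) ->
  halfball (tnth (permute t s)) = halfball (tnth t).
Proof.
move=> at_; have ats : affinely_independent (vertices (permute t s)).
  by rewrite vertices_permute; exact: affinely_independent_perm.
have [c r] : center (tnth t) = center (tnth (permute t s)) /\
    rad2 (tnth t) = rad2 (tnth (permute t s)).
  apply/(circumsphereP _ _ ats) => i; rewrite tnth_permute /=.
  exact: ((circumsphereP _ _ at_).2 (conj erefl erefl)).
by rewrite /halfball c r.
Qed.

Let cell_tuples_permute E t s : cell_tuples E t -> cell_tuples E (permute t s).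
Proof.
move=> [[tinj Et] at_ ht]; split.
- split => [|i]; rewrite tnth_permute; last exact: Et.
  by move=> i j /tinj /perm_inj.
- by rewrite vertices_permute; exact: affinely_independent_perm.
- by rewrite halfball_permute.
Qed.

(** The cell determines its vertices, and the vertices determine the points of E
    above them, so only the order of the points is free. *)
Lemma same_cell_tuples E t :
  (forall x y, E x -> E y -> x.1 = y.1 -> x = y) -> cell_tuples E t ->
  [set t' | cell_tuples E t' /\ hull (vertices t') = hull (vertices t)] =
  [set permute t s | s in [set: {perm 'I_m.+2}]].
Proof.
move=> simpleE Et; apply/seteqP; split => t'.
  move=> [Et' /= h]; have [[_ tE'] at_ _] := Et'; have [[_ tE] _ _] := Et.
  have [s sinj sP] := hull_vertices at_ h.
  exists (perm sinj) => //; apply: eq_from_tnth => i.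
  rewrite tnth_permute /= permE; apply: simpleE => //; exact/esym/(sP i).
move=> [s _ <-]; split; first exact: cell_tuples_permute.
by rewrite vertices_permute hull_perm.
Qed.

Lemma esum_cell_tuples E (f : set 'rV[R]_m.+1 -> R) :
  (forall x y, E x -> E y -> x.1 = y.1 -> x = y) -> (forall C, 0 <= f C)%R ->
  \esum_(t in cell_tuples E) (f (hull (vertices t)))%:E =
  ((m.+2)`!%:R)%:E * \esum_(C in hyperbolic_delaunay m.+2 E) (f C)%:E.
Proof.
move=> simpleE f0.
pose J (C : set 'rV[R]_m.+1) := [set t | cell_tuples E t /\ hull (vertices t) = C].
transitivity (\esum_(C in hyperbolic_delaunay m.+2 E) \esum_(t in J C) (f C)%:E).
  rewrite esum_esum => [|C t _ _]; last by rewrite lee_fin.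
  rewrite (@reindex_esum R _ _ (cell_tuples E) _ (fun t => (hull (vertices t), t)))//.
  split => [t Et|t t' _ _ [] //|[C t] [/= _ [Et tC]]].
  - by split => //=; rewrite hyperbolic_delaunayE; exists t.
  - by exists t => //; rewrite tC.
have inner C : hyperbolic_delaunay m.+2 E C ->
    \esum_(t in J C) (f C)%:E = \sum_(s : {perm 'I_m.+2}) (f C)%:E.
  rewrite hyperbolic_delaunayE => -[t Et <-].
  rewrite /J (same_cell_tuples simpleE Et) esum_image; last first.
    move=> s s' _ _ ss'; apply/permP => i.
    have [[tinj _] _ _] := Et; apply: tinj.
    by have := congr1 (fun u => tnth u i) ss'; rewrite !tnth_permute.
  rewrite esum_fset; [|exact: finite_finset|by move=> *; rewrite lee_fin].
  rewrite [RHS]fsbig_seq ?index_enum_uniq//; congr (\sum_(i \in _) _)%R.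
  by apply/seteqP; split => s //= _; rewrite mem_index_enum.
rewrite (eq_esum inner) esum_sum => [|C s _ _]; last by rewrite lee_fin.
by rewrite sumr_const card_Sn mule_natl.
Qed.

End cells_and_tuples.

(** * Measurability of the circumscribed half-ball *)

Section measurable_geometry.
Context {R : realType} d (T : measurableType d).

Lemma measurable_det n (F : T -> 'M[R]_n) :
  (forall i j, measurable_fun setT (fun t => F t i j)) ->
  measurable_fun setT (fun t => \det (F t)).
Proof.
move=> mF; apply: measurable_sum => s; apply: measurable_funM => //.
by apply: measurable_prod => i _; exact: mF.
Qed.

Lemma measurable_adj n (F : T -> 'M[R]_n) i j :
  (forall i j, measurable_fun setT (fun t => F t i j)) ->
  measurable_fun setT (fun t => (\adj (F t)) i j).
Proof.
move=> mF; rewrite (_ : (fun _ => _) = fun t =>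
    (-1) ^+ (j + i) * \det (row' j (col' i (F t)))); last first.
  by apply/funext => t; rewrite mxE.
apply: measurable_funM => //; apply: measurable_det => k l.
rewrite (_ : (fun _ => _) = fun t => F t (lift j k) (lift i l)) //.
by apply/funext => t; rewrite !mxE.
Qed.

(** Measurability of the coordinates, which composes better than measurability
    for the Borel sets of row vectors. *)
Definition measurable_row n (v : T -> 'rV[R]_n) : Prop :=
  forall j, measurable_fun setT (fun t => v t ord0 j).

Lemma measurable_rowB n (u v : T -> 'rV[R]_n) :
  measurable_row u -> measurable_row v -> measurable_row (fun t => u t - v t).
Proof.
move=> mu mv j; rewrite (_ : (fun _ => _) = fun t => u t ord0 j - v t ord0 j).
  by apply: measurable_funB; [exact: mu|exact: mv].
by apply/funext => t; rewrite !mxE.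
Qed.

Lemma measurable_rowZ n (a : R) (v : T -> 'rV[R]_n) :
  measurable_row v -> measurable_row (fun t => a *: v t).
Proof.
move=> mv j; rewrite (_ : (fun _ => _) = fun t => a * v t ord0 j).
  by apply: measurable_funM => //; exact: mv.
by apply/funext => t; rewrite !mxE.
Qed.

Lemma measurable_row_sum n k (v : 'I_k -> T -> 'rV[R]_n) :
  (forall i, measurable_row (v i)) -> measurable_row (fun t => \sum_i v i t).
Proof.
move=> mv j; rewrite (_ : (fun _ => _) = fun t => \sum_i v i t ord0 j).
  by apply: measurable_sum => i; exact: mv.
by apply/funext => t; rewrite summxE.
Qed.

Lemma measurable_enorm_sqr n (v : T -> 'rV[R]_n) : measurable_row v ->
  measurable_fun setT (fun t => enorm (v t) ^+ 2).
Proof.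
move=> mv; rewrite (_ : (fun _ => _) = fun t => \sum_i v t ord0 i ^+ 2).
  by apply: measurable_sum => i; apply: measurable_funX; exact: mv.
by apply/funext => t; rewrite enorm_sqr.
Qed.

Lemma measurable_sqrtr (f : T -> R) : measurable_fun setT f ->
  measurable_fun setT (fun t => Num.sqrt (f t)).
Proof.
move=> mf; apply: (measurableT_comp _ mf).
exact: (continuous_measurable_fun (@sqrt_continuous R)).
Qed.

Lemma measurable_enorm n (v : T -> 'rV[R]_n) : measurable_row v ->
  measurable_fun setT (fun t => enorm (v t)).
Proof.
move=> mv; rewrite (_ : (fun _ => _) = fun t => Num.sqrt (enorm (v t) ^+ 2)).
  by apply: measurable_sqrtr; exact: measurable_enorm_sqr.
by apply/funext => t; rewrite sqrtr_sqr ger0_norm// enorm_ge0.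
Qed.

Lemma measurable_lt_fun (f g : T -> R) : measurable_fun setT f -> measurable_fun setT g ->
  measurable [set t | f t < g t].
Proof.
move=> mf mg; rewrite (_ : [set t | _] = setT `&` (g \- f) @^-1` `]0, +oo[).
  by apply: (measurable_funB mg mf).
by rewrite setTI; apply/seteqP; split => t /=; rewrite in_itv/= andbT subr_gt0.
Qed.

Variables (m : nat) (p : T -> 'I_m.+2 -> 'rV[R]_m.+1 * R).
Hypothesis mp1 : forall i, measurable_row (fun t => (p t i).1).
Hypothesis mp2 : forall i, measurable_fun setT (fun t => (p t i).2).

Let measurable_edges i j :
  measurable_fun setT (fun t => edges (fun i => (p t i).1) i j).
Proof.
rewrite (_ : (fun _ => _) = fun t => ((p t (lift ord0 i)).1 - (p t ord0).1) ord0 j).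
  by apply: measurable_rowB; exact: mp1.
by apply/funext => t; rewrite !mxE.
Qed.

Lemma measurable_affinely_independent :
  measurable [set t | affinely_independent (fun i => (p t i).1)].
Proof.
rewrite (_ : [set t | _] = ~` [set t | \det (edges (fun i => (p t i).1)) = cst 0 t]).
  apply: measurableC; apply: measurable_eq_fun => //.
  by apply: measurable_det => i j; exact: measurable_edges.
apply/seteqP; split => t /=.
  by move/affinely_independent_det/eqP.
by move=> h; apply/affinely_independent_det/eqP.
Qed.

Lemma measurable_center : measurable_row (fun t => center (p t)).
Proof.
move=> j.
rewrite (_ : (fun _ => _) = fun t => (p t ord0).1 ord0 j +
  (\det (edges (fun i => (p t i).1)))^-1 * \sum_k
     (\adj (edges (fun i => (p t i).1))) j k * sphere_rhs (p t) k ord0).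
  apply: measurable_funD; first exact: mp1.
  apply: measurable_funM.
    apply: (measurableT_comp measurable_invr).
    by apply: measurable_det => *; exact: measurable_edges.
  apply: measurable_sum => k; apply: measurable_funM.
    by apply: measurable_adj => *; exact: measurable_edges.
  rewrite (_ : (fun _ => _) = fun t => (enorm ((p t (lift ord0 k)).1 - (p t ord0).1) ^+ 2 +
           (p t (lift ord0 k)).2 ^+ 2 - (p t ord0).2 ^+ 2) / 2).
    apply: measurable_funM => //; apply: measurable_funB.
      apply: measurable_funD; last by apply: measurable_funX; exact: mp2.
      by apply: measurable_enorm_sqr; apply: measurable_rowB; exact: mp1.
    by apply: measurable_funX; exact: mp2.
  by apply/funext => t; rewrite mxE.
by apply/funext => t; rewrite !mxE.
Qed.

Lemma measurable_rad2 : measurable_fun setT (fun t => rad2 (p t)).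
Proof.
apply: measurable_funD; last by apply: measurable_funX; exact: mp2.
apply: measurable_enorm_sqr; apply: measurable_rowB; first exact: mp1.
exact: measurable_center.
Qed.

End measurable_geometry.

(** * Half-balls as countable unions of rational half-balls *)

Section rational_approximation.
Context {R : realType}.

Lemma norm_rV_le n (v : 'rV[R]_n) (r : R) : 0 <= r ->
  (forall i, `|v ord0 i| <= r) -> `|v| <= r.
Proof.
move=> r0 vr; rewrite /Num.norm/= mx_normrE; apply/bigmax_leP; split => //.
by move=> [i j] _ /=; rewrite (ord1 i); exact: vr.
Qed.

Lemma enorm_le_coord n (v : 'rV[R]_n) (r : R) : 0 <= r ->
  (forall i, `|v ord0 i| <= r) -> enorm v <= n%:R * r.
Proof.
move=> r0 vr; apply: le_trans (enorm_le_norm v) _.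
by rewrite ler_wpM2l//; exact: norm_rV_le.
Qed.

Definition rational_vector {n} (q : 'rV[rat]_n) : 'rV[R]_n := map_mx (@ratr R) q.

Lemma dense_rational_vector n (v : 'rV[R]_n) (e : R) : 0 < e ->
  exists q, enorm (v - rational_vector q) < e.
Proof.
move=> e0; have a0 : 0 < e / n.+1%:R by rewrite divr_gt0.
have /choice[q qP] : forall i, exists q : rat, `|v ord0 i - ratr q| < e / n.+1%:R.
  move=> i; have /(@rat_in_itvoo R)[q] : v ord0 i - e / n.+1%:R < v ord0 i + e / n.+1%:R. by move: a0; set b := _ / _ => a0; lra.
  rewrite in_itv/=; set b := _ / _ => /andP[h1 h2]; exists q; rewrite ltr_norml; lra.
exists (\row_i q i).
apply: (@le_lt_trans _ _ (n%:R * (e / n.+1%:R))).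
  apply: enorm_le_coord => [|i]; first exact: ltW.
  by rewrite !mxE ltW.
by rewrite mulrCA gtr_pMr// ltr_pdivrMr// mul1r ltr_nat.
Qed.

(** The triangle inequality of R^(n+1) for the points (u, y) and (v, 0). *)
Lemma ler_sqrt_enormD n (u v : 'rV[R]_n) (y : R) :
  Num.sqrt (enorm (u + v) ^+ 2 + y ^+ 2) <= Num.sqrt (enorm u ^+ 2 + y ^+ 2) + enorm v.
Proof.
pose pt (w : 'rV[R]_n) (s : R) : 'rV[R]_(n + 1) := row_mx w s%:M.
have ptE w s : enorm (pt w s) = Num.sqrt (enorm w ^+ 2 + s ^+ 2).
  rewrite {1}/enorm big_split_ord/= big_ord1 enorm_sqr /pt row_mxEr mxE eqxx mulr1n.
  by congr (Num.sqrt (_ + _)); apply: eq_bigr => i _; rewrite row_mxEl.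
have -> : enorm v = enorm (pt v 0).
  by rewrite ptE expr0n addr0 sqrtr_sqr ger0_norm// enorm_ge0.
rewrite -!ptE (_ : pt (u + v) y = pt u y + pt v 0); first exact: ler_enormD.
by rewrite /pt add_row_mx raddf0 addr0.
Qed.

End rational_approximation.

Section swept_halfball.
Context {R : realType} {m : nat}.
Local Notation X := ('rV[R]_m.+1 * R)%type.

Definition rational_halfball (j : nat) : set X :=
  if @choice.unpickle ('rV[rat]_m.+1 * rat)%type j is Some (q, s) then
    [set z | enorm (z.1 - rational_vector q) ^+ 2 + z.2 ^+ 2 < ratr s ^+ 2]
  else set0.

Definition includes_rational_halfball (j : nat) : set (m.+2.-tuple X) :=
  if @choice.unpickle ('rV[rat]_m.+1 * rat)%type j is Some (q, s) then
    [set t | (0 < s)%R /\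
             enorm (center (tnth t) - rational_vector q) + ratr s < Num.sqrt (rad2 (tnth t))]
  else set0.

(** A point in the half-ball lies in a rational half-ball contained in it, and the
    inclusion of the rational half-ball is the triangle inequality for the two
    centres and radii, a measurable condition on the tuple. *)
Lemma halfball_swept (t : m.+2.-tuple X) :
  halfball (tnth t) = swept rational_halfball includes_rational_halfball t.
Proof.
apply/seteqP; split => z.
  set c := center (tnth t); set r := Num.sqrt (rad2 (tnth t)) => hz.
  pose a := Num.sqrt (enorm (z.1 - c) ^+ 2 + z.2 ^+ 2).
  have ar : a < r by rewrite ltr_sqrt//; apply: le_lt_trans hz; rewrite addr_ge0 ?sqr_ge0.
  (* With the rational centre within e of the centre, every radius strictly between
     a + e and r - e works; there is room since r - a = 3 e. *)
  have e0 : 0 < (r - a) / 3 by rewrite divr_gt0// subr_gt0.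
  have [q qc] := dense_rational_vector c e0.
  set e := _ / 3 in e0 qc.
  have [s] : exists s, ratr s \in `]a + e, r - e[.
    by apply: rat_in_itvoo; rewrite /e; lra.
  rewrite in_itv/= => /andP[s1 s2].
  have a0 : 0 <= a by exact: sqrtr_ge0.
  have s0 : 0 < (ratr s : R) by lra.
  exists (choice.pickle (q, s)).
    rewrite /includes_rational_halfball/= choice.pickleK; split.
      by rewrite -(ltr0q R).
    by rewrite -/c -/r; lra.
  rewrite /rational_halfball choice.pickleK/=.
  have := ler_sqrt_enormD (z.1 - c) (c - rational_vector q) z.2.
  rewrite addrA subrK -/a => h.
  rewrite -[ltLHS]sqr_sqrtr ?addr_ge0 ?sqr_ge0//.
  by rewrite ltr_pXn2r// ?nnegrE ?sqrtr_ge0 ?(ltW s0)//; lra.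
move=> [j]; rewrite /includes_rational_halfball /rational_halfball/=.
case: (choice.unpickle j) => [[q s]|] //= [s0 h] hz.
rewrite /halfball/=; set c := center _ in h *.
have s0' : 0 < (ratr s : R) by rewrite ltr0q.
have := ler_sqrt_enormD (z.1 - rational_vector q) (rational_vector q - c) z.2.
rewrite addrA subrK (enormB (rational_vector q) c) => h'.
have : Num.sqrt (enorm (z.1 - rational_vector q) ^+ 2 + z.2 ^+ 2) < ratr s.
  by rewrite -[ltRHS]gtr0_norm// -sqrtr_sqr ltr_sqrt// exprn_gt0.
move=> h''.
have rr : 0 <= rad2 (tnth t) by rewrite addr_ge0 ?sqr_ge0.
rewrite -[ltLHS]sqr_sqrtr ?addr_ge0 ?sqr_ge0// -[ltRHS]sqr_sqrtr//.
by rewrite ltr_pXn2r// ?nnegrE ?sqrtr_ge0//; lra.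
Qed.

Lemma measurable_row_tnth_vertex (i : 'I_m.+2) :
  measurable_row (fun t : tuple_space X m.+2 => (tnth t i).1).
Proof.
move=> j; apply: (measurableT_comp (measurable_coord j)).
exact: (measurableT_comp measurable_fst (measurable_tnth _)).
Qed.

Lemma measurable_tnth_height (i : 'I_m.+2) :
  measurable_fun setT (fun t : tuple_space X m.+2 => (tnth t i).2).
Proof. exact: (measurableT_comp measurable_snd (measurable_tnth _)). Qed.

Lemma measurable_tuple_center :
  measurable_row (fun t : tuple_space X m.+2 => center (tnth t)).
Proof.
apply: (@measurable_center _ _ _ _ (fun t : tuple_space X m.+2 => tnth t)).
  exact: measurable_row_tnth_vertex.
exact: measurable_tnth_height.
Qed.

Lemma measurable_tuple_rad2 :
  measurable_fun setT (fun t : tuple_space X m.+2 => rad2 (tnth t)).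
Proof.
apply: (@measurable_rad2 _ _ _ _ (fun t : tuple_space X m.+2 => tnth t)).
  exact: measurable_row_tnth_vertex.
exact: measurable_tnth_height.
Qed.

Lemma measurable_row_cst d (T : measurableType d) n (v : 'rV[R]_n) :
  measurable_row (fun _ : T => v).
Proof. by move=> j; exact: measurable_cst. Qed.

Lemma measurable_rational_halfball j : measurable (rational_halfball j).
Proof.
rewrite /rational_halfball; case: (choice.unpickle j) => [[q s]|] //.
apply: measurable_lt_fun => //; apply: measurable_funD.
  apply: measurable_enorm_sqr; apply: measurable_rowB; last exact: measurable_row_cst.
  by move=> k; exact: (measurableT_comp (measurable_coord k) measurable_fst).
by apply: measurable_funX; exact: measurable_snd.
Qed.

Lemma measurable_includes_rational_halfball j :
  measurable (includes_rational_halfball j : set (tuple_space X m.+2)).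
Proof.
rewrite /includes_rational_halfball; case: (choice.unpickle j) => [[q s]|] //.
case: (ltP 0 s) => s0; last first.
  rewrite (_ : [set t | _] = set0)//; apply/seteqP; split => // t /= [] //.
rewrite (_ : [set t | _] = [set t : tuple_space X m.+2 |
    enorm (center (tnth t) - rational_vector q) + ratr s < Num.sqrt (rad2 (tnth t))]).
  apply: measurable_lt_fun; last by apply: measurable_sqrtr; exact: measurable_tuple_rad2.
  apply: measurable_funD => //; apply: measurable_enorm; apply: measurable_rowB.
    exact: measurable_tuple_center.
  exact: measurable_row_cst.
by apply/seteqP; split => t /=; [case|split].
Qed.

Lemma bounded_cylinder (B : set X) (v : 'rV[R]_m.+1) (r : R) :
  (forall z, B z -> enorm (z.1 - v) < r) -> exists k, B `<=` cylinder m k.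
Proof.
move=> h; exists (Num.bound (r + enorm v)) => z Bz; split => //=.
rewrite mx_norm_ball /ball_/= sub0r normrN.
apply: le_lt_trans (le_norm_enorm _) _.
have := ler_enorm_dist v z.1 0; rewrite !subr0 => hz.
have zr := h _ Bz.
have : r + enorm v < (Num.bound (r + enorm v))%:R.
  apply: archi_boundP; have := enorm_ge0 v; have := enorm_ge0 (z.1 - v); lra.
have : (Num.bound (r + enorm v))%:R < (Num.bound (r + enorm v)).+1%:R :> R by rewrite ltr_nat.
lra.
Qed.

Lemma halfball_cylinder (p : 'I_m.+2 -> X) : exists k, halfball p `<=` cylinder m k.
Proof.
apply: (@bounded_cylinder _ (center p) (rad2 p + 1)) => z; rewrite /halfball/= => hz.
have z2 := sqr_ge0 z.2.
have : enorm (z.1 - center p) ^+ 2 < rad2 p by lra.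
have := enorm_ge0 (z.1 - center p); nra.
Qed.

Lemma rational_halfball_cylinder j : exists k, rational_halfball j `<=` cylinder m k.
Proof.
rewrite /rational_halfball; case: (choice.unpickle j) => [[q s]|]; last by exists 0%N.
apply: (@bounded_cylinder _ (rational_vector q) (ratr s ^+ 2 + 1)) => z /= hz.
have z2 := sqr_ge0 z.2.
have : enorm (z.1 - rational_vector q) ^+ 2 < ratr s ^+ 2 by lra.
have := enorm_ge0 (z.1 - rational_vector q); nra.
Qed.

End swept_halfball.

(** * Convex hulls as points of the space of compact convex sets *)

Lemma continuous_sum {R : realType} (T : topologicalType) (V : normedModType R)
    (I : Type) (r : seq I) (f : I -> T -> V) :
  (forall i, continuous (f i)) -> continuous (fun a => \sum_(i <- r) f i a).
Proof.
move=> cf a; elim: r => [|i r ih].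
  rewrite (_ : (fun _ => _) = cst 0); first exact: cst_continuous.
  by apply/funext => b; rewrite big_nil.
rewrite (_ : (fun _ => _) = (fun b => f i b + \sum_(j <- r) f j b)).
  by apply: cvgD; [exact: cf|exact: ih].
by apply/funext => b; rewrite big_cons.
Qed.

Section hull_compact_convex.
Context {R : realType} {n k : nat}.
Implicit Types x y : 'I_k.+1 -> 'rV[R]_n.

Lemma hull_convex x : @convex_set R 'rV[R]_n (hull x).
Proof.
move=> u v l; rewrite !inE => -[a [a0 a1 ->]] [b [b0 b1 ->]].
exists (fun i => l%:num * a i + (1 - l%:num) * b i); split.
- move=> i; rewrite addr_ge0// mulr_ge0//; by rewrite subr_ge0.
- by rewrite big_split/= -!mulr_sumr a1 b1 !mulr1 addrC subrK.
- rewrite /conv/= !scaler_sumr -big_split/=; apply: eq_bigr => i _.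
  by rewrite !scalerA -scalerDl.
Qed.

Definition simplex : set 'rV[R]_k.+1 :=
  [set a | (forall i, 0 <= a ord0 i) /\ \sum_i a ord0 i = 1].

Lemma simplex_compact : compact simplex.
Proof.
have cc i : continuous (fun a : 'rV[R]_k.+1 => a ord0 i).
  by move=> a; exact: coord_continuous.
apply: bounded_closed_compact.
  exists 1; split => // r r1 a [a0 a1]; apply: le_trans (ltW r1).
  apply: norm_rV_le => // i; rewrite ger0_norm// -a1 (bigD1 i)//= lerDl.
  by apply: sumr_ge0 => j _.
rewrite (_ : simplex = (\bigcap_(i in [set: 'I_k.+1]) ((fun a : 'rV[R]_k.+1 => a ord0 i) @^-1` [set y | 0 <= y])) `&`
   (fun a : 'rV[R]_k.+1 => \sum_i a ord0 i) @^-1` [set 1]).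
  apply: closedI.
    apply: closed_bigI => i _; apply: closed_comp => [a _|]; first exact: cc.
    exact: closed_ge.
  apply: closed_comp => [a _|]; last exact: closed_eq.
  by apply: continuous_sum => i; exact: cc.
apply/seteqP; split => a /= [a0 a1]; split => // i; last exact: (a0 i I).
by move=> _; exact: a0.
Qed.

Lemma hull_simplex x : hull x = (fun a : 'rV[R]_k.+1 => \sum_i a ord0 i *: x i) @` simplex.
Proof.
apply/seteqP; split => v.
  move=> [a [a0 a1 ->]]; exists (\row_i a i); last by apply: eq_bigr => i _; rewrite mxE.
  by split => [i|]; [rewrite mxE|under eq_bigr do rewrite mxE].
by move=> [a [a0 a1] <-]; exists (a ord0).
Qed.

Lemma hull_compact x : compact (hull x).
Proof.
rewrite hull_simplex; apply: continuous_compact; last exact: simplex_compact.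
apply: continuous_subspaceT; apply: continuous_sum => i a.
apply: (@cvgZr_tmp R _ _ (nbhs a) _ (fun b : 'rV[R]_k.+1 => b ord0 i)).
exact: coord_continuous.
Qed.

Lemma hull_vertex x i : hull x (x i).
Proof.
exists (fun j => (j == i)%:R); split.
- by move=> j; exact: ler0n.
- by rewrite (bigD1 i)//= eqxx big1 ?addr0// => j /negPf ->.
- rewrite (bigD1 i)//= eqxx scale1r big1 ?addr0// => j /negPf ->.
  by rewrite scale0r.
Qed.

Definition simplex_hull x : compact_convex R n :=
  CompactConvex (ex_intro _ _ (hull_vertex x ord0)) (@hull_compact x) (@hull_convex x).

Lemma enorm_sum (I : Type) (r : seq I) (v : I -> 'rV[R]_n) :
  enorm (\sum_(i <- r) v i) <= \sum_(i <- r) enorm (v i).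
Proof.
elim: r => [|i r ih]; first by rewrite !big_nil enorm0.
by rewrite !big_cons; apply: le_trans (ler_enormD _ _) _; rewrite lerD2l.
Qed.

Lemma enormZ (a : R) (v : 'rV[R]_n) : enorm (a *: v) = `|a| * enorm v.
Proof.
apply/eqP; rewrite -(@eqrXn2 _ 2) ?mulr_ge0 ?enorm_ge0//.
rewrite exprMn real_normK ?num_real// !enorm_sqr mulr_sumr; apply/eqP.
by apply: eq_bigr => i _; rewrite mxE exprMn.
Qed.

Let hull_fattening x y (r : R) : (forall i, enorm (x i - y i) <= r) ->
  hull x `<=` fattening r (hull y).
Proof.
move=> xy v [a [a0 a1 ->]]; exists (\sum_i a i *: y i); first by exists a.
rewrite -sumrB; apply: le_trans (enorm_sum _ _) _.
rewrite -[leRHS]mul1r -a1 mulr_suml; apply: ler_sum => i _.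
by rewrite -scalerBr enormZ ger0_norm// ler_wpM2l.
Qed.

(** The hull is 1-Lipschitz in its vertices: the same convex combination of the other
    vertices is within r. *)
Lemma hausdorff_hull_le x y (r : R) : (forall i, enorm (x i - y i) <= r) ->
  hausdorff_dist (hull x) (hull y) <= r.
Proof.
move=> xy; apply: ge_inf; first by exists 0 => s [].
split; [exact: le_trans (enorm_ge0 _) (xy ord0)|exact: hull_fattening|].
by apply: hull_fattening => i; rewrite enormB.
Qed.

Let ratM (q : 'M[rat]_(k.+1, n)) i : 'rV[R]_n := rational_vector (row i q).

Let box (t : 'M[rat]_(k.+1, n) * nat) : set ('I_k.+1 -> 'rV[R]_n) :=
  [set x | forall i, enorm (x i - ratM t.1 i) < t.2.+1%:R^-1].

Let box_dense x (e : R) : 0 < e -> exists t, box t x /\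
  forall y, box t y -> forall i, enorm (x i - y i) < e.
Proof.
move=> e0.
have [j je] : exists j : nat, j.+1%:R^-1 < e / 2.
  have h : 0 < e / 2 by rewrite divr_gt0.
  by have [j _ /(_ j)/= jh] := near_infty_natSinv_lt (PosNum h); exists j; exact: jh.
have j0 : 0 < j.+1%:R^-1 :> R by rewrite invr_gt0.
have /choice[q qP] : forall i, exists q, enorm (x i - rational_vector q) < j.+1%:R^-1.
  by move=> i; exact: dense_rational_vector.
have qE i : ratM (\matrix_(i, l) q i ord0 l) i = rational_vector (q i).
  by apply/rowP => l; rewrite !mxE.
exists (\matrix_(i, l) q i ord0 l, j); split => [i|y yb i]; first by rewrite qE.
have := yb i; rewrite /= qE => yq.
have := ler_enorm_dist (rational_vector (q i)) (x i) (y i).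
rewrite (enormB (rational_vector (q i)) (y i)) => h.
have := qP i; move: je yq h => /=; set b := _^-1; lra.
Qed.

(** An open set of shapes pulls back to an open condition on the vertices, hence to
    a countable union of rational boxes of vertices. *)
Lemma measurable_simplex_hull d (T : measurableType d) (x : T -> 'I_k.+1 -> 'rV[R]_n) :
  (forall i, measurable_row (fun t => x t i)) ->
  measurable_fun setT (fun t => simplex_hull (x t)).
Proof.
move=> mx; apply: (@measurability _ _ _ _ _ _ (@open (compact_convex R n))) => //.
move=> _ [U oU <-]; rewrite setTI.
rewrite (_ : _ @^-1` U = \bigcup_(b in [set b | forall y, box b y -> U (simplex_hull y)])
    [set t | box b (x t)]).
  rewrite bigcup_mkcond; apply: countable_bigcupT_measurable; first exact: countableP.
  move=> b; case: ifP => // _.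
  rewrite (_ : [set t | _] = \bigcap_(i in [set: 'I_k.+1])
      [set t | enorm (x t i - ratM b.1 i) < b.2.+1%:R^-1]).
    apply: fin_bigcap_measurable => [|i _]; first exact: finite_finset.
    apply: measurable_lt_fun => //; apply: measurable_enorm.
    by apply: measurable_rowB => //; exact: measurable_row_cst.
  by apply/seteqP; split => t /= h i; [move=> _|]; exact: h.
apply/seteqP; split => t /=; last by move=> [b /= hb]; exact: hb.
move=> Ux; have /nbhs_ballP[e /= e0 eU] : nbhs (simplex_hull (x t)) U.
  exact: open_nbhs_nbhs.
have e20 : 0 < e / 2 by rewrite divr_gt0.
have [b [bx bxy]] := box_dense (x t) e20.
exists b => //= y yb; apply: eU; rewrite /ball/=.
apply: (@le_lt_trans _ _ (e / 2)); last by lra.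
by apply: hausdorff_hull_le => i; exact/ltW/bxy.
Qed.

End hull_compact_convex.

(** * The mean number of cells through the Mecke formula *)

Section cell_tuples_at_origin.
Context {R : realType} {m : nat}.
Local Notation X := ('rV[R]_m.+1 * R)%type.
Local Notation tuples := (tuple_space X m.+2).
Local Notation shapes := (compact_convex R m.+1).

Definition vertex_mean (t : tuples) : 'rV[R]_m.+1 :=
  m.+2%:R^-1 *: \sum_i vertices t i.

Definition centred_simplex (t : tuples) : shapes :=
  simplex_hull (fun i => vertices t i - vertex_mean t).

Definition unit_window : set 'rV[R]_m.+1 := ball 0 1.

Definition cells_at (A : set shapes) : set tuples :=
  [set t | [/\ affinely_independent (vertices t), unit_window (vertex_mean t) &
               A (centred_simplex t)]].

Lemma measurable_row_vertex_mean : measurable_row vertex_mean.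
Proof.
apply: measurable_rowZ; apply: measurable_row_sum => i.
exact: measurable_row_tnth_vertex.
Qed.

Lemma measurable_centred_simplex : measurable_fun setT centred_simplex.
Proof.
apply: measurable_simplex_hull => i.
apply: measurable_rowB; last exact: measurable_row_vertex_mean.
exact: measurable_row_tnth_vertex.
Qed.

Lemma unit_windowP (v : 'rV[R]_m.+1) : unit_window v <-> forall i, `|v ord0 i| < 1.
Proof.
rewrite /unit_window; split => [[_ h] i|h].
  by have := h ord0 i; rewrite /ball/= mxE sub0r normrN.
split => // i j; rewrite (ord1 i) /ball/= mxE sub0r normrN; exact: h.
Qed.

Lemma measurable_cells_at A : measurable A -> measurable (cells_at A).
Proof.
move=> mA.
have m1 : measurable [set t : tuples | affinely_independent (vertices t)].
  apply: (@measurable_affinely_independent R _ _ _ (fun t : tuples => tnth t)).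
  exact: measurable_row_tnth_vertex.
have m2 : measurable (\bigcap_(i in [set: 'I_m.+1]) [set t : tuples | `|vertex_mean t ord0 i| < 1]).
  apply: fin_bigcap_measurable => [|i _]; first exact: finite_finset.
  apply: measurable_lt_fun => //; apply: measurableT_comp => //.
  exact: measurable_row_vertex_mean.
have m3 : measurable (centred_simplex @^-1` A).
  by rewrite -[X in measurable X]setTI; exact: measurable_centred_simplex.
rewrite (_ : cells_at A = [set t : tuples | affinely_independent (vertices t)] `&`
  (\bigcap_(i in [set: 'I_m.+1]) [set t : tuples | `|vertex_mean t ord0 i| < 1]) `&`
  centred_simplex @^-1` A).
  by apply: measurableI => //; exact: measurableI.
apply/seteqP; split => t /=.
  by move=> [h1 /unit_windowP h2 h3]; split => //; split => // i _; exact: h2.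
by move=> [[h1 h2] h3]; split => //; apply/unit_windowP => i; exact: (h2 i I).
Qed.

Definition scale_tuple (l : R) (t : tuples) : tuples :=
  [tuple scale_height l (tnth t i) | i < m.+2].

Lemma measurable_scale_tuple l : measurable_fun setT (scale_tuple l).
Proof.
apply/measurable_fun_tnthP => i.
rewrite (_ : _ \o _ = fun t : tuples => scale_height l (tnth t i)).
  exact: (measurableT_comp (measurable_scale_height l) (measurable_tnth _)).
by apply/funext => t /=; rewrite tnth_mktuple.
Qed.

Lemma vertices_scale_tuple l t : vertices (scale_tuple l t) = vertices t.
Proof. by apply/funext => i; rewrite /vertices tnth_mktuple. Qed.

Lemma scale_tuple_cells_at l A : scale_tuple l @^-1` cells_at A = cells_at A.
Proof.
by apply/seteqP; split => t; rewrite /cells_at /= /centred_simplex /vertex_mean !vertices_scale_tuple.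
Qed.

(** The intensity measure of the half-ball; [void_mass_lty] and the sections of a
    measurable set make it a finite measurable function of the tuple. *)
Definition void_mass (l : R) (t : tuples) : \bar R :=
  scaled_volume m l (halfball (tnth t)).

Lemma measurable_void_mass l : measurable_fun setT (void_mass l).
Proof.
pose S : set (tuples * X) := [set p | enorm ((scale_height l p.2).1 - center (tnth p.1)) ^+ 2 +
  (scale_height l p.2).2 ^+ 2 < rad2 (tnth p.1)].
have mS : measurable S.
  apply: measurable_lt_fun; last exact: (measurableT_comp measurable_tuple_rad2 measurable_fst).
  have ms : measurable_fun setT (fun p : tuples * X => scale_height l p.2).
    exact: (measurableT_comp (measurable_scale_height l) measurable_snd).
  apply: measurable_funD.
    apply: measurable_enorm_sqr; apply: measurable_rowB => j.
      apply: (measurableT_comp (measurable_coord j)).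
      exact: (measurableT_comp measurable_fst ms).
    exact: (measurableT_comp (measurable_tuple_center j) measurable_fst).
  by apply: measurable_funX; exact: (measurableT_comp measurable_snd ms).
rewrite (_ : void_mass l = marked_volume m \o xsection S).
  exact: (measurable_fun_xsection (marked_volume m) mS).
apply/funext => t; rewrite /void_mass /scaled_volume /pushforward /=; congr (marked_volume m _).
by apply/seteqP; split => z; rewrite /xsection /S /= inE.
Qed.

Lemma measurable_halfball (t : tuples) : measurable (halfball (tnth t)).
Proof.
rewrite halfball_swept; apply: bigcup_measurable => j _.
exact: measurable_rational_halfball.
Qed.

Lemma void_mass_lty l t : (void_mass l t < +oo)%E.
Proof.
have [k hk] := halfball_cylinder (tnth t).
apply: le_lt_trans (scaled_volume_cylinder m k l).
apply: (le_measure (scaled_volume m l)); rewrite ?inE //.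
  exact: measurable_halfball.
exact: measurable_cylinder.
Qed.

Variable M : {measure set tuples -> \bar R}.
Hypothesis M_rectangle : forall B : 'I_m.+2 -> set X, (forall i, measurable (B i)) ->
  M (rectangle B) = (\prod_(i < m.+2) marked_volume m (B i))%E.

Local Open Scope ereal_scope.

(** All scales l are integrated over the same tuples, at scale 1; the scaling of the
    heights is inside the integrand. *)
Definition cell_mass (l : R) (A : set shapes) : \bar R :=
  \int[M]_(t in cells_at A) (expR (- fine (void_mass l (scale_tuple l t))))%:E.

Section typical_cell_count.
Variables (l : R) (dO : measure_display) (Om : measurableType dO).
Variable P : probability Om R.
Variable eta : Om -> set X.

(** Pathwise identity: cells in the window with shape in A, each counted once,
    against ordered tuples with an empty half-ball. *)
Lemma tuple_count_cells_at (A : set shapes) (E : set X) :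
  (forall x y, E x -> E y -> x.1 = y.1 -> x = y) ->
  \esum_(C in hyperbolic_delaunay m.+2 E)
    (\1_unit_window (barycentre m.+2 C) *
     \1_[set cc_set K | K in A] (recentred m.+2 C))%R%:E =
  ((m.+2)`!%:R^-1)%:E * tuple_count E (cells_at A `&`
     [set t | E `&` swept rational_halfball includes_rational_halfball t = set0]) :> \bar R.
Proof.
move=> simpleE.
pose f C : R := (\1_unit_window (barycentre m.+2 C) *
     \1_[set cc_set K | K in A] (recentred m.+2 C))%R.
have f0 C : (0 <= f C)%R by rewrite mulr_ge0.
have fact_ne0 : ((m.+2)`!%:R : R) != 0%R by rewrite pnatr_eq0 -lt0n fact_gt0.
transitivity (((m.+2)`!%:R^-1)%:E *
    (((m.+2)`!%:R)%:E * \esum_(C in hyperbolic_delaunay m.+2 E) (f C)%:E)).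
  by rewrite muleA -EFinM mulVf// mul1e.
congr (_ * _); rewrite -esum_cell_tuples// /tuple_count.
rewrite (_ : cell_tuples E = @distinct_tuples _ m.+2 E `&`
   [set t | affinely_independent (vertices t) /\ E `&` halfball (tnth t) = set0]); last first.
  by apply/seteqP; split => t [] // h1 [h2 h3].
rewrite esum_mkcondr; apply: eq_esum => t _.
case: ifPn => [/set_mem [at_ Et]|nt]; last first.
  rewrite indicE memNset// => -[[at_ _ _] Et]; move/negP: nt; apply; apply/mem_set.
  by split => //; rewrite halfball_swept.
have bE : barycentre m.+2 (hull (vertices t)) = vertex_mean t by exact: barycentre_hull.
have rE : recentred m.+2 (hull (vertices t)) = cc_set (centred_simplex t).
  rewrite /recentred bE /=; apply/seteqP; split => v.
    move=> [_ [a [a0 a1 ->]] <-]; exists a; split => //.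
    under [RHS]eq_bigr => i _ do rewrite scalerBr.
    by rewrite sumrB -scaler_suml a1 scale1r.
  move=> [a [a0 a1 ->]]; exists (\sum_i a i *: vertices t i)%R; first by exists a.
  under [RHS]eq_bigr => i _ do rewrite scalerBr.
  by rewrite sumrB -scaler_suml a1 scale1r.
have AE : (recentred m.+2 (hull (vertices t)) \in [set cc_set K | K in A]) =
    (centred_simplex t \in A).
  rewrite rE; apply/idP/idP => /set_mem h; apply/mem_set; last by exists (centred_simplex t).
  by have [K AK /compact_convex_eq <-] := h.
rewrite /f !indicE AE bE; congr EFin.
rewrite -natrM mulnb; congr (_%:R); congr nat_of_bool.
apply/andP/idP => [[/set_mem h1 /set_mem h2]|/set_mem [[_ h1 h2] _]]; last by split; apply/mem_set.
by apply/mem_set; split => //=; rewrite -halfball_swept.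
Qed.

Hypothesis heta : lf_poisson P (scaled_volume m l) (cylinder m) eta.

Lemma mean_tuple_count_cells_at (A : set shapes) : measurable A ->
  let c w := tuple_count (eta w) (cells_at A `&`
     [set t | eta w `&` swept rational_halfball includes_rational_halfball t = set0]) in
  measurable_fun setT c /\ \int[P]_w c w = cell_mass l A.
Proof.
move=> mA c.
have [Ml MlE Ml_integral] : exists2 Ml : {measure set tuples -> \bar R},
    (forall B : 'I_m.+2 -> set X, (forall i, measurable (B i)) ->
      Ml (rectangle B) = \prod_(i < m.+2) scaled_volume m l (B i)) &
    forall (D : set tuples) (f : tuples -> \bar R), measurable D ->
      measurable_fun setT f -> (forall t, 0 <= f t) ->
      \int[Ml]_(t in D) f t = \int[M]_(t in scale_tuple l @^-1` D) f (scale_tuple l t).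
  exists (pushforward M (scale_tuple l)) => [B mB|D f mD mf f0].
    have eB : scale_tuple l @^-1` rectangle B = rectangle (fun i => scale_height l @^-1` B i).
      apply/seteqP; split => t /= h i; have := h i; by rewrite tnth_mktuple.
    transitivity (M (rectangle (fun i => scale_height l @^-1` B i))).
      exact: (congr1 M eB).
    rewrite M_rectangle// => i; rewrite -[_ @^-1` _]setTI.
    exact: (measurable_scale_height l measurableT (mB i)).
  apply: ge0_integral_pushforward => //; last exact: measurable_funTS.
  exact: measurable_scale_tuple.
have mE : measurable_fun setT (fun t : tuples => (expR (- fine (void_mass l t)))%:E : \bar R).
  apply/measurable_EFinP; apply: measurableT_comp => //; apply: measurableT_comp => //.
  by apply: measurableT_comp => //; exact: measurable_void_mass.
have [] := @mecke_moving_void _ _ _ _ _ _ _ _ _ heta _ _ MlE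
  _ (@measurable_halfspace_enum R m) (@halfspace_enum_separates R m)
  rational_halfball includes_rational_halfball (cells_at A).
- exact: measurable_rational_halfball.
- exact: rational_halfball_cylinder.
- exact: measurable_includes_rational_halfball.
- exact: measurable_cells_at.
- move=> t [at_ _ _] i j tij; apply: (affinely_independent_inj at_).
  by rewrite /vertices tij.
- by move=> t _; rewrite -halfball_swept; exact: void_mass_lty.
- by move=> t i [at_ _ _]; rewrite -halfball_swept; exact: halfball_boundary.
- rewrite (_ : (fun _ => _) = (fun t : tuples => (\1_(cells_at A) t)%:E * (expR (- fine (void_mass l t)))%:E)).
    apply: emeasurable_funM => //; apply/measurable_EFinP.
    by apply: measurable_indic; exact: measurable_cells_at.
  by apply/funext => t; rewrite -EFinM /void_mass halfball_swept.
move=> mc ic; split; first exact: mc.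
apply: (etrans ic).
transitivity (\int[Ml]_(t in cells_at A) (expR (- fine (void_mass l t)))%:E).
  by apply: eq_integral => t _; rewrite /void_mass halfball_swept.
rewrite (Ml_integral _ _ (measurable_cells_at mA) mE); last first.
  by move=> t; rewrite lee_fin expR_ge0.
exact: (congr1 (fun D => \int[M]_(t in D) (expR (- fine (void_mass l (scale_tuple l t))))%:E)
  (scale_tuple_cells_at l A)).
Unshelve. all: exact: (measurable_scale_tuple l). Qed.

End typical_cell_count.

Lemma mean_cells_at l dO (Om : measurableType dO) (P : probability Om R)
    (intensity : set X -> \bar R) (eta : Om -> set X) (A : set shapes) :
  is_poisson_process P intensity eta ->
  (forall B, measurable B -> intensity B = scaled_volume m l B) ->
  measurable A ->
  (\int[P]_w \esum_(C in hyperbolic_delaunay m.+2 (eta w))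
    (\1_unit_window (barycentre m.+2 C) *
     \1_[set cc_set K | K in A] (recentred m.+2 C))%R%:E) =
  ((m.+2)`!%:R^-1)%:E * cell_mass l A.
Proof.
move=> heta hI mA.
have [eta' [N0 [heta' mN0 PN0 etaE]]] := lf_poisson_scaled_volume heta hI.
have [N1 [mN1 PN1 simple']] := no_vertical_pairs heta'.
have [mc ic] := mean_tuple_count_cells_at heta' mA.
have fact0 : 0 <= ((m.+2)`!%:R^-1)%:E :> \bar R by rewrite lee_fin invr_ge0.
rewrite -ic -ge0_integralZl//; last by move=> w _; exact: tuple_count_ge0.
apply: (@ge0_integral_off_null _ _ _ _ _ _ (N0 `|` N1)).
- exact: measurableU.
- by apply: null_set_setU.
- by apply: emeasurable_funM.
- by move=> w; apply: esum_ge0 => C _; rewrite lee_fin mulr_ge0.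
- by move=> w; rewrite mule_ge0// tuple_count_ge0.
- move=> w nN; rewrite -(etaE w) => [|h]; last by apply: nN; left.
  by apply: tuple_count_cells_at; apply: simple' => h; apply: nN; right.
Qed.

End cell_tuples_at_origin.

(** * The half-ball as the heights are flattened *)

Section flat_limit.
Context {R : realType} {m : nat}.
Local Notation X := ('rV[R]_m.+1 * R)%type.
Local Notation tuples := (tuple_space X m.+2).
Implicit Type t : tuples.

(** The velocity of the centre with respect to l^2. *)
Definition tilt t : 'rV[R]_m.+1 :=
  ((\det (edges (vertices t)))^-1 *: (\adj (edges (vertices t)) *m
     \col_i (((tnth t (lift ord0 i)).2 ^+ 2 - (tnth t ord0).2 ^+ 2) / 2)))^T.

Lemma center_scale_tuple l t :
  center (tnth (scale_tuple l t)) = center (tnth (scale_tuple 0 t)) + l ^+ 2 *: tilt t.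
Proof.
have edgesE s : edges (fun i => (tnth (scale_tuple s t) i).1) = edges (vertices t).
  by rewrite -[X in edges X]/(vertices _) vertices_scale_tuple.
rewrite /center !edgesE /tilt.
rewrite (_ : sphere_rhs (tnth (scale_tuple l t)) = sphere_rhs (tnth (scale_tuple 0 t)) +
   l ^+ 2 *: \col_i (((tnth t (lift ord0 i)).2 ^+ 2 - (tnth t ord0).2 ^+ 2) / 2)).
  rewrite !tnth_mktuple /= -addrA; congr (_ + _).
  rewrite mulmxDr scalerDr raddfD/=; congr (_ + _).
  by rewrite -scalemxAr scalerA mulrC -scalerA linearZ.
apply/matrixP => i j; rewrite !mxE !tnth_mktuple /= !mul0r.
by set a := enorm _; field.
Qed.

(** The velocity of the power of the point z with respect to l^2. *)
Definition bend t (z : X) : R := z.2 ^+ 2 - (tnth t ord0).2 ^+ 2 -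
  2 * \sum_i (z.1 - (tnth t ord0).1) ord0 i * tilt t ord0 i.

(** The power of the point z, scaled to height l * z.2, with respect to the
    sphere through the scaled tuple; it is negative inside. *)
Definition sphere_power l t (z : X) : R :=
  enorm (z.1 - center (tnth (scale_tuple l t))) ^+ 2 + (l * z.2) ^+ 2 -
  rad2 (tnth (scale_tuple l t)).

(** The terms of order l^4 cancel because the point 0 of the tuple is on the sphere. *)
Lemma sphere_powerE l t z :
  sphere_power l t z = sphere_power 0 t z + l ^+ 2 * bend t z.
Proof.
rewrite /sphere_power /rad2 !tnth_mktuple /= center_scale_tuple !mul0r.
move: (center (tnth (scale_tuple 0 t))) => c.
have shift u : enorm (u - (c + l ^+ 2 *: tilt t)) ^+ 2 = enorm (u - c) ^+ 2 +
    enorm (l ^+ 2 *: tilt t) ^+ 2 - 2 * \sum_i (u - c) ord0 i * (l ^+ 2 *: tilt t) ord0 i.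
  by rewrite opprD addrA enorm_sqrB.
rewrite !shift.
have -> : \sum_i (z.1 - c) ord0 i * (l ^+ 2 *: tilt t) ord0 i =
    l ^+ 2 * \sum_i (z.1 - (tnth t ord0).1) ord0 i * tilt t ord0 i +
    \sum_i ((tnth t ord0).1 - c) ord0 i * (l ^+ 2 *: tilt t) ord0 i.
  by rewrite mulr_sumr -big_split/=; apply: eq_bigr => i _; rewrite !mxE; ring.
by rewrite /bend; ring.
Qed.

Lemma void_massE l t : void_mass l (scale_tuple l t) =
  marked_volume m [set z | sphere_power l t z < 0].
Proof.
rewrite /void_mass /scaled_volume /pushforward; congr (marked_volume m _).
by apply/seteqP; split => z; rewrite /halfball/= /sphere_power subr_lt0.
Qed.

Lemma measurable_sphere_power l t : measurable_fun setT (sphere_power l t).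
Proof.
apply: measurable_funB => //; apply: measurable_funD.
  apply: measurable_enorm_sqr; apply: measurable_rowB; last exact: measurable_row_cst.
  by move=> k; exact: (measurableT_comp (measurable_coord k) measurable_fst).
by apply: measurable_funX; apply: measurable_funM => //; exact: measurable_snd.
Qed.

Lemma countable_sqr_eq (a b : R) : countable [set x : R | (x - a) ^+ 2 = b].
Proof.
apply: (@sub_countable _ _ _ [set a + Num.sqrt b; a - Num.sqrt b]); last first.
  by apply: finite_set_countable; exact: finite_set2.
apply: subset_card_le => x /= xb.
have : `|x - a| = Num.sqrt b by rewrite -xb sqrtr_sqr.
case: (ler0P (x - a)) => _ e; [right|left]; rewrite -e; ring.
Qed.

Lemma sphere_null t : marked_volume m [set z | sphere_power 0 t z = 0] = 0%E.
Proof.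
have [c cE0] : exists c, c = center (tnth (scale_tuple 0 t)) by exists (center (tnth (scale_tuple 0 t))).
pose S : set 'rV[R]_m.+1 := [set v | enorm (v - c) ^+ 2 = cst (rad2 (tnth (scale_tuple 0 t))) v].
have mS : measurable S.
  apply: measurable_eq_fun => //; apply: measurable_enorm_sqr; apply: measurable_rowB.
    by move=> k; exact: measurable_coord.
  exact: measurable_row_cst.
have S0 : lebesgue_rV S = 0%E.
  apply: lebesgue_rV_null => // v.
  rewrite (_ : [set x | _] = [set x : R | (x - c ord0 ord0) ^+ 2 =
     rad2 (tnth (scale_tuple 0 t)) - \sum_(i < m) (v ord0 i - c ord0 (rshift 1 i)) ^+ 2]).
    exact: countable_sqr_eq.
  have cE x : enorm ((row_mx x%:M v : 'rV[R]_(1 + m)) - c) ^+ 2 =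
      (x - c ord0 ord0) ^+ 2 + \sum_(i < m) (v ord0 i - c ord0 (rshift 1 i)) ^+ 2.
    rewrite enorm_sqr (@big_split_ord _ _ _ 1)/= big_ord1; congr (_ + _).
      rewrite !mxE; case: split_ordP => j; last by move/(congr1 val).
      rewrite (ord1 j) !mxE eqxx mulr1n => _; congr ((_ - _) ^+ 2).
      by congr (c _ _); exact/val_inj.
    apply: eq_bigr => i _; rewrite !mxE; case: split_ordP => j.
      by move/(congr1 val) => /=; rewrite (ord1 j).
    by move/(@rshift_inj 1 m) => <-.
  apply/seteqP; split => x /=; rewrite /S/= cE => h; first by rewrite -h addrK.
  by rewrite h subrK.
rewrite (_ : [set z | _] = S `*` setT).
  by rewrite [LHS]product_measure1E// [X in (X * _)%E]S0 mul0e.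
apply/seteqP; split => z /=; rewrite /S/= /sphere_power -cE0 mul0r expr0n addr0.
  by move/eqP; rewrite subr_eq0 => /eqP.
by move=> [-> _]; rewrite subrr.
Qed.

End flat_limit.

Section void_mass_limit.
Context {R : realType} {m : nat}.
Local Notation X := ('rV[R]_m.+1 * R)%type.
Local Notation tuples := (tuple_space X m.+2).
Variable t : tuples.

Lemma scaled_halfballs_bounded : exists k, forall l z, l ^+ 2 <= 1 ->
  sphere_power l t z < 0 -> cylinder m k z.
Proof.
pose v := (tnth t ord0).1; pose y := (tnth t ord0).2.
pose c := center (tnth (scale_tuple 0 t)).
pose B : set X := [set z | exists2 l : R, l ^+ 2 <= 1 & sphere_power l t z < 0].
have [k Bk] : exists k, B `<=` cylinder m k.
  apply: (@bounded_cylinder _ _ _ v (2 * (enorm (v - c) + enorm (tilt t)) + `|y| + 1)).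
  move=> z [l l1]; rewrite /sphere_power /rad2 center_scale_tuple !tnth_mktuple /=.
  rewrite -/v -/y -/c; set cl := c + _ => h.
  have h1 : enorm (z.1 - cl) ^+ 2 < enorm (v - cl) ^+ 2 + (l * y) ^+ 2.
    have := sqr_ge0 (l * z.2); lra.
  have h2 : (l * y) ^+ 2 <= `|y| ^+ 2.
    by rewrite exprMn real_normK ?num_real// ler_piMl ?sqr_ge0.
  have h3 : enorm (v - cl) <= enorm (v - c) + enorm (tilt t).
    apply: le_trans (ler_enorm_dist c _ _) _; rewrite lerD2l /cl opprD addrA subrr sub0r.
    by rewrite enormN enormZ ger0_norm ?sqr_ge0// ler_piMl ?enorm_ge0.
  have h4 : enorm (z.1 - cl) < enorm (v - cl) + `|y| + 1.
    have := enorm_ge0 (z.1 - cl); have := enorm_ge0 (v - cl); have := normr_ge0 y; nra.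
  have := ler_enorm_dist cl z.1 v; rewrite (enormB cl v); lra.
by exists k => l z l1 h; apply: Bk; exists l.
Qed.

Let measurable_negative l : measurable [set z | sphere_power l t z < 0].
Proof. by apply: measurable_lt_fun => //; exact: measurable_sphere_power. Qed.

Local Open Scope ereal_scope.

(** Off the limiting sphere, a null set, the sign of the power of a point is
    eventually constant, and all the half-balls lie in one cylinder. *)
Lemma cvg_void_mass (u : R^nat) : u @ \oo --> (0%R : R) -> (forall j, (u j) ^+ 2 <= 1)%R ->
  void_mass (u j) (scale_tuple (u j) t) @[j --> \oo] --> void_mass 0 (scale_tuple 0 t).
Proof.
move=> u0 u1; have [k hk] := scaled_halfballs_bounded.
pose S (l : R) := [set z | sphere_power l t z < 0]%R.
pose N := [set z | sphere_power 0 t z = 0]%R.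
have mN : measurable N by apply: measurable_eq_fun => //; exact: measurable_sphere_power.
pose D := cylinder m k `\` N.
have mD : measurable D by apply: measurableD => //; exact: measurable_cylinder.
have vE (l : R) : (l ^+ 2 <= 1)%R ->
    void_mass l (scale_tuple l t) = \int[marked_volume m]_(z in D) (\1_(S l) z)%:E.
  move=> l1; have -> : void_mass l (scale_tuple l t) = marked_volume m (S l) by exact: void_massE.
  have mSD : measurable (S l `&` D) by apply: measurableI mD; exact: measurable_negative.
  have -> : \int[marked_volume m]_(z in D) (\1_(S l) z)%:E = marked_volume m (S l `&` D).
    by rewrite integral_indic; [|exact: mD|exact: measurable_negative].
  apply/eqP; rewrite eq_le; apply/andP; split; last first.
    apply: (le_measure (marked_volume m)); rewrite ?inE; [exact: mSD|exact: measurable_negative|].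
    exact: subIsetl.
  rewrite -[leRHS]adde0 -(sphere_null t).
  apply: le_trans (measureU2 (marked_volume m) mSD mN).
  apply: (le_measure (marked_volume m)); rewrite ?inE; first exact: measurable_negative.
    exact: measurableU.
  move=> z Sz; have [Nz|Nz] := pselect (N z); first by right.
  by left; split => //; split => //; exact: hk l1 Sz.
rewrite vE ?expr0n// ?ler01//.
under eq_fun => j do rewrite vE//.
apply: (@dominated_cvg _ _ _ (marked_volume m) D mD _ _ (cst 1)).
- move=> j; apply: measurable_funTS; apply/measurable_EFinP; apply: measurable_indic.
  exact: measurable_negative.
- move=> z [_ Nz].
  have q : (sphere_power (u j) t z @[j --> \oo] --> sphere_power 0 t z)%R.
    rewrite [X in _ --> X](_ : _ = (sphere_power 0 t z + 0 * 0 * bend t z)%R); last by ring.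
    under eq_fun do rewrite sphere_powerE expr2.
    by apply: cvgD; [exact: cvg_cst|apply: cvgMl; exact: cvgM].
  apply: cvg_near_cst.
  case: (ltgtP (sphere_power 0 t z) 0%R) => s; last by case: Nz.
    have lt0 : \forall j \near \oo, (sphere_power (u j) t z < 0)%R.
      by have := cvgr_lt _ q _ s; apply.
    apply: filterS lt0 => j h.
    by rewrite !indicE !mem_set.
  have gt0 : \forall j \near \oo, (0 < sphere_power (u j) t z)%R.
    by have := cvgr_gt _ q _ s; apply.
  apply: filterS gt0 => j h.
  by rewrite !indicE !memNset// /S/=; apply/negP; rewrite -leNgt ltW.
- by [].
- apply/integrableP; split; first exact: measurable_cst.
  under eq_integral do rewrite gee0_abs//.
  rewrite integral_cst// mul1e; apply: le_lt_trans (_ : marked_volume m (cylinder m k) < +oo).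
    apply: (le_measure (marked_volume m)); rewrite ?inE//; first exact: measurable_cylinder.
    exact: subDsetl.
  by rewrite marked_volume_cylinder ltry.
- move=> j z _; rewrite gee0_abs ?lee_fin// indicE; by case: (_ \in _).
Qed.

End void_mass_limit.

(** * Large cells are unlikely, uniformly in the scale *)

Section large_cells.
Context {R : realType} {m : nat}.
Local Notation X := ('rV[R]_m.+1 * R)%type.
Local Notation tuples := (tuple_space X m.+2).
Implicit Type t : tuples.

(** The mass of the heights in ]1, 2]. *)
Let band : R := m.+1%:R^-1 * (1 - 2^-1 ^+ m.+1).

Let band_gt0 : 0 < band.
Proof.
rewrite mulr_gt0 ?invr_gt0// subr_gt0 exprn_ilt1 ?invr_ge0//.
by rewrite invf_lt1// ltr1n.
Qed.

Let height_law_band : height_law m `]1, 2]%classic = band%:E.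
Proof.
have rayE (a : R) : 1 <= a -> height_law m `]a, +oo[%classic = (m.+1%:R^-1 * a^-1 ^+ m.+1)%:E.
  move=> a1; have := @pareto_ray R m.+1 (PosNum ltr01) a (ltn0Sn m).
  by rewrite /= (max_idPl a1) mul1r.
have eU : `]1, +oo[%classic = `]1, 2] `|` `]2, +oo[ :> set R.
  apply/seteqP; split => y /=; rewrite !in_itv/= !andbT.
    by move=> y1; case: (lerP y 2) => y2; [left; rewrite y1|right].
  by move=> [/andP[]//|y2]; apply: lt_trans y2; rewrite ltr1n.
have : (@height_law R m `]1%R, +oo[%classic =
    @height_law R m `]1%R, 2%R]%classic + @height_law R m `]2%R, +oo[%classic)%E.
  rewrite eU measureU//; apply/seteqP; split => // y /=; rewrite !in_itv/= andbT.
  by move=> [/andP[_ h] /lt_geF]; rewrite h.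
rewrite !rayE ?ler1n// invr1 expr1n mulr1 => e.
have fin : @height_law R m `]1%R, 2%R]%classic \is a fin_num.
  rewrite ge0_fin_numE; last exact: measure_ge0.
  apply: (@le_lt_trans _ _ (height_law m setT)); last by rewrite height_law_setT ltry.
  by apply: (le_measure (height_law m)); rewrite ?inE.
move: e; rewrite -(fineK fin) -EFinD => -[e]; congr EFin.
by rewrite /band mulrBr mulr1 [X in _ = X - _]e addrK.
Qed.

(** For l <= 1 the half-ball of radius r contains the points over a cube of half-side
    r / (2 n) around the centre with heights in ]1, 2], once r >= 4.  Their
    measure is a multiple of (r / n)^n, which is at least r / n for r >= n. *)
Lemma void_mass_ge l t (r : R) : 0 <= l <= 1 ->
  r = Num.sqrt (rad2 (tnth (scale_tuple l t))) -> m.+1%:R + 4 <= r ->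
  ((band / m.+1%:R * r)%:E <= void_mass l (scale_tuple l t))%E.
Proof.
move=> /andP[l0 l1] rE rbig.
have n0 : 0 < m.+1%:R :> R by rewrite ltr0n.
have r4 : 4 <= r by lra.
have rn : 1 <= r / m.+1%:R by rewrite ler_pdivlMr// mul1r; lra.
have a0 : 0 < r / (2 * m.+1%:R) by rewrite divr_gt0 ?mulr_gt0//; lra.
set c := center (tnth (scale_tuple l t)).
have vol : marked_volume m (ball c (r / (2 * m.+1%:R)) `*` `]1, 2]%classic) =
    (((r / m.+1%:R) ^+ m.+1) * band)%:E.
  rewrite [LHS]product_measure1E//; last exact: measurable_ball_rV.
  rewrite [X in (X * _)%E]lebesgue_rV_ball// [X in (_ * X)%E]height_law_band -EFinM.
  congr (_ ^+ _ * _)%:E; by field; rewrite gt_eqF.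
apply: (@le_trans _ _ (((r / m.+1%:R) ^+ m.+1) * band)%:E).
  rewrite lee_fin (_ : band / m.+1%:R * r = r / m.+1%:R * band); last by ring.
  by rewrite (ler_pM2r band_gt0) exprS ler_peMr ?exprn_ege1// ltW// (lt_le_trans ltr01).
rewrite -vol void_massE; apply: (le_measure (marked_volume m)); rewrite ?inE.
- by apply: measurableX => //; exact: measurable_ball_rV.
- by apply: measurable_lt_fun => //; exact: measurable_sphere_power.
move=> [v y] [/= vc]; rewrite in_itv/= => /andP[y1 y2].
rewrite /sphere_power /= -/c subr_lt0.
have h1 : enorm (v - c) < r / 2.
  apply: le_lt_trans (enorm_le_norm _) _.
  move: vc; rewrite mx_norm_ball /ball_/= distrC => vc.
  rewrite -ltr_pdivlMl//; apply: lt_le_trans vc _.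
  by rewrite le_eqVlt; apply/orP; left; apply/eqP; field; rewrite gt_eqF.
have h2 : enorm (v - c) ^+ 2 < r ^+ 2 / 4.
  have := enorm_ge0 (v - c); nra.
have ly0 : 0 <= l * y by rewrite mulr_ge0// ltW// (lt_trans ltr01).
have ly2 : l * y <= 1 * 2 by rewrite ler_pM// ltW// (lt_trans ltr01).
have h3 : (l * y) ^+ 2 <= 4 by move: (l * y) ly0 ly2 => b b0 b2; nra.
have : rad2 (tnth (scale_tuple l t)) = r ^+ 2.
  by rewrite rE sqr_sqrtr// addr_ge0// sqr_ge0.
by move=> ->; nra.
Qed.

Let size t : R := \sum_i enorm (vertices t i).

(** The vertices are within the circumradius of the centre, hence within twice the
    circumradius of their mean, which lies in the unit window. *)
Lemma circumradius_ge l t : cells_at setT t ->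
  size t <= m.+2%:R * (m.+1%:R + 2 * Num.sqrt (rad2 (tnth (scale_tuple l t)))).
Proof.
move=> [at_ wt _]; set r := Num.sqrt _.
have atl : affinely_independent (vertices (scale_tuple l t)).
  by rewrite vertices_scale_tuple.
set c := center (tnth (scale_tuple l t)).
have vc i : enorm (vertices t i - c) <= r.
  rewrite -[leLHS]ger0_norm ?enorm_ge0// -sqrtr_sqr ler_wsqrtr//.
  rewrite -((circumsphereP _ _ atl).2 (conj erefl erefl) i) -[(tnth _ i).1]/(vertices _ i).
  by rewrite vertices_scale_tuple -/c lerDl sqr_ge0.
have d0 : 0 < m.+2%:R :> R by rewrite ltr0n.
have mc : enorm (c - vertex_mean t) <= r.
  have -> : c - vertex_mean t = m.+2%:R^-1 *: \sum_i (c - vertices t i).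
    rewrite sumrB sumr_const card_ord scalerBr; congr (_ - _).
    by rewrite -[c *+ _]scaler_nat scalerA mulVf ?scale1r// gt_eqF.
  rewrite enormZ ger0_norm; last by rewrite invr_ge0 ltW.
  rewrite ler_pdivrMl//.
  apply: le_trans (enorm_sum _ _) _.
  rewrite mulr_natl -[X in _ *+ X]card_ord -sumr_const; apply: ler_sum => i _.
  by rewrite enormB; exact: vc.
have mn : enorm (vertex_mean t) <= m.+1%:R.
  rewrite -[leRHS]mulr1; apply: enorm_le_coord => // i; apply/ltW.
  by move/unit_windowP : wt; exact.
rewrite mulr_natl -[X in _ *+ X]card_ord -sumr_const; apply: ler_sum => i _.
have := ler_enorm_dist c (vertices t i) (vertex_mean t).
have := ler_enorm_dist (vertex_mean t) (vertices t i) 0; rewrite !subr0.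
have := vc i; lra.
Qed.

(** If r is the circumradius, the void probability is at most exp(a r0 - a r): for
    r >= r0 by [void_mass_ge], for r < r0 because it is at most 1.  The bound on r
    in terms of the vertices absorbs the constants. *)
Lemma void_probability_le : exists K k : R, [/\ 0 < K, 0 < k &
  forall l t, 0 <= l <= 1 -> cells_at setT t ->
    expR (- fine (void_mass l (scale_tuple l t))) <= K * expR (- (k * size t))].
Proof.
pose a := band / m.+1%:R; pose r0 : R := m.+1%:R + 4.
have a0 : 0 < a by rewrite divr_gt0.
have d0 : 0 < m.+2%:R :> R by rewrite ltr0n.
exists (expR (a * r0 + a * m.+1%:R / 2)), (a / (2 * m.+2%:R)); split.
- exact: expR_gt0.
- by rewrite divr_gt0// mulr_gt0.
move=> l t l01 ct; rewrite -expRD ler_expR.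
set r := Num.sqrt (rad2 (tnth (scale_tuple l t))).
have h0 : 0 <= fine (void_mass l (scale_tuple l t)) by apply: fine_ge0; exact: measure_ge0.
have hr : - fine (void_mass l (scale_tuple l t)) <= a * r0 - a * r.
  case: (leP r0 r) => rr0.
    have := void_mass_ge l01 erefl rr0.
    rewrite -[X in (_ <= X)%E]fineK; last by rewrite ge0_fin_numE ?void_mass_lty//; exact: measure_ge0.
    rewrite lee_fin -/a -/r => h.
    have : 0 <= a * r0 by rewrite mulr_ge0 ?(ltW a0)// addr_ge0.
    lra.
  have : 0 <= a * (r0 - r) by rewrite mulr_ge0 ?(ltW a0)// subr_ge0 ltW.
  rewrite mulrBr; lra.
have := circumradius_ge l ct; rewrite -/r => sr.
have : a / (2 * m.+2%:R) * size t <= a * m.+1%:R / 2 + a * r.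
  rewrite (_ : a * m.+1%:R / 2 + a * r = a / (2 * m.+2%:R) * (m.+2%:R * (m.+1%:R + 2 * r))).
    by rewrite ler_pM2l// divr_gt0// mulr_gt0.
  by field; rewrite gt_eqF.
set A := a / _ * _; set B := a * _ / 2; lra.
Qed.

End large_cells.

(** * An integrable majorant *)

Section envelope.
Context {R : realType} {m : nat}.
Local Notation X := ('rV[R]_m.+1 * R)%type.
Local Notation tuples := (tuple_space X m.+2).

Lemma exprn_le_expR (q : nat) (x : R) : 0 <= x -> x ^+ q.+1 <= q.+1%:R ^+ q.+1 * expR x.
Proof.
move=> x0; have q0 : 0 < q.+1%:R :> R by rewrite ltr0n.
have -> : expR x = expR (x / q.+1%:R) ^+ q.+1.
  by rewrite -expRM_natl mulrC divfK// gt_eqF.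
rewrite -exprMn; apply: lerXn2r; rewrite ?nnegrE ?mulr_ge0 ?expR_ge0// ?(ltW q0)//.
rewrite -ler_pdivrMl// mulrC; apply: le_trans (expR_ge1Dx _); by rewrite lerDr.
Qed.

Lemma nneseries_geometric_lty (a : nat -> R) (C z : R) : 0 <= z < 1 -> 0 <= C ->
  (forall j, 0 <= a j <= C * z ^+ j) -> (\sum_(j <oo) (a j)%:E < +oo)%E.
Proof.
move=> /andP[z0 z1] C0 aC.
apply: (@le_lt_trans _ _ (C / (1 - z))%:E); last by rewrite ltry.
apply: lime_le.
  by apply: is_cvg_nneseries => j _ _; rewrite lee_fin; have /andP[] := aC j.
near=> N; rewrite sumEFin lee_fin.
apply: (@le_trans _ _ (series (geometric C z) N)).
  by apply: ler_sum => j _; have /andP[] := aC j.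
rewrite geometric_seriesE; last by rewrite lt_eqF.
by rewrite /= ler_pdivrMr ?subr_gt0// divfK ?gt_eqF ?subr_gt0// ler_piMr// gerBl exprn_ge0.
Unshelve. all: by end_near. Qed.

Variable M : {measure set tuples -> \bar R}.
Hypothesis M_rectangle : forall B : 'I_m.+2 -> set X, (forall i, measurable (B i)) ->
  M (rectangle B) = (\prod_(i < m.+2) marked_volume m (B i))%E.

Lemma measurable_tuple_size :
  measurable_fun setT (fun t : tuples => \sum_i enorm (vertices t i)).
Proof.
apply: measurable_sum => i; apply: measurable_enorm.
exact: measurable_row_tnth_vertex.
Qed.

(** A tuple whose size is between j and j + 1 has all its points in the cylinder j;
    the measure of these tuples grows like a power of j, while the majorant is
    exponentially small on them. *)
Lemma integrable_envelope (K k : R) : 0 < K -> 0 < k ->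
  M.-integrable setT (fun t : tuples => (K * expR (- (k * \sum_i enorm (vertices t i))))%:E).
Proof.
move=> K0 k0; pose g (t : tuples) := K * expR (- (k * \sum_i enorm (vertices t i))).
have mg : measurable_fun setT g.
  apply: measurable_funM => //; apply: measurableT_comp => //; apply: measurableT_comp => //.
  by apply: measurable_funM => //; exact: measurable_tuple_size.
have g0 t : 0 <= g t by rewrite mulr_ge0 ?expR_ge0// ltW.
apply/integrableP; split; first by apply/measurable_EFinP.
under eq_integral do rewrite gee0_abs ?lee_fin ?g0//.
pose C j : set tuples := rectangle (fun _ => cylinder m j).
have mC j : measurable (C j) by apply: measurable_rectangle => i; exact: measurable_cylinder.
pose a (j : nat) : R := K * expR (- (k * j%:R)).
have a0 j : 0 <= a j by rewrite mulr_ge0 ?expR_ge0// ltW.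
pose G (t : tuples) : \bar R := (\sum_(j <oo) (a j * \1_(C j) t)%:E)%E.
have mt j : measurable_fun setT (fun t : tuples => (a j * \1_(C j) t)%:E).
  by apply/measurable_EFinP; apply: measurable_funM => //; exact: measurable_indic.
have t0 j (t : tuples) : (0 <= (a j * \1_(C j) t)%:E)%E by rewrite lee_fin mulr_ge0.
have gG t : ((g t)%:E <= G t)%E.
  pose s := \sum_i enorm (vertices t i).
  have s0 : 0 <= s by apply: sumr_ge0 => i _; exact: enorm_ge0.
  have /andP[j1 j2] := truncn_itv s0; set j := Num.truncn s in j1 j2.
  apply: (@le_trans _ _ (a j * \1_(C j) t)%:E).
    rewrite indicE mem_set ?mulr1 ?lee_fin ?ler_pM2l ?ler_expR ?lerN2 ?ler_pM2l//.
    move=> i; split => //=; rewrite mx_norm_ball /ball_/= sub0r normrN.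
    apply: le_lt_trans (le_norm_enorm _) (le_lt_trans _ j2).
    by rewrite /s (bigD1 i)//= lerDl; apply: sumr_ge0 => l _; exact: enorm_ge0.
  rewrite /G (nneseriesD1 (n := j))// leeDl//.
  by apply: nneseries_ge0 => l _ _.
apply: (@le_lt_trans _ _ (\int[M]_t G t)%E).
  apply: ge0_le_integral => //.
  - by move=> t _; exact: g0.
  - exact/measurable_EFinP.
  - exact: ge0_emeasurable_sum.
  - by move=> t _; exact: gG.
rewrite integral_nneseries//.
pose b : R := (2 ^+ m.+1 / m.+1%:R) ^+ m.+2.
have intC j : (\int[M]_t (a j * \1_(C j) t)%:E = (a j * (b * j.+1%:R ^+ (m.+1 * m.+2)))%:E)%E.
  under eq_integral do rewrite EFinM.
  rewrite ge0_integralZl//; [|by apply/measurable_EFinP; exact: measurable_indic|by rewrite lee_fin].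
  rewrite integral_indic// setIT M_rectangle; last by move=> i; exact: measurable_cylinder.
  under eq_bigr do rewrite marked_volume_cylinder.
  rewrite prodEFin prodr_const card_ord -EFinM; congr (_ * _)%:E.
  by rewrite /b exprM -exprMn; congr (_ ^+ _); rewrite exprMn mulrAC.
under eq_eseriesr => j _ do rewrite intC.
have b0 : 0 <= b by rewrite exprn_ge0// divr_ge0// exprn_ge0.
clearbody b.
pose q := (m.+1 * m.+2).-1; have qE : (m.+1 * m.+2)%N = q.+1 by [].
clearbody q.
have u0 : 0 <= (2 / k) ^+ q.+1 by rewrite exprn_ge0// divr_ge0// ltW.
have w0 : 0 <= (q.+1%:R : R) ^+ q.+1 by rewrite exprn_ge0.
pose z := expR (- (k / 2)).
apply: (@nneseries_geometric_lty _ (K * b * ((2 / k) ^+ q.+1 * (q.+1%:R ^+ q.+1 * expR (k / 2)))) z).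
- by rewrite expR_ge0 expR_lt1 oppr_lt0 divr_gt0.
- apply: mulr_ge0; first by rewrite mulr_ge0// ltW.
  by rewrite mulr_ge0// mulr_ge0// expR_ge0.
- move=> j; rewrite qE; apply/andP; split; first by rewrite mulr_ge0// mulr_ge0// exprn_ge0.
  have x0 : 0 <= k * j.+1%:R / 2 by rewrite divr_ge0// mulr_ge0// ltW.
  (* Half of the exponential decay pays for the polynomial growth. *)
  have -> : (j.+1%:R : R) ^+ q.+1 = (2 / k) ^+ q.+1 * (k * j.+1%:R / 2) ^+ q.+1.
    by rewrite -exprMn; congr (_ ^+ _); field; rewrite gt_eqF.
  rewrite /a.
  have := exprn_le_expR q x0.
  set Y := _ ^+ _ => hY.
  apply: (@le_trans _ _ (K * expR (- (k * j%:R)) * (b * ((2 / k) ^+ q.+1 * (q.+1%:R ^+ q.+1 * expR (k * j.+1%:R / 2)))))).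
    rewrite ler_wpM2l ?mulr_ge0 ?expR_ge0 ?(ltW K0)// ler_wpM2l//.
    by rewrite ler_wpM2l// exprn_ge0// divr_ge0// ltW.
  rewrite le_eqVlt; apply/orP; left; apply/eqP.
  rewrite /z -expRM_natl.
  have -> : expR (k * j.+1%:R / 2) = expR (k * j%:R / 2) * expR (k / 2).
    by rewrite -expRD; congr expR; rewrite -[in LHS]natr1; field.
  have -> : expR (j%:R * - (k / 2)) = expR (- (k * j%:R)) * expR (k * j%:R / 2).
    by rewrite -expRD; congr expR; field.
  ring.
Qed.

End envelope.

(** * Convergence of the laws of the typical cells *)

Section cell_mass_limit.
Context {R : realType} {m : nat}.
Local Notation X := ('rV[R]_m.+1 * R)%type.
Local Notation tuples := (tuple_space X m.+2).
Local Notation shapes := (compact_convex R m.+1).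
Variable M : {measure set tuples -> \bar R}.
Hypothesis M_rectangle : forall B : 'I_m.+2 -> set X, (forall i, measurable (B i)) ->
  M (rectangle B) = (\prod_(i < m.+2) marked_volume m (B i))%E.

Let void_probability (l : R) (t : tuples) : R :=
  expR (- fine (void_mass l (scale_tuple l t))).

Let measurable_void_probability l :
  measurable_fun setT (fun t : tuples => (void_probability l t)%:E : \bar R).
Proof.
apply/measurable_EFinP; apply: measurableT_comp => //; apply: measurableT_comp => //.
apply: measurableT_comp => //.
exact: (measurableT_comp (measurable_void_mass l) (measurable_scale_tuple l)).
Qed.

Let cells_atT A : cells_at A `<=` (cells_at setT : set tuples).
Proof. by move=> t []; split. Qed.

Lemma cvg_cell_mass (A : set shapes) (u : R^nat) : measurable A ->
  u @ \oo --> (0 : R) -> (forall j, 0 <= u j <= 1) ->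
  (cell_mass M (u j) A @[j --> \oo] --> cell_mass M 0 A)%E.
Proof.
move=> mA u0 u01.
have [K [k [K0 k0 hK]]] := @void_probability_le R m.
have mc := measurable_cells_at mA.
rewrite /cell_mass.
apply: (@dominated_cvg _ _ _ M (cells_at A) mc (fun j t => (void_probability (u j) t)%:E) _
  (fun t => (K * expR (- (k * \sum_i enorm (vertices t i))))%:E)).
- by move=> j; apply: measurable_funTS; exact: measurable_void_probability.
- move=> t _; apply: cvg_expRN_fine.
    by rewrite ge0_fin_numE ?void_mass_lty//; exact: measure_ge0.
  apply: cvg_void_mass => // j; have /andP[h0 h1] := u01 j.
  by rewrite exprn_ile1.
- by [].
- apply: (@integrableS _ _ _ _ setT) => //; exact: integrable_envelope.
- move=> j t /cells_atT ct; rewrite gee0_abs ?lee_fin ?expR_ge0//.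
  exact: hK.
Qed.

End cell_mass_limit.

Section setwise_convergence.
Context {d} {T : measurableType d} {R : realType}.

(** After adding a constant f is nonnegative, and its integral is the integral over
    r of the masses of [f > r], to which dominated convergence applies. *)
Lemma cvg_integral_setwise (Q : nat -> probability T R) (Q0 : probability T R)
    (f : T -> R) : measurable_fun setT f -> bounded_fun f ->
  (forall A, measurable A -> (Q j A @[j --> \oo] --> Q0 A)%E) ->
  \int[Q j]_x f x @[j --> \oo] --> \int[Q0]_x f x.
Proof.
move=> mf bf QQ.
have [B [B0 fB]] : exists B : R, 0 < B /\ forall x, `|f x| <= B.
  have [b [_ hb]] := bf; exists (Num.max b 0 + 1); split.
    by rewrite ltr_wpDl// le_max lexx orbT.
  move=> x; apply: (hb (Num.max b 0 + 1)) => //.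
  by rewrite (@le_lt_trans _ _ (Num.max b 0))// ?le_max ?lexx// ltrDl.
pose F x := f x + B.
have mF : measurable_fun setT F by exact: measurable_funD.
have F0 x : 0 <= F x by have := fB x; rewrite ler_norml /F => /andP[]; lra.
have F2 x : F x <= 2 * B by have := fB x; rewrite ler_norml /F => /andP[]; lra.
pose X : {mfun T >-> R} := HB.pack F (@isMeasurableFun.Build _ _ _ _ F mF).
have ccdfE (Q' : probability T R) r : ccdf (P := Q') X r = Q' [set x | r < F x].
  rewrite /ccdf /distribution /pushforward; congr (Q' _).
  by apply/seteqP; split => x /=; rewrite in_itv/= andbT.
have mray r : measurable [set x | r < F x] by exact: measurable_lt_fun.
have EF (Q' : probability T R) : (\int[Q']_x (F x)%:E =
    \int[lebesgue_measure]_(r in `[0%R, +oo[) ccdf (P := Q') X r)%E.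
  have := @ge0_expectation_ccdf _ _ _ Q' X; rewrite unlock => <- //.
(* The masses of [F > r] are at most 1 and vanish for r > 2 B. *)
have cvgF : (\int[Q j]_x (F x)%:E @[j --> \oo] --> \int[Q0]_x (F x)%:E)%E.
  rewrite EF; under eq_fun do rewrite EF.
  have mD : measurable (`[0%R, +oo[%classic : set R) by [].
  apply: (@dominated_cvg _ _ _ lebesgue_measure _ mD _ _
    (fun r => (\1_`[0, 2 * B]%classic r)%:E)).
  - by move=> j; apply: measurable_funTS; exact: ccdf_measurable.
  - by move=> r _; rewrite ccdfE; under eq_fun do rewrite ccdfE; exact: QQ.
  - by [].
  - apply/integrableP; split; first by apply/measurable_EFinP; exact: measurable_indic.
    under eq_integral do rewrite gee0_abs ?lee_fin//.
    rewrite integral_indic//.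
    apply: (@le_lt_trans _ _ (lebesgue_measure `[0, 2 * B]%classic)).
      by apply: le_measure; rewrite ?inE//; exact: measurableI.
    by rewrite lebesgue_measure_itv/=; case: ifP => _; rewrite ?ltry// -EFinB ltry.
  - move=> j r; rewrite /= in_itv/= andbT => r0; rewrite ccdfE gee0_abs//.
    rewrite indicE; case: (boolP (r \in _)) => [_|rn]; first exact: probability_le1.
    rewrite (_ : [set x | _] = set0) ?measure0//; apply/seteqP; split => // x /= rx.
    move/negP: rn; apply; apply/mem_set; rewrite /= in_itv/= r0/=.
    exact: le_trans (ltW rx) (F2 x).
have finF (Q' : probability T R) : Q'.-integrable setT (EFin \o F).
  apply: measurable_bounded_integrable => //; first by rewrite -ge0_fin_numE// fin_num_measure.
  exists (2 * B); split; first exact: num_real.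
  by move=> b hb x _ /=; rewrite ger0_norm ?F0//; exact: le_trans (F2 x) (ltW hb).
have fE (Q' : probability T R) : \int[Q']_x f x = fine (\int[Q']_x (F x)%:E)%E - B.
  rewrite -[RHS]/(Rintegral Q' setT F - B).
  rewrite (_ : f = (fun x => F x - cst B x)); last by apply/funext => x; rewrite /F/= addrK.
  rewrite RintegralB//; [|exact: finF|exact: finite_measure_integrable_cst].
  congr (_ - _); transitivity (B * fine (Q' setT)); first exact: Rintegral_cst.
  by rewrite probability_setT mulr1.
rewrite fE; under eq_fun do rewrite fE.
apply: cvgB; last exact: cvg_cst.
apply: fine_cvg; rewrite fineK//; exact: (integrable_fin_num measurableT (finF Q0)).
Qed.

End setwise_convergence.

(** * The typical cell as a quotient of cell masses *)

Section typical_cell_ratio.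
Context {R : realType} {m : nat}.
Local Notation X := ('rV[R]_m.+1 * R)%type.
Local Notation tuples := (tuple_space X m.+2).
Local Notation shapes := (compact_convex R m.+1).
Variable M : {measure set tuples -> \bar R}.
Hypothesis M_rectangle : forall B : 'I_m.+2 -> set X, (forall i, measurable (B i)) ->
  M (rectangle B) = (\prod_(i < m.+2) marked_volume m (B i))%E.

Lemma unit_window_admissible : [/\ measurable (@unit_window R m),
  bounded_set (@unit_window R m) & (0 < lebesgue_rV (@unit_window R m))%E].
Proof.
split; first exact: measurable_ball_rV.
  exists 1; split => // r r1 v /unit_windowP h; apply: le_trans (ltW r1).
  by apply: norm_rV_le => // i; exact/ltW/h.
by rewrite lebesgue_rV_ball// lte_fin exprn_gt0// mulr_gt0.
Qed.

(** For the unit window the law is a multiple of the cell mass; since its total mass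
    is 1, the cell intensity, the volume of the window and the number of orderings
    cancel. *)
Lemma typical_cell_ratio l dO (Om : measurableType dO) (P : probability Om R)
    (intensity : set X -> \bar R) (eta : Om -> set X) (Z : probability shapes R) :
  is_poisson_process P intensity eta ->
  (forall B, measurable B -> intensity B = scaled_volume m l B) ->
  is_typical_cell_law m.+2 P (fun w => hyperbolic_delaunay m.+2 (eta w)) Z ->
  [/\ cell_mass M l setT \is a fin_num, fine (cell_mass M l setT) != 0 &
    forall A, measurable A -> cell_mass M l A \is a fin_num /\
      Z A = (fine (cell_mass M l A) / fine (cell_mass M l setT))%:E].
Proof.
move=> heta hI [xi xi0 hZ].
have [mW bW W0] := unit_window_admissible.
have [_ ZE] := hZ _ mW bW W0.
have vW : 0 < fine (lebesgue_rV (@unit_window R m)).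
  by apply: fine_gt0; rewrite W0 lebesgue_rV_ball// ltry.
pose k : R := (xi * fine (lebesgue_rV (@unit_window R m)))^-1 * ((m.+2)`!%:R)^-1.
have k0 : 0 < k by rewrite mulr_gt0// invr_gt0 ?mulr_gt0// ltr0n fact_gt0.
have ZkE A : measurable A -> (Z A = k%:E * cell_mass M l A)%E.
  by move=> mA; rewrite ZE// (mean_cells_at M_rectangle heta hI mA) muleA -EFinM.
have JE A : measurable A -> (cell_mass M l A = (k^-1)%:E * Z A)%E.
  by move=> mA; rewrite ZkE// muleA -EFinM mulVf ?gt_eqF// mul1e.
have JT : (cell_mass M l setT = (k^-1)%:E)%E.
  by rewrite JE// probability_setT mule1.
have Jfin A : measurable A -> cell_mass M l A \is a fin_num.
  by move=> mA; rewrite JE// fin_numM// fin_num_measure.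
split; [by rewrite JT|by rewrite JT/= invr_neq0// gt_eqF|move=> A mA; split; first exact: Jfin].
by rewrite JT/= invrK mulrC EFinM fineK ?Jfin// ZkE.
Qed.

End typical_cell_ratio.

(** * The classical Poisson-Delaunay tessellation at height 0 *)

Section flat_poisson_process.
Context {R : realType} {m : nat}.
Local Notation V := 'rV[R]_m.+1.

Definition ground (v : V) : V * R := (v, 0).

Lemma counting_ground (E : set V) (B : set (V * R)) :
  counting ((ground @` E) `&` B) = counting (E `&` ground @^-1` B) :> \bar R.
Proof.
have ginj : injective ground by move=> u v [].
have -> : (ground @` E) `&` B = ground @` (E `&` ground @^-1` B).
  apply/seteqP; split => z.
    by move=> [[v Ev <-] Bv]; exists v.
  by move=> [v [Ev Bv] <-]; split => //; exists v.
set A := E `&` _.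
rewrite /counting; case: ifPn => [/asboolP fA|/asboolPn nA].
  have fA' : finite_set A.
    rewrite (_ : A = (fun z : V * R => z.1) @` (ground @` A)); first exact: finite_image.
    by rewrite image_comp image_id.
  by rewrite asboolT// fset_set_image// card_imfset.
by rewrite asboolF// => fA; apply: nA; exact: finite_image.
Qed.

Lemma poisson_ground dO (Om : measurableType dO) (P : probability Om R)
    (intensity : set V -> \bar R) (eta : Om -> set V) :
  is_poisson_process P intensity eta ->
  is_poisson_process P (fun B => intensity (ground @^-1` B)) (fun w => ground @` eta w).
Proof.
move=> [h1 h2 h3].
have mg (B : set (V * R)) : measurable B -> measurable (ground @^-1` B).
  have : measurable_fun setT ground by exact: measurable_fun_pair.
  by move=> mf mB; rewrite -[_ @^-1` _]setTI; exact: mf.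
have NE B : (fun w => counting (ground @` eta w `&` B)) =
    (fun w => counting (eta w `&` ground @^-1` B) : \bar R).
  by apply/funext => w; exact: counting_ground.
split.
- by move=> B mB; rewrite NE; apply: h1; exact: mg.
- move=> B r k mB Ir; rewrite -(h2 _ r k (mg _ mB) Ir); congr (P _).
  by apply/seteqP; split => w /=; rewrite counting_ground.
- move=> n B U mB tB mU.
  have := h3 n (fun i => ground @^-1` B i) U (fun i => mg _ (mB i)) _ mU.
  rewrite (_ : [set w | forall i, U i (counting (eta w `&` ground @^-1` B i))] =
    [set w | forall i, U i (counting (ground @` eta w `&` B i))]); last first.
    by apply/seteqP; split => w /= h i; have := h i; rewrite counting_ground.
  move=> ->; last by move=> i j _ _ [v [h h']]; apply: tB => //; exists (ground v).
  apply: eq_bigr => i _; congr (P _).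
  by apply/seteqP; split => w /=; rewrite counting_ground.
Qed.

Lemma delaunay_ground (E : set V) :
  delaunay m.+2 E = hyperbolic_delaunay m.+2 (ground @` E).
Proof.
have eq_radius (w v : V) (r : R) : 0 < r ->
    (enorm (v - w) ^+ 2 + 0 ^+ 2 = r ^+ 2) <-> enorm (v - w) = r.
  move=> r0; rewrite expr0n addr0; split => [/eqP|-> //].
  by rewrite eqrXn2 ?enorm_ge0 ?(ltW r0)// => /eqP.
have lt_radius (w v : V) (r : R) : 0 < r ->
    (enorm (v - w) ^+ 2 + 0 ^+ 2 < r ^+ 2) = (enorm (v - w) < r).
  by move=> r0; rewrite expr0n addr0 ltr_pXn2r// nnegrE ?enorm_ge0// ltW.
apply/seteqP; split => C.
  move=> [x [xinj Ex ax [w [r [r0 xr er]]] ->]].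
  exists (ground \o x); split => //.
  - by move=> i j [/xinj].
  - by move=> i; exists (x i).
  - exists w, r; split => // [i|q [v Ev <-]]; first exact: ((eq_radius _ _ _ r0).2 (xr i)).
    by rewrite /= lt_radius//; exact: er.
move=> [p [pinj Ep ap [w [r [r0 pr er]]] ->]].
have pE i : p i = ground (p i).1 by have [v _ <-] := Ep i.
exists (fun i => (p i).1); split => //.
- by move=> i j pij; apply: pinj; rewrite pE pij -pE.
- by move=> i; have [v Ev <-] := Ep i.
- exists w, r; split => // [i|q Eq].
    by apply/(eq_radius _ _ _ r0); have := pr i; rewrite [in X in _ + X]pE.
  by rewrite -lt_radius//; apply: (er (ground q)); exists q.
Qed.

End flat_poisson_process.

(** * The limit theorem *)

Lemma measurable_continuous_shape {R : realType} {n : nat}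
    (f : compact_convex R n -> R) : continuous f -> measurable_fun setT f.
Proof.
move=> cf; apply: (measurability _ (RGenOInfty.measurableE R)) => _ [_ [x ->] <-].
rewrite setTI; apply: sub_gen_smallest.
apply: open_comp; last exact: interval_open.
by move=> K _; exact: cf.
Qed.

Theorem corollary13 (R : realType) (d : nat) (hd : (2 <= d)%N)
  (dO : R -> measure_display) (Omega : forall lambda : R, measurableType (dO lambda))
  (P : forall lambda : R, probability (Omega lambda) R)
  (eta : forall lambda : R, Omega lambda -> set ('rV[R]_d.-1 * R))
  (Z : R -> probability (compact_convex R d.-1) R)
  (dPD : measure_display) (OmegaPD : measurableType dPD)
  (PPD : probability OmegaPD R)
  (etaPD : OmegaPD -> set 'rV[R]_d.-1)
  (ZPD : probability (compact_convex R d.-1) R)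
  (heta : forall lambda : R, 0 < lambda ->
     is_poisson_process (P lambda)
       (horoball_intensity d (lambda ^+ d.-1) lambda) (@eta lambda))
  (hZ : forall lambda : R, 0 < lambda ->
     is_typical_cell_law d (P lambda)
       (fun w => hyperbolic_delaunay d (@eta lambda w)) (Z lambda))
  (hetaPD : is_poisson_process PPD
     (homogeneous_intensity (d.-1%:R)^-1) etaPD)
  (hZPD : is_typical_cell_law d PPD (fun w => delaunay d (etaPD w)) ZPD) :
  weakly_converges Z 0^'+ ZPD.
Proof.
case: d hd eta Z etaPD ZPD heta hZ hetaPD hZPD => [|[|m]] // _ eta Z etaPD ZPD.
rewrite /= => heta hZ hetaPD hZPD.
have [M M_rectangle] := @tuple_product_measure _ _ R (marked_volume m) m.+2.
have ratio l : 0 < l -> [/\ cell_mass M l setT \is a fin_num,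
    fine (cell_mass M l setT) != 0 & forall A, measurable A ->
    cell_mass M l A \is a fin_num /\
    Z l A = (fine (cell_mass M l A) / fine (cell_mass M l setT))%:E].
  move=> l0; apply: (typical_cell_ratio M_rectangle (heta l l0) _ (hZ l l0)) => B mB.
  exact: horoball_intensityE.
have [J0_fin J0_neq0 ratio0] : [/\ cell_mass M 0 setT \is a fin_num,
    fine (cell_mass M 0 setT) != 0 & forall A, measurable A ->
    cell_mass M 0 A \is a fin_num /\
    ZPD A = (fine (cell_mass M 0 A) / fine (cell_mass M 0 setT))%:E].
  apply: (typical_cell_ratio M_rectangle (poisson_ground hetaPD)).
    by move=> B mB; exact: homogeneous_intensityE.
  by under eq_fun do rewrite -delaunay_ground.
move=> f cf bf.
have mf := measurable_continuous_shape cf.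
apply/cvg_at_rightP => u [u_gt0 u0].
(* The majorant is uniform for scales in [0, 1] only, so the sequence is shifted. *)
have [N uN] : exists N, forall j, u (j + N)%N <= 1.
  have : \forall j \near \oo, u j < 1 by have := cvgr_lt _ u0 _ ltr01; apply.
  by move=> [N _ hN]; exists N => j; apply/ltW/hN => /=; rewrite leq_addl.
rewrite -(cvg_shiftn N)/=.
have v0 : u (j + N)%N @[j --> \oo] --> (0 : R) by rewrite (cvg_shiftn N).
have v01 j : 0 <= u (j + N)%N <= 1 by rewrite (ltW (u_gt0 _)) uN.
apply: cvg_integral_setwise => // A mA.
have [fin0 ->] := ratio0 A mA.
rewrite (_ : (fun j => Z (u (j + N)%N) A) = fun j =>
  (fine (cell_mass M (u (j + N)%N) A) / fine (cell_mass M (u (j + N)%N) setT))%:E).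
  apply: cvg_EFin; first by near=> j.
  apply: cvgM; first by apply: fine_cvg; rewrite fineK//; exact: cvg_cell_mass.
  by apply: cvgV => //; apply: fine_cvg; rewrite fineK//; exact: cvg_cell_mass.
by apply/funext => j; have [_ _ /(_ A mA)[_ ->]] := ratio _ (u_gt0 (j + N)%N).
Unshelve. all: by end_near. Qed.
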